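(* For every real $\omega>1$, the set $\Omega^*_\omega=\{x\in\mathbb{R}:\omega^*(x)\ge\omega\}$ is $(1/\omega)$-describable in $\mathbb{R}$ (with $d=1$).
   Context: $\mathbb{A}_n$ is the set of real algebraic numbers of degree at most $n$; for a real algebraic number $a$, $\mathrm{H}(a)$ is the maximum of the absolute values of the coefficients of its minimal defining polynomial over $\mathbb{Z}$. For $n\ge1$ and $\omega>-1$, $K^*_{n,\omega}=\{x\in\mathbb{R}:|x-a|<\mathrm{H}(a)^{-\omega-1}\text{ for infinitely many }a\in\mathbb{A}_n\}$; $\omega^*_n(x)=\sup\{\omega>-1:x\in K^*_{n,\omega}\}$ and $\omega^*(x)=\limsup_{n\to\infty}\omega^*_n(x)/n$. Fix $d\ge1$ and a norm $|\cdot|$ on $\mathbb{R}^d$ (diameters are taken with respect to it); $\mathcal{L}^d$ is Lebesgue measure. A gauge function is a function $g:[0,\infty]\to[0,\infty]$ that is nondecreasing on a neighbourhood of $0$ and satisfies $\lim_{r\to0}g(r)=g(0)=0$, $g(\infty)=\infty$; $\mathfrak{G}$ denotes the set of gauge functions. $\mathcal{H}^g$ is the Hausdorff $g$-measure: $\mathcal{H}^g(E)=\lim_{\delta\downarrow0}\inf\{\sum_ng(\mathrm{diam}\,C_n):E\subseteq\bigcup_nC_n,\ \mathrm{diam}\,C_n\le\delta\}$. The $d$-normalization of $g$ is $g_d(r)=r^d\inf_{0<\rho\le r}g(\rho)/\rho^d$ for $r\in(0,\infty)$, $g_d(0)=0$, $g_d(\infty)=\infty$; $g$ is $d$-normalized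 if $g=g_d$ on a neighbourhood of $0$. Let $\ell_g=\liminf_{r\to0}g(r)/r^d$, $\mathfrak{G}^\infty=\{g\in\mathfrak{G}:\ell_g=\infty\}$, $\mathfrak{G}^*=\{g\in\mathfrak{G}:\ell_g\in(0,\infty]\}$. For $d$-normalized gauge functions $g,h$ write $h\prec g$ if $h(r)/g(r)$ increases monotonically to $\infty$ as $r\downarrow0$ (with the convention that $h\prec g$ for every $h$ if $g$ vanishes on a neighbourhood of $0$). Dyadic cubes are the sets $2^{-j}(k+[0,1)^d)$, $j\in\mathbb{Z}$, $k\in\mathbb{Z}^d$. For a $d$-normalized gauge function $h$, let $\varepsilon_h$ be the supremum of those $\varepsilon>0$ such that $h$ is nondecreasing on $[0,\varepsilon]$ and $r\mapsto h(r)/r^d$ is nonincreasing on $(0,\varepsilon]$, and let $\mathcal{M}^h_\infty(E)=\inf\sum_nh(\mathrm{diam}\,\lambda_n)$, the infimum over all countable coverings of $E$ by dyadic cubes $\lambda_n$ of diameter less than $\varepsilon_h$. For a gauge function $g$ and a nonempty open set $U\subseteq\mathbb{R}^d$, the large intersection class $G^g(U)$ is the collection of $G_\delta$ subsets $F\subseteq\mathbb{R}^d$ such that $\mathcal{M}^h_\infty(F\cap V)=\mathcal{M}^h_\infty(V)$ for every $d$-normalized gauge function $h$ with $h\prec g_d$ and every open $V\subseteq U$. Let $\mathcal{Z}(U)$ be the set of Borel sets $E$ with $\mathcal{L}^d(E\cap U)=0$; for such $E$, the majorizing collection is $\mathfrak{M}(E,U)=\{g\in\mathfrak{G}^\infty:\mathcal{H}^g(E\cap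 U)=0\}$ and the minorizing collection is $\mathfrak{m}(E,U)=\{g\in\mathfrak{G}^*:\exists F\in G^g(U),\ F\subseteq E\}$. Let $\mathcal{R}$ be the set of positive Borel measures $\mathfrak{n}$ on $(0,1]$ with infinite total mass and $\mathfrak{n}([\rho,1])<\infty$ for all $\rho\in(0,1]$, and $\mathcal{R}_d=\{\mathfrak{n}\in\mathcal{R}:\int_{(0,1]}r^d\,\mathfrak{n}(dr)<\infty\}$. For $\mathfrak{n}\in\mathcal{R}_d$, $\mathfrak{G}(\mathfrak{n})=\{g\in\mathfrak{G}^\infty:\int_{(0,1]}g_d\,d\mathfrak{n}=\infty\}$ and $\mathfrak{G}(\mathfrak{n})^\complement=\mathfrak{G}^\infty\setminus\mathfrak{G}(\mathfrak{n})$. A set $E$ is $\mathfrak{n}$-describable in $U$ if $E\in\mathcal{Z}(U)$, $\mathfrak{M}(E,U)=\mathfrak{G}(\mathfrak{n})^\complement$ and $\mathfrak{m}(E,U)\cap\mathfrak{G}^\infty=\mathfrak{G}(\mathfrak{n})$. For $\mathfrak{s}\in[0,d)$, $\mathfrak{G}(\mathfrak{s})$ is the set of $g\in\mathfrak{G}^\infty$ such that for every $s>\mathfrak{s}$, $g_d(r)$ is not $o(r^s)$ as $r\to0$; $E$ is $\mathfrak{s}$-describable in $U$ if $E\in\mathcal{Z}(U)$, $\mathfrak{M}(E,U)=\mathfrak{G}^\infty\setminus\mathfrak{G}(\mathfrak{s})$ and $\mathfrak{m}(E,U)\cap\mathfrak{G}^\infty=\mathfrak{G}(\mathfrak{s})$.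 *)

(* Defs.v *)
From Stdlib Require Import Reals ZArith Classical ClassicalEpsilon List.
Open Scope R_scope.

Inductive Rbar : Type := Finite (r : R) | p_infty | m_infty.

Definition Rbar_le (x y : Rbar) : Prop :=
  match x, y with
  | m_infty, _ => True
  | _, p_infty => True
  | p_infty, _ => False
  | _, m_infty => False
  | Finite a, Finite b => a <= b
  end.

Definition Rbar_lt (x y : Rbar) : Prop := Rbar_le x y /\ x <> y.

(* addition (only used on [0,+oo]-valued quantities) *)
Definition Rbar_plus (x y : Rbar) : Rbar :=
  match x, y with
  | Finite a, Finite b => Finite (a + b)
  | p_infty, m_infty => Finite 0
  | m_infty, p_infty => Finite 0
  | p_infty, _ => p_infty
  | _, p_infty => p_infty
  | m_infty, _ => m_infty
  | _, m_infty => m_infty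
  end.

(* multiplication by a real scalar c (only used with c > 0) *)
Definition Rbar_scal (c : R) (x : Rbar) : Rbar :=
  match x with
  | Finite a => Finite (c * a)
  | p_infty => p_infty
  | m_infty => m_infty
  end.

Definition is_sup (S : Rbar -> Prop) (v : Rbar) : Prop :=
  (forall y, S y -> Rbar_le y v) /\
  (forall u, (forall y, S y -> Rbar_le y u) -> Rbar_le v u).
Definition is_inf (S : Rbar -> Prop) (v : Rbar) : Prop :=
  (forall y, S y -> Rbar_le v y) /\
  (forall u, (forall y, S y -> Rbar_le u y) -> Rbar_le u v).

(* the (always existing) supremum / infimum in [-oo,+oo] *)
Definition Rbar_sup (S : Rbar -> Prop) : Rbar :=
  epsilon (inhabits p_infty) (is_sup S).
Definition Rbar_inf (S : Rbar -> Prop) : Rbar :=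
  epsilon (inhabits p_infty) (is_inf S).

(* partial sums and sum of a series of [0,+oo]-valued terms *)
Fixpoint Rbar_psum (u : nat -> Rbar) (n : nat) : Rbar :=
  match n with
  | O => Finite 0
  | S k => Rbar_plus (Rbar_psum u k) (u k)
  end.
Definition Rbar_series (u : nat -> Rbar) : Rbar :=
  Rbar_sup (fun v => exists n, v = Rbar_psum u n).

Definition Rbar_limsup (u : nat -> Rbar) : Rbar :=
  Rbar_inf (fun v => exists N, v = Rbar_sup (fun w => exists n, (N <= n)%nat /\ w = u n)).

Fixpoint zpoly_eval (m : nat) (c : nat -> Z) (a : R) : R :=
  match m with
  | O => IZR (c O)
  | S k => zpoly_eval k c a + IZR (c (S k)) * a ^ (S k)
  end.

Definition zpoly_root (m : nat) (c : nat -> Z) (a : R) : Prop :=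
  c m <> 0%Z /\ zpoly_eval m c a = 0.

Definition alg_deg_le (n : nat) (a : R) : Prop :=
  exists m c, (m <= n)%nat /\ zpoly_root m c a.

Definition min_poly (a : R) (m : nat) (c : nat -> Z) : Prop :=
  zpoly_root m c a /\
  (forall m' c', zpoly_root m' c' a -> (m <= m')%nat) /\
  (forall k : Z, (forall i, (i <= m)%nat -> Z.divide k (c i)) -> Z.divide k 1%Z).

Fixpoint zmax_abs (m : nat) (c : nat -> Z) : Z :=
  match m with
  | O => Z.abs (c O)
  | S k => Z.max (zmax_abs k c) (Z.abs (c (S k)))
  end.

(* h = H(a) (well defined: the minimal polynomial is unique up to sign) *)
Definition height (a : R) (h : Z) : Prop :=
  exists m c, min_poly a m c /\ h = zmax_abs m c.

Definition infinite_set (P : R -> Prop) : Prop :=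
  ~ exists l : list R, forall a, P a -> In a l.

Definition Kstar (n : nat) (w : R) (x : R) : Prop :=
  infinite_set (fun a => alg_deg_le n a /\
    exists h, height a h /\ Rabs (x - a) < Rpower (IZR h) (- w - 1)).

Definition omega_star_n (n : nat) (x : R) : Rbar :=
  Rbar_sup (fun v => exists w, -1 < w /\ Kstar n w x /\ v = Finite w).

(* omega^*(x) = limsup_{n -> oo} omega^*_n(x)/n  (index k <-> n = k+1) *)
Definition omega_star (x : R) : Rbar :=
  Rbar_limsup (fun k => Rbar_scal (/ INR (S k)) (omega_star_n (S k) x)).

Definition Omega_star (w : R) : R -> Prop :=
  fun x => Rbar_le (Finite w) (omega_star x).

Definition is_norm (N : R -> R) : Prop :=
  (forall x, N x = 0 <-> x = 0) /\
  (forall l x, N (l * x) = Rabs l * N x) /\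
  (forall x y, N (x + y) <= N x + N y).

Definition open_set (U : R -> Prop) : Prop :=
  forall x, U x -> exists e, 0 < e /\ forall y, Rabs (y - x) < e -> U y.

Inductive borel : (R -> Prop) -> Prop :=
  | borel_open : forall U, open_set U -> borel U
  | borel_compl : forall E, borel E -> borel (fun x => ~ E x)
  | borel_union : forall E : nat -> R -> Prop,
      (forall n, borel (E n)) -> borel (fun x => exists n, E n x).

Definition G_delta (F : R -> Prop) : Prop :=
  exists O : nat -> R -> Prop, (forall n, open_set (O n)) /\
    forall x, F x <-> forall n, O n x.

Definition lebesgue (E : R -> Prop) : Rbar :=
  Rbar_inf (fun s => exists a b : nat -> R,
    (forall n, a n <= b n) /\
    (forall x, E x -> exists n, a n < x < b n) /\
    s = Rbar_series (fun n => Finite (b n - a n))).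

(* diameter w.r.t. the norm N (diam of the empty set is 0) *)
Definition diam (N : R -> R) (C : R -> Prop) : Rbar :=
  Rbar_sup (fun v => v = Finite 0 \/ exists x y, C x /\ C y /\ v = Finite (N (x - y))).

(* Hausdorff g-measure; H^g_delta is nonincreasing in delta, so the limit
   as delta -> 0 is the supremum over delta > 0 *)
Definition hausdorff_delta (N : R -> R) (g : Rbar -> Rbar) (delta : R) (E : R -> Prop) : Rbar :=
  Rbar_inf (fun s => exists C : nat -> R -> Prop,
    (forall x, E x -> exists n, C n x) /\
    (forall n, Rbar_le (diam N (C n)) (Finite delta)) /\
    s = Rbar_series (fun n => g (diam N (C n)))).
Definition hausdorff (N : R -> R) (g : Rbar -> Rbar) (E : R -> Prop) : Rbar :=
  Rbar_sup (fun v => exists delta, 0 < delta /\ v = hausdorff_delta N g delta E).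

Definition is_gauge (g : Rbar -> Rbar) : Prop :=
  (forall x, match x with
             | Finite r => 0 <= r -> Rbar_le (Finite 0) (g x)
             | p_infty => True
             | m_infty => True end) /\
  (exists e, 0 < e /\ forall r s, 0 <= r -> r <= s -> s <= e ->
     Rbar_le (g (Finite r)) (g (Finite s))) /\
  (forall eta, 0 < eta -> exists rho, 0 < rho /\
     forall r, 0 < r < rho -> Rbar_le (g (Finite r)) (Finite eta)) /\
  g (Finite 0) = Finite 0 /\
  g p_infty = p_infty.

Definition ell (g : Rbar -> Rbar) : Rbar :=
  Rbar_sup (fun v => exists e, 0 < e /\
    v = Rbar_inf (fun w => exists r, 0 < r < e /\ w = Rbar_scal (/ r) (g (Finite r)))).

Definition G_infty (g : Rbar -> Rbar) : Prop := is_gauge g /\ ell g = p_infty.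
Definition G_star (g : Rbar -> Rbar) : Prop := is_gauge g /\ Rbar_lt (Finite 0) (ell g).

Definition normalize (g : Rbar -> Rbar) : Rbar -> Rbar :=
  fun x => match x with
  | Finite r =>
      if Rlt_dec 0 r then
        Rbar_scal r (Rbar_inf (fun w => exists rho, 0 < rho <= r /\
                                 w = Rbar_scal (/ rho) (g (Finite rho))))
      else Finite 0
  | p_infty => p_infty
  | m_infty => Finite 0
  end.

Definition d_normalized (g : Rbar -> Rbar) : Prop :=
  is_gauge g /\ exists e, 0 < e /\
    forall r, 0 <= r < e -> g (Finite r) = normalize g (Finite r).

Definition fin (x : Rbar) : R := match x with Finite r => r | _ => 0 end.
Definition is_finite (x : Rbar) : Prop := exists r, x = Finite r.

Definition prec (h g : Rbar -> Rbar) : Prop :=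
  (exists e, 0 < e /\ forall r, 0 < r < e -> g (Finite r) = Finite 0) \/
  (exists e, 0 < e /\
     (forall r, 0 < r < e -> is_finite (h (Finite r)) /\ is_finite (g (Finite r))
                           /\ 0 < fin (g (Finite r))) /\
     (forall r s, 0 < r -> r <= s -> s < e ->
        fin (h (Finite s)) / fin (g (Finite s)) <= fin (h (Finite r)) / fin (g (Finite r))) /\
     (forall M, exists rho, 0 < rho /\ forall r, 0 < r < rho ->
        M < fin (h (Finite r)) / fin (g (Finite r)))).

Definition eps_h (h : Rbar -> Rbar) : Rbar :=
  Rbar_sup (fun v => exists e, 0 < e /\ v = Finite e /\
    (forall r s, 0 <= r -> r <= s -> s <= e -> Rbar_le (h (Finite r)) (h (Finite s))) /\
    (forall r s, 0 < r -> r <= s -> s <= e ->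
       Rbar_le (Rbar_scal (/ s) (h (Finite s))) (Rbar_scal (/ r) (h (Finite r))))).

Definition dyadic (j k : Z) : R -> Prop :=
  fun x => IZR k * powerRZ 2 (- j) <= x < (IZR k + 1) * powerRZ 2 (- j).

(* M^h_infty : countable coverings by dyadic intervals of diameter < eps_h;
   None encodes an absent member (finite coverings) *)
Definition M_infty (N : R -> R) (h : Rbar -> Rbar) (E : R -> Prop) : Rbar :=
  Rbar_inf (fun s => exists lam : nat -> option (Z * Z),
    (forall x, E x -> exists n j k, lam n = Some (j, k) /\ dyadic j k x) /\
    (forall n j k, lam n = Some (j, k) -> Rbar_lt (diam N (dyadic j k)) (eps_h h)) /\
    s = Rbar_series (fun n => match lam n with
                              | Some (j, k) => h (diam N (dyadic j k))
                              | None => Finite 0 end)).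

Definition large_int_class (N : R -> R) (g : Rbar -> Rbar) (U : R -> Prop)
    (F : R -> Prop) : Prop :=
  G_delta F /\
  forall h, d_normalized h -> prec h (normalize g) ->
    forall V, open_set V -> (forall x, V x -> U x) ->
      M_infty N h (fun x => F x /\ V x) = M_infty N h V.

Definition null_in (E U : R -> Prop) : Prop :=
  borel E /\ lebesgue (fun x => E x /\ U x) = Finite 0.

Definition majorizing (N : R -> R) (E U : R -> Prop) (g : Rbar -> Rbar) : Prop :=
  G_infty g /\ hausdorff N g (fun x => E x /\ U x) = Finite 0.
Definition minorizing (N : R -> R) (E U : R -> Prop) (g : Rbar -> Rbar) : Prop :=
  G_star g /\ exists F, large_int_class N g U F /\ forall x, F x -> E x.

Definition G_s (s0 : R) (g : Rbar -> Rbar) : Prop :=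
  G_infty g /\
  forall s, s0 < s ->
    ~ (forall eta, 0 < eta -> exists rho, 0 < rho /\ forall r, 0 < r < rho ->
         Rbar_le (normalize g (Finite r)) (Finite (eta * Rpower r s))).

Definition s_describable (N : R -> R) (s0 : R) (E U : R -> Prop) : Prop :=
  null_in E U /\
  (forall g, majorizing N E U g <-> (G_infty g /\ ~ G_s s0 g)) /\
  (forall g, (minorizing N E U g /\ G_infty g) <-> G_s s0 g).

(* Main.v *)
(* Let [F] be the set of the [x] that are approximated to within [H(a)^(-n w - 1)] by algebraic
   numbers [a <> x] of degree at most [n] arbitrarily close to [x], for every [n]; it is a
   [G_delta] subset of [Omega_star w].

   Abundance.  By the nondivergence argument of Kleinbock and Margulis, for large [Q] all [x] in
   an interval, up to a set of small measure, admit no nonzero integer polynomial of degree at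
   most [n] that is simultaneously small at [x] and of small height.  For such [x] two pigeonhole
   arguments give an integer polynomial with [|P(x)| << Q^-n], height [<< Q] and derivative
   [>> Q] at [x], hence an algebraic number of height [<< Q] at distance [<< Q^(-n-1)] from [x].
   So the algebraic numbers of degree at most [n] are well spread, and a mass distribution
   argument shows that [F] has full net content [M^h] in every open set as soon as [h(r)/r]
   tends to infinity and [h] is not [o(r^s)] for any [s > 1/w].

   Scarcity.  Counting the algebraic numbers of degree at most [n] and given height shows that
   [Omega_star w] has covers with arbitrarily small sums of [r^s] for every [s > 1/w].

   Let [g_1] be the normalization of [g].  If [g] lies in [G_s (1/w)], abundance applies to [g_1]
   and to every [h] preceding [g_1].  Otherwise [g_1 = o(r^s)] for some [s > 1/w]; scarcity makes
   the Hausdorff measure vanish, and [h = g_1^t] with [t < 1 < t s w] precedes [g_1] and has zero content on [Omega_star w]. *)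

From Stdlib Require Reals ZArith List FinFun Cantor.
Require Defs.
From mathcomp Require all_boot all_order all_algebra boolp reals Rstruct ssrZ.
From mathcomp Require ring lra zify.

(** The large intersection class asks for equality of contents, and the covers of [F] are arbitrary.
    So no measure is built: a dyadic cover of [F] within [V] is repaired into a cover of [V] at the
    price of a factor [1 / th], with [th < 1] as close to 1 as desired. An interval is heavy if the
    cubes inside it cost at least [th] times its own value, and light if it is not heavy and no cube
    contains it. Maximal heavy intervals replace the cubes they contain; a point of [V] still missed
    would lie in a light interval, and nested light intervals would lead to a point of [F] that the
    cover misses. Each descent discards up to half of the subintervals, because nearby algebraic
    numbers are known only off a set of relative measure 1/4. The divergence of [h(r)/r] pays for
    this: it allows passing to a subinterval that is light with [th / 2]. The value [1/w] arises
    from spacing: numbers of degree at most [n+1] whose neighbourhoods have length at least [x]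
    occur at spacing about [x^b], [b = (n+2)/((n+1)w+1)]. For [w > 1] this [b] is below 1 and
    decreases to [1/w] as [n] grows. *)

Module NumberTheory.
Import all_boot all_order all_algebra.
Import boolp reals Rstruct ssrZ.
Import ring lra zify.
Import Order.TTheory GRing.Theory Num.Theory.
Set Implicit Arguments. Unset Strict Implicit. Unset Printing Implicit Defensive.
Local Open Scope ring_scope.

(** * Covers by intervals and polynomial interpolation *)

Section Covers.
Variable R : realType.
Implicit Types (Z : R -> Prop) (c : R).

(** Outer Lebesgue measure at most [c], attained by a single cover and stated through partial sums,
    so that countable subadditivity costs no epsilon and no infinite sum is formed. *)
Definition cov Z c := exists a b : nat -> R,
  [/\ forall i, a i <= b i, forall x, Z x -> exists i, a i < x < b i
    & forall n, \sum_(i < n) (b i - a i) <= c].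

Lemma cov_sub Z Z' c c' : (forall x, Z x -> Z' x) -> c' <= c -> cov Z' c' -> cov Z c.
Proof.
move=> sZ lec [a [b [ab cvr sm]]]; exists a, b; split=> // [x /sZ /cvr //|n].
exact: le_trans lec.
Qed.

Lemma cov0 : cov (fun=> False) 0.
Proof.
by exists (fun=> 0), (fun=> 0); split=> // n; rewrite big1 // => i _; rewrite subrr.
Qed.

Lemma cov_ge0 Z c : cov Z c -> 0 <= c.
Proof. by case=> a [b [_ _ /(_ 0)]]; rewrite big_ord0. Qed.

Lemma cov_itv (u v : R) : u <= v -> cov (fun x => u < x < v) (v - u).
Proof.
move=> uv; exists (fun i => if i is 0 then u else 0), (fun i => if i is 0 then v else 0).
split=> [[|i]|x ux|[|n]] //; first by exists 0.
  by rewrite big_ord0 subr_ge0.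
by rewrite big_ord_recl /= big1 ?addr0 // => i _; rewrite subrr.
Qed.

Lemma ler_sum_uniq_sub (T : eqType) (s s' : seq T) (u : T -> R) :
  uniq s -> {subset s <= s'} -> (forall x, 0 <= u x) ->
  \sum_(x <- s) u x <= \sum_(x <- s') u x.
Proof.
elim: s s' => [|x s IHs] s' /=; first by move=> _ _ u0; rewrite big_nil sumr_ge0.
case/andP=> xs us ss u0; have xs' := ss x (mem_head x s); rewrite big_cons [leRHS](big_rem x xs') /=.
apply: lerD => //; apply: IHs => // y ys.
have := ss y; rewrite inE ys orbT => /(_ isT); rewrite (perm_mem (perm_to_rem xs')).
rewrite inE => /orP[/eqP yx|//].
by rewrite yx (negPf xs) in ys.
Qed.

(** The covers are merged along an enumeration of pairs; a finite part of the merged family lies in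
    a square of indices, where the bounds of the rows add up. *)
Lemma cov_bigcup (A : nat -> R -> Prop) (c : nat -> R) C :
  (forall i, cov (A i) (c i)) -> (forall n, \sum_(i < n) c i <= C) ->
  cov (fun x => exists i, A i x) C.
Proof.
move=> covA sumc.
have [a /choice[b ab]] := choice covA.
pose f (z : option (nat * nat)) : R * R := if z is Some (i, j) then (a i j, b i j) else (0, 0).
pose w m := f (pickle_inv m).
exists (fun m => (w m).1), (fun m => (w m).2); split.
- by move=> m; rewrite /w /f; case: pickle_inv => [[i j]|] //=; case: (ab i).
- move=> x [i Ax]; case: (ab i) => _ /(_ x Ax)[j xj] _.
  by exists (pickle (i, j)); rewrite /w pickleK_inv.
move=> n.
pose u (p : nat * nat) := b p.1 p.2 - a p.1 p.2.
have u0 p : 0 <= u p by rewrite subr_ge0; case: (ab p.1).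
pose s := pmap (@pickle_inv (nat * nat)%type) (iota 0 n).
have -> : \sum_(i < n) ((w i).2 - (w i).1) = \sum_(p <- s) u p.
  rewrite -(big_mkord xpredT (fun i => (w i).2 - (w i).1)) /s /index_iota subn0.
  elim: (iota 0 n) => [|m l IHl]; first by rewrite !big_nil.
  rewrite big_cons IHl /= /w; case: (pickle_inv m) => [[i j]|] /=; last by rewrite subrr add0r.
  by rewrite big_cons.
pose M := (\max_(p <- s) (maxn p.1 p.2)).+1.
have us : uniq s.
  exact: (pmap_uniq (@pickle_invK _) (iota_uniq 0 n)).
apply: (@le_trans _ _ (\sum_(p <- [seq (i, j) | i <- iota 0 M, j <- iota 0 M]) u p)).
  apply: ler_sum_uniq_sub => // -[i j] ps.
  have : (maxn i j < M)%N.
    by rewrite ltnS; exact: (@leq_bigmax_seq _ s xpredT (fun p : nat * nat => maxn p.1 p.2) (i, j)).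
  rewrite gtn_max => /andP[iM jM].
  by apply/allpairsPdep; exists i, j; split=> //; rewrite mem_iota.
rewrite big_allpairs.
apply: le_trans (sumc M); rewrite -(big_mkord xpredT c) /index_iota subn0.
apply: ler_sum => i _; case: (ab i) => _ _ /(_ M); apply: le_trans.
by rewrite -(big_mkord xpredT (fun j => b i j - a i j)) /index_iota subn0.
Qed.

Lemma cov_bigcup_seq (T : Type) (s : seq T) (A : T -> R -> Prop) (c : T -> R) :
  (forall t, cov (A t) (c t)) ->
  cov (fun x => List.Exists (fun t => A t x) s) (\sum_(t <- s) c t).
Proof.
move=> covA.
elim: s => [|t s IHs].
  by rewrite big_nil; apply: cov_sub (lexx _) cov0 => x h; inversion h.
rewrite big_cons.
have H := @cov_bigcup (fun i x => if i is 0 then A t x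
   else if i is 1 then List.Exists (fun t => A t x) s else False)
  (fun i => if i is 0 then c t else if i is 1 then \sum_(t <- s) c t else 0)
  (c t + \sum_(t <- s) c t).
apply: cov_sub (H _ _) => // [x h|[|[|i]]|[|[|n]]] //; last 3 first.
- by rewrite big_ord0 addr_ge0 ?(cov_ge0 (covA t)) ?(cov_ge0 IHs).
- by rewrite big_ord_recl big_ord0 /= addr0 lerDl (cov_ge0 IHs).
- by rewrite !big_ord_recl /= big1_eq addr0.
- by inversion h; [exists 0|exists 1].
- exact: cov0.
Qed.

Lemma covU Z1 Z2 c1 c2 : cov Z1 c1 -> cov Z2 c2 -> cov (fun x => Z1 x \/ Z2 x) (c1 + c2).
Proof.
move=> h1 h2.
have := @cov_bigcup_seq bool [:: true; false] (fun b => if b then Z1 else Z2) (fun b => if b then c1 else c2).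
rewrite !big_cons big_nil addr0 => H.
apply: cov_sub (H _) => // [x [] h|[]] //; [exact: List.Exists_cons_hd|].
by apply: List.Exists_cons_tl; apply: List.Exists_cons_hd.
Qed.

Lemma cov_bigcup_fin (T : finType) (P : pred T) (A : T -> R -> Prop) (c : T -> R) :
  (forall t, P t -> cov (A t) (c t)) ->
  cov (fun x => exists2 t, P t & A t x) (\sum_(t | P t) c t).
Proof.
move=> covA; rewrite big_mkcond.
have := @cov_bigcup_seq T (index_enum T) (fun t x => P t /\ A t x) (fun t => if P t then c t else 0).
move=> H; apply: cov_sub (H _) => // [x [t Pt Atx]|t].
  have : t \in index_enum T by rewrite mem_index_enum.
  elim: (index_enum T) => // y s IHs; rewrite inE => /orP[/eqP <-|/IHs]; first exact: List.Exists_cons_hd.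
  exact: List.Exists_cons_tl.
case: ifP => Pt; last by apply: cov_sub cov0 => // x [].
by apply: cov_sub (covA t Pt) => // x [].
Qed.

End Covers.

Section Lagrange.
Variable R : realType.

Definition lagr m (t : 'I_m -> R) (i : 'I_m) : {poly R} :=
  \prod_(j < m | j != i) ((t i - t j)^-1 *: ('X - (t j)%:P)).

Lemma lagr_sample m (t : 'I_m -> R) i k : injective t -> (lagr t i).[t k] = (k == i)%:R.
Proof.
move=> inj_t; rewrite horner_prod; case: eqP => [->|/eqP ki].
  rewrite big1 // => j ji; rewrite hornerZ !hornerE mulVf // subr_eq0.
  by apply: contra ji => /eqP/inj_t->.
by rewrite (bigD1 k) //= hornerZ !hornerE subrr mulr0 mul0r.
Qed.

Lemma size_lagr m (t : 'I_m -> R) i : (size (lagr t i) <= m)%N.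
Proof.
apply: leq_trans (size_poly_prod_leq _ _) _.
have le : (\sum_(j < m | j != i) size ((t i - t j)^-1 *: ('X - (t j)%:P)) <= \sum_(j < m | j != i) 2)%N.
  by apply: leq_sum => j _; rewrite (leq_trans (size_scale_leq _ _)) // size_XsubC.
have c : #|(fun j : 'I_m => j != i)| = m.-1.
  by have := cardC1 i; rewrite card_ord => <-; apply: eq_card.
rewrite sum_nat_const c in le; rewrite leq_subLR c.
apply: leq_ltn_trans le _; case: m t i c => [|m] t i _; [by case: i|lia].
Qed.

Lemma lagrange_interp m (t : 'I_m -> R) (p : {poly R}) :
  injective t -> (size p <= m)%N -> p = \sum_(i < m) p.[t i] *: lagr t i.
Proof.
move=> inj_t sp; apply/eqP; rewrite -subr_eq0; apply/eqP.
apply: (@roots_geq_poly_eq0 _ _ (codom t)).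
- apply/allP=> _ /codomP[k ->]; rewrite /root hornerD hornerN horner_sum (bigD1 k) //=.
  rewrite big1 => [|i ik]; last by rewrite hornerZ lagr_sample // eq_sym (negPf ik) mulr0.
  by rewrite hornerZ lagr_sample // eqxx mulr1 addr0 subrr.
- by rewrite /codom /image_mem map_inj_uniq ?enum_uniq.
rewrite size_codom card_ord (leq_trans (size_polyD _ _)) // geq_max sp size_polyN.
apply: leq_trans (size_sum _ _ _) _; apply/bigmax_leqP=> i _.
exact: leq_trans (size_scale_leq _ _) (size_lagr _ _).
Qed.

(** Sum of the absolute values of the entries of the inverse Vandermonde matrix, hence a bound for
    coefficients in terms of values at the nodes. *)
Definition lagr_norm m (t : 'I_m -> R) : R :=
  \sum_(i < m) \sum_(l < m) `|(lagr t i)`_l|.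

Lemma lagr_norm_ge0 m (t : 'I_m -> R) : 0 <= lagr_norm t.
Proof. by apply: sumr_ge0 => i _; apply: sumr_ge0. Qed.

Lemma coef_le_lagr_norm m (t : 'I_m -> R) (p : {poly R}) (e : R) l :
  injective t -> (size p <= m)%N -> (forall i, `|p.[t i]| <= e) ->
  `|p`_l| <= lagr_norm t * e.
Proof.
case: m t => [|m] t inj_t sp pe.
  by move: sp; rewrite leqn0 size_poly_eq0 => /eqP->; rewrite coef0 normr0 /lagr_norm big_ord0 mul0r.
have e0 : 0 <= e by exact: le_trans (pe ord0).
have [lm|ml] := ltnP l m.+1; last first.
  by rewrite nth_default ?normr0 ?mulr_ge0 ?lagr_norm_ge0 // (leq_trans sp).
rewrite {1}(lagrange_interp inj_t sp) coef_sum (le_trans (ler_norm_sum _ _ _)) //.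
rewrite /lagr_norm mulr_suml; apply: ler_sum => i _.
rewrite coefZ normrM mulrC ler_pM //.
by rewrite (bigD1 (Ordinal lm)) //= lerDl sumr_ge0.
Qed.

Lemma horner_le_lagr m (t : 'I_m -> R) (p : {poly R}) (e d D x : R) :
  injective t -> (size p <= m)%N -> (forall i, `|p.[t i]| <= e) ->
  0 < d -> (forall i j, i != j -> d <= `|t i - t j|) -> (forall j, `|x - t j| <= D) ->
  `|p.[x]| <= m%:R * (e * (D / d) ^+ m.-1).
Proof.
case: m t => [|m] t inj_t sp pe d0 td xD.
  by move: sp; rewrite leqn0 size_poly_eq0 => /eqP->; rewrite horner0 normr0 mul0r.
have e0 : 0 <= e by exact: le_trans (pe ord0).
have D0 : 0 <= D by exact: le_trans (xD ord0).
rewrite {1}(lagrange_interp inj_t sp) horner_sum (le_trans (ler_norm_sum _ _ _)) //.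
have -> (y : R) : m.+1%:R * y = \sum_(i < m.+1) y by rewrite sumr_const card_ord mulr_natl.
apply: ler_sum => i _; rewrite hornerZ normrM; apply: ler_pM => //=; rewrite horner_prod normr_prod.
have -> : (D / d) ^+ m = \prod_(j < m.+1 | j != i) (D / d).
  rewrite prodr_const; congr (_ ^+ _).
  have := cardC1 i; rewrite card_ord /= => ce; apply: etrans (esym ce) _; exact: eq_card.
have hd j : j != i -> d <= `|t i - t j| by move=> ji; rewrite td // eq_sym.
apply: ler_prod => j ji; rewrite normr_ge0 /= hornerZ !hornerE normrM mulrC ler_pM //.
by rewrite normfV lef_pV2 ?hd ?posrE // (lt_le_trans d0) // hd.
Qed.

End Lagrange.

(** * Small values of polynomials *)

Section PolyBounds.
Variable R : realType.

Lemma grid_index (M : nat) (z : R) : 0 <= z < M%:R -> exists i : 'I_M, i%:R <= z < i%:R + 1.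
Proof.
case/andP=> z0 zM; have /andP[h1 h2] := truncn_itv z0.
have iM : (Num.truncn z < M)%N by rewrite -(ltr_nat R) (le_lt_trans h1).
by exists (Ordinal iM); rewrite /= h1 natr1 h2.
Qed.

Lemma odd_gap i j : odd i = odd j -> (i < j)%N -> (i.+2 <= j)%N.
Proof.
by move=> o; rewrite leq_eqVlt => /orP[/eqP e|//]; move: o; rewrite -e /=; case: odd.
Qed.

Lemma horner_near (p : {poly R}) (x r : R) : `|p.[x]| < r ->
  exists2 d : R, 0 < d & forall y : R, `|y - x| <= d -> `|p.[y]| < r.
Proof.
move=> pxr.
have : root (p - p.[x]%:P) x by rewrite /root !hornerE subrr.
case/factor_theorem => q eq.
have [B HB] := poly_itv_bound q (x - 1) (x + 1).
have B0 : 0 <= B by apply: le_trans (HB x _); rewrite //; apply/andP; split; lra.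
pose d := Num.min 1 ((r - `|p.[x]|) / (2 * (B + 1))).
have rp : 0 < r - `|p.[x]| by rewrite subr_gt0.
have B1 : 0 < 2 * (B + 1) by lra.
exists d => [|y yd]; first by rewrite lt_min ltr01 divr_gt0.
have := congr1 (horner^~ y) eq; rewrite !hornerE => e.
have -> : p.[y] = p.[x] + q.[y] * (y - x) by rewrite -e; ring.
apply: le_lt_trans (ler_normD _ _) _; rewrite normrM -ltrBrDl.
have /andP[y1 y2] : (`|y - x| <= 1) && (`|y - x| <= (r - `|p.[x]|) / (2 * (B + 1))) by rewrite -le_min.
have qB : `|q.[y]| <= B.
  by apply: HB; rewrite -ler_distl.
apply: (@le_lt_trans _ _ (B * ((r - `|p.[x]|) / (2 * (B + 1))))); first by rewrite ler_pM.
rewrite mulrA ltr_pdivrMr //; nra.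
Qed.

(** Interpolation at [D+1] equally spaced nodes of the interval: they are at least [L / (D+1)] apart
    and at distance at most [3 L] from every point of the tripled interval. *)
Lemma doubling (D : nat) : exists2 C : R, 1 <= C &
  forall (p : {poly R}) (u L e : R), (size p <= D.+1)%N -> 0 < L ->
    (forall y : R, u <= y < u + L -> `|p.[y]| <= e) ->
    forall x : R, u - L <= x <= u + 2 * L -> `|p.[x]| <= C * e.
Proof.
exists (D.+1%:R * (3 * D.+1%:R) ^+ D).
  have D1 : 1 <= D.+1%:R :> R by rewrite ler1n.
  have : 1 <= (3 * D.+1%:R : R) ^+ D by apply: exprn_ege1; lra.
  by nra.
move=> p u L e sp L0 pe x xu.
have D0 : 0 < D.+1%:R :> R by rewrite ltr0n.
pose t (i : 'I_D.+1) := u + i%:R * (L / D.+1%:R).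
have d0 : 0 < L / D.+1%:R by rewrite divr_gt0.
have inj_t : injective t.
  by move=> i j /addrI /(mulIf (lt0r_neq0 d0)) /eqP; rewrite eqr_nat => /eqP /val_inj.
have ti i : u <= t i < u + L.
  rewrite /t lerDl mulr_ge0 ?ler0n ?(ltW d0) //= ltrD2l mulrA ltr_pdivrMr // mulrC ltr_pM2l //.
  by rewrite ltr_nat.
have := @horner_le_lagr R D.+1 t p e (L / D.+1%:R) (3 * L) x inj_t sp (fun i => pe _ (ti i)) d0.
move=> H; apply: le_trans (H _ _) _.
- move=> i j ij; rewrite /t opprD addrACA subrr add0r -mulrBl normrM (gtr0_norm d0) ler_peMl ?(ltW d0) //.
  have [lt|lt|e0] := ltngtP i j; last by move: ij; rewrite (val_inj e0) eqxx.
    by rewrite distrC -natrB 1?ltnW // normr_nat ler1n subn_gt0.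
  by rewrite -natrB 1?ltnW // normr_nat ler1n subn_gt0.
- by move=> j; have := ti j; rewrite ler_norml; move: xu => /andP[? ?] /andP[? ?]; apply/andP; split; lra.
have e3 (w : R) : 0 < w -> 3 * L / (L / w) = 3 * w by move=> w0; field; rewrite !gt_eqF.
rewrite e3 //.
by rewrite /= [e * _]mulrC mulrA.
Qed.

(** A Remez-type estimate. Among [M] equal cells, points in different cells of the same parity are a
    full cell apart, so [D+1] such points with small values would make [p] small on the whole
    interval. Hence at most [2 D] cells meet the sublevel set, for an [e] that depends on [D], [kap]
    and [rho] alone. *)
Lemma poly_sub_cov (D : nat) (kap rho : R) : 0 < kap -> 0 < rho -> exists2 e : R, 0 < e &
  forall (p : {poly R}) (u L : R), (size p <= D.+1)%N -> 0 < L ->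
    (exists2 y : R, u <= y < u + L & rho <= `|p.[y]|) ->
    cov (fun x : R => u <= x < u + L /\ `|p.[x]| < e) (kap * L).
Proof.
move=> k0 r0.
pose M := (Num.truncn (6 * D.+1%:R / kap)).+1.
have M0 : 0 < M%:R :> R by rewrite ltr0n.
have MD : 6 * D.+1%:R <= kap * M%:R.
  rewrite -ler_pdivrMl // mulrC; have q0 : 0 <= 6 * D.+1%:R / kap by rewrite divr_ge0 ?mulr_ge0 ?ler0n // ltW.
  by have /andP[_ /ltW] := truncn_itv q0.
have D0 : 0 < D.+1%:R :> R by rewrite ltr0n.
have MD0 : 0 < M%:R ^+ D :> R by rewrite exprn_gt0.
(* Interpolation from [D+1] points at mutual distance [d] in an interval of length [d M] gives the
   bound [(D+1) e M^D], which is [rho / 2]. *)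
pose e := rho / (2 * D.+1%:R * M%:R ^+ D).
have e0 : 0 < e by rewrite divr_gt0 // !mulr_gt0.
exists e => // p u L sp L0 [y yu py].
pose d := L / M%:R.
have d0 : 0 < d by rewrite divr_gt0.
have LM : L = d * M%:R by rewrite /d divfK // gt_eqF.
pose cell (i : 'I_M) (x : R) := u + i%:R * d <= x < u + i%:R * d + d.
pose hit i := `[< exists x, cell i x /\ `|p.[x]| < e >].
have parity b : (#|[pred i : 'I_M | hit i && (odd i == b)]| <= D)%N.
  rewrite leqNgt; apply/negP => cD.
  set A := [pred i | _] in cD.
  pose k (i : 'I_D.+1) : 'I_M := enum_val (widen_ord cD i).
  have inj_k : injective k by move=> i j /enum_val_inj /(congr1 val) /= /val_inj.
  have kA i : hit (k i) && (odd (k i) == b) by exact: (enum_valP (widen_ord cD i)).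
  have /choice[t tP] : forall i, exists x, cell (k i) x /\ `|p.[x]| < e.
    by move=> i; have /andP[/asboolP] := kA i.
  have far i j : (k i < k j)%N -> d <= `|t i - t j|.
    move=> kij; have kij2 : (k i).+2%:R <= (k j)%:R :> R.
      by rewrite ler_nat; have /andP[_ /eqP oi] := kA i; have /andP[_ /eqP oj] := kA j; rewrite odd_gap // oi oj.
    have [/andP[_ h1] _] := tP i; have [/andP[h2 _] _] := tP j.
    have : t j - t i >= d by have := ler_wpM2r (ltW d0) kij2; rewrite -!natr1; lra.
    by rewrite distrC => h; apply: le_trans h (ler_norm _).
  have tfar i j : i != j -> d <= `|t i - t j|.
    move=> ij; have [lt|lt|/val_inj/inj_k eij] := ltngtP (k i) (k j); first exact: far.
      by rewrite distrC; exact: far.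
    by rewrite eij eqxx in ij.
  have inj_t : injective t.
    move=> i j eij; apply/eqP/negPn/negP => /tfar; rewrite eij subrr normr0; lra.
  have tu i : u <= t i < u + L.
    have [/andP[h1 h2] _] := tP i.
    have : (k i).+1%:R <= M%:R :> R by rewrite ler_nat ltn_ord.
    have := ler0n R (k i); rewrite LM -natr1 => ? ?; apply/andP; split; nra.
  have := @horner_le_lagr R D.+1 t p e d L y inj_t sp (fun i => ltW (tP i).2) d0 tfar.
  move=> H; suff : `|p.[y]| <= rho / 2 by lra.
  apply: le_trans (H _) _ => [j|].
    by have := tu j; move: yu => /andP[? ?] /andP[? ?]; rewrite ler_norml; apply/andP; split; lra.
  have -> : L / d = M%:R by rewrite LM mulrC mulKf // gt_eqF.
  rewrite /e /= le_eqVlt; apply/orP; left; apply/eqP; move: D0 MD0.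
  move: (D.+1%:R : R) (M%:R ^+ D : R) => w z w0 z0; field; rewrite !gt_eqF //.
have hitD : (#|hit| <= 2 * D)%N.
  rewrite -(cardID [pred i : 'I_M | odd i] hit) mul2n -addnn leq_add //.
    by apply: leq_trans (parity true); apply: subset_leq_card; apply/subsetP => i; rewrite !inE eqb_id andbC.
  by apply: leq_trans (parity false); apply: subset_leq_card; apply/subsetP => i; rewrite !inE eqbF_neg andbC.
(* Each half-open cell is enlarged to an open interval of length [3 d]; the total is at most
   [6 D d], and [M] was chosen to keep this below [kap L]. *)
have := @cov_bigcup_fin R 'I_M hit (fun i (x : R) => u + i%:R * d - d < x < u + i%:R * d + 2 * d) (fun=> 3 * d).
move=> H; apply: cov_sub (H _); last first.
- move=> i _; have h : u + i%:R * d - d <= u + i%:R * d + 2 * d by lra.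
  by apply: cov_sub (cov_itv h) => //; lra.
- rewrite sumr_const -[leLHS]mulr_natl.
  apply: (@le_trans _ _ ((2 * D)%:R * (3 * d))); first by rewrite ler_pM2r ?ler_nat // mulr_gt0.
  rewrite natrM LM; move: MD; rewrite -natr1 => MD.
  have := ler_wpM2r (ltW d0) MD; have := ler0n R D; nra.
move=> x [/andP[x1 x2] px].
have [|i /andP[i1 i2]] := @grid_index M ((x - u) / d).
  by rewrite divr_ge0 ?(ltW d0) ?subr_ge0 //= ltr_pdivrMr // mulrC -LM; lra.
move: i1 i2; rewrite ler_pdivlMr // ltr_pdivrMr // mulrDl mul1r => i1 i2.
exists i; last by apply/andP; split; lra.
by apply/asboolP; exists x; split=> //; apply/andP; split; lra.
Qed.

(** A polynomial smaller than [c] at [D+1] fixed nodes has all its coefficients below 1. The bound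
    is meant for nonzero integer polynomials, whatever their height. *)
Lemma int_poly_low (D : nat) (u L : R) : 0 < L -> exists2 c : R, 0 < c &
  forall p : {poly R}, (size p <= D.+1)%N -> (exists l, 1 <= `|p`_l|) ->
    exists2 y : R, u <= y < u + L & c <= `|p.[y]|.
Proof.
move=> L0.
have D0 : 0 < D.+1%:R :> R by rewrite ltr0n.
pose t (i : 'I_D.+1) := u + i%:R * (L / D.+1%:R).
have d0 : 0 < L / D.+1%:R by rewrite divr_gt0.
have inj_t : injective t.
  by move=> i j /addrI /(mulIf (lt0r_neq0 d0)) /eqP; rewrite eqr_nat => /eqP /val_inj.
have ti i : u <= t i < u + L.
  rewrite /t lerDl mulr_ge0 ?ler0n ?(ltW d0) //= ltrD2l mulrA ltr_pdivrMr // mulrC ltr_pM2l //.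
  by rewrite ltr_nat.
have K0 := lagr_norm_ge0 t.
have K1 : 0 < lagr_norm t + 1 by lra.
exists (lagr_norm t + 1)^-1; first by rewrite invr_gt0.
move=> p sp [l pl]; apply: contrapT => nex.
have pe i : `|p.[t i]| <= (lagr_norm t + 1)^-1.
  by rewrite leNgt; apply/negP => h; apply: nex; exists (t i) => //; exact: ltW.
have := le_trans pl (coef_le_lagr_norm l inj_t sp pe).
by rewrite ler_pdivlMr // mul1r; lra.
Qed.

(** One constant for all choices of [m] integer nodes below [N]; the [+ 1] makes the comparison in
    [few_small] strict. *)
Definition lagr_all m N : R :=
  \sum_(T : {ffun 'I_m -> 'I_N}) lagr_norm (fun i => (T i)%:R : R) + 1.

Lemma lagr_all_gt0 m N : 0 < lagr_all m N.
Proof. by rewrite ltr_wpDl // sumr_ge0 // => T _; exact: lagr_norm_ge0. Qed.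

Definition small_at N (p : {poly R}) (a : R) := [pred t : 'I_N | `|p.[t%:R]| < a].

Lemma few_small m N (p : {poly R}) l : (size p <= m)%N -> 0 < `|p`_l| ->
  (#|small_at N p (`|p`_l| / lagr_all m N)%R| < m)%N.
Proof.
move=> sp pl; rewrite ltnNge; apply/negP => cD.
set A := small_at _ _ _ in cD.
pose k (i : 'I_m) : 'I_N := enum_val (widen_ord cD i).
have inj_k : injective k by move=> i j /enum_val_inj /(congr1 val) /= /val_inj.
have kA i : `|p.[(k i)%:R]| < `|p`_l| / lagr_all m N by exact: (enum_valP (widen_ord cD i)).
pose t i : R := (finfun k i)%:R.
have inj_t : injective t.
  by move=> i j; rewrite /t !ffunE => /eqP; rewrite eqr_nat => /eqP /val_inj /inj_k.
have := @coef_le_lagr_norm R m t p (`|p`_l| / lagr_all m N) l inj_t sp.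
have K0 := lagr_all_gt0 m N.
move=> H; have {H} : `|p`_l| <= lagr_norm t * (`|p`_l| / lagr_all m N).
  by apply: H => i; rewrite /t ffunE; exact: ltW.
rewrite mulrA ler_pdivlMr // mulrC ler_pM2r // leNgt => /negP; apply.
rewrite /lagr_all (bigD1 (finfun k)) //= -addrA ltrDl ltr_wpDl // sumr_ge0 // => T _.
exact: lagr_norm_ge0.
Qed.

(** A Gelfond-type inequality obtained from values at integers. Among [2 n + 1] integers each factor
    is small at no more than [n], so at some integer [t] both are bounded below, [f] in terms of any
    chosen coefficient and [g] by its leading coefficient, a nonzero integer. The value of the
    product at [t] is bounded by its coefficients. *)
Lemma factor_height (n : nat) : exists2 C : R, 1 <= C &
  forall (f g : {poly int}) (B : R), f * g != 0 -> (size (f * g)%R <= n.+1)%N ->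
    (forall l, `|(f * g)`_l|%:~R <= B) -> forall l, `|f`_l|%:~R <= C * B.
Proof.
pose N := (2 * n).+1.
pose K := lagr_all n.+1 N.
have K0 : 0 < K := lagr_all_gt0 _ _.
pose E : R := \sum_(l < n.+1) N%:R ^+ l.
have E1 : 1 <= E by rewrite /E big_ord_recl expr0 lerDl sumr_ge0 // => i _; rewrite exprn_ge0.
exists (1 + K ^+ 2 * E); first by rewrite lerDl mulr_ge0 ?exprn_ge0 ?ltW // (lt_le_trans ltr01).
move=> f g B fg0 sfg fgB l.
have B0 : 0 <= B by apply: le_trans (fgB 0%N); rewrite ler0z.
have [->|fl0] := eqVneq f`_l 0.
  by rewrite normr0 mulr_ge0 // addr_ge0 // mulr_ge0 ?exprn_ge0 ?ltW // (lt_le_trans ltr01).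
have /andP[f0 g0] : (f != 0) && (g != 0) by rewrite -negb_or -mulf_eq0.
have sz : (size f <= n.+1)%N && (size g <= n.+1)%N.
  have f1 : (0 < size f)%N by rewrite size_poly_gt0.
  have g1 : (0 < size g)%N by rewrite size_poly_gt0.
  move: sfg f1 g1; rewrite size_mul //; move: (size f) (size g) => a b h1 h2 h3; apply/andP; split; lia.
have /andP[sf sg] := sz.
pose F : {poly R} := map_poly intr f; pose G : {poly R} := map_poly intr g.
have sF : (size F <= n.+1)%N by rewrite (leq_trans (size_poly _ _)).
have sG : (size G <= n.+1)%N by rewrite (leq_trans (size_poly _ _)).
have Fl : `|F`_l| = `|f`_l|%:~R by rewrite coef_map /= intr_norm.
have Gl : 1 <= `|G`_(size g).-1|.
  rewrite coef_map /= -intr_norm -[_`__]/(lead_coef g) ler1z.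
  by rewrite -gtz0_ge1 normr_gt0 lead_coef_eq0.
have cF := @few_small n.+1 N F l sF.
have cG := @few_small n.+1 N G (size g).-1 sG.
have {}cF := cF (_ : 0 < `|F`_l|); have {}cG := cG (lt_le_trans ltr01 Gl).
have [t Ft Gt] : exists2 t : 'I_N, `|F`_l| / K <= `|F.[t%:R]| & `|G`_(size g).-1| / K <= `|G.[t%:R]|.
  apply: contrapT => nex.
  have : (#|'I_N| <= n + n)%N.
    set A := small_at _ F _ in cF.
    set A' := small_at _ G _ in cG.
    apply: (@leq_trans (#|A| + #|A'|)%N); last first.
      have h : (0 < `|F`_l|) by rewrite Fl ltr0z normr_gt0.
      by rewrite leq_add // -ltnS // cF.
    rewrite -cardUI; apply: leq_trans (leq_addr _ _); apply: subset_leq_card.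
    apply/subsetP => t _; rewrite !inE; apply: contrapT => /negP; rewrite negb_or -!leNgt => /andP[h1 h2].
    by apply: nex; exists t.
  by rewrite card_ord /N mul2n addnn ltnn.
have FG : F * G = map_poly intr (f * g) by rewrite rmorphM.
have up : `|(F * G).[t%:R]| <= B * E.
  rewrite FG (@horner_coef_wide _ n.+1) ?(leq_trans (size_poly _ _)) //.
  apply: le_trans (ler_norm_sum _ _ _) _; rewrite mulr_sumr; apply: ler_sum => i _.
  rewrite coef_map /= normrM -intr_norm; apply: ler_pM => //; rewrite ?ler0z // normrX normr_nat.
  by apply: lerXn2r; rewrite ?nnegrE ?ler0n // ler_nat ltnW.
rewrite -Fl; move: up; rewrite hornerM normrM.
have h1 : `|F`_l| / K * (1 / K) <= `|F.[t%:R]| * `|G.[t%:R]|.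
  apply: ler_pM => //; [by rewrite divr_ge0 // ltW|by rewrite divr_ge0 // ltW|].
  by apply: le_trans Gt; rewrite ler_pM2r ?invr_gt0.
move=> /(le_trans h1); rewrite mulrA mulr1 -mulrA -invfM ler_pdivrMr ?mulr_gt0 // => h.
rewrite -expr2 in h; apply: le_trans h _; rewrite mulrDl mul1r.
have -> : B * E * K ^+ 2 = K ^+ 2 * E * B by ring.
by rewrite lerDr.
Qed.

End PolyBounds.

(** * Minors *)

Section Minors.
Variables (R : realType) (n : nat).
Implicit Types (Q x y : R).

(* The coefficient vector [r] of a polynomial [P] is mapped to [(Q^n P(x), r_1/Q, .., r_n/Q)]. *)
Definition Hmx Q x : 'M[R]_n.+1 :=
  \matrix_(i, j) if j == ord0 then Q ^+ n * x ^+ i else (i == j)%:R / Q.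

Definition minor Q j (V : 'M[R]_(j, n.+1)) (S : {ffun 'I_j -> 'I_n.+1}) x : R :=
  \det (colsub S (V *m Hmx Q x)).

(* Plays the role of the covolume of the lattice spanned by the rows of [V *m Hmx Q x]. *)
Definition psi Q j (V : 'M[R]_(j, n.+1)) x : R :=
  \big[Num.max/0]_(S : {ffun 'I_j -> 'I_n.+1}) `|minor Q V S x|.

Definition zmx j (V : 'M[int]_(j, n.+1)) : 'M[R]_(j, n.+1) := map_mx intr V.

Lemma psi_ge0 Q j (V : 'M_(j, n.+1)) x : 0 <= psi Q V x.
Proof. by rewrite /psi; elim/big_ind: _ => // a b a0 b0; rewrite le_max a0. Qed.

Lemma minor_le_psi Q j (V : 'M_(j, n.+1)) S x : `|minor Q V S x| <= psi Q V x.
Proof. exact: (le_bigmax 0 (fun S => `|minor Q V S x|) S). Qed.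

Lemma psi_geP Q j (V : 'M_(j, n.+1)) x r : 0 < r -> r <= psi Q V x -> exists S, r <= `|minor Q V S x|.
Proof.
move=> r0 rp; apply: contrapT => nex.
suff : psi Q V x < r by rewrite ltNge rp.
apply/bigmax_ltP; split=> // S _; rewrite ltNge; apply/negP => h; apply: nex; by exists S.
Qed.

(** The degree depends neither on [V] nor on [Q]; this is what lets [doubling] and [poly_sub_cov]
    act on minors with uniform constants. *)
Lemma minor_poly Q j (V : 'M_(j, n.+1)) S : (j <= n.+1)%N ->
  exists2 p : {poly R}, (size p <= (n.+1 * n).+1)%N & forall x, minor Q V S x = p.[x].
Proof.
move=> jn.
pose HP : 'M[{poly R}]_n.+1 :=
  \matrix_(i, j) if j == ord0 then Q ^+ n *: 'X^i else ((i == j)%:R / Q)%:P.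
pose M : 'M[{poly R}]_j := colsub S (map_mx polyC V *m HP).
exists (\det M); last first.
  move=> x; rewrite -[RHS]/(horner_eval x (\det M)) -det_map_mx; congr (\det _).
  apply/matrixP => i k; rewrite /M !mxE /= /horner_eval horner_sum; apply: eq_bigr => l _.
  by rewrite !mxE hornerM hornerC; case: ifP => _; rewrite ?hornerZ ?hornerXn ?hornerC.
have sM i k : (size (M i k) <= n.+1)%N.
  rewrite /M !mxE; apply: leq_trans (size_sum _ _ _) _; apply/bigmax_leqP => l _.
  rewrite !mxE mul_polyC; apply: leq_trans (size_scale_leq _ _) _.
  case: ifP => _; last by rewrite (leq_trans (size_polyC_leq1 _)).
  by apply: leq_trans (size_scale_leq _ _) _; rewrite size_polyXn.
rewrite /determinant; apply: leq_trans (size_sum _ _ _) _; apply/bigmax_leqP => s _.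
rewrite mulr_sign (fun_if (fun q : {poly R} => size q)) size_polyN if_same.
apply: leq_trans (size_poly_prod_leq _ _) _; rewrite card_ord leq_subLR.
apply: (@leq_ltn_trans (\sum_(i < j) n.+1)); first exact: leq_sum.
by rewrite sum_nat_const card_ord addnS ltnS mulnS leq_add2l leq_mul2r jn orbT.
Qed.

(** Laplace expansion of each minor along the new row. *)
Lemma psi_col_mx Q j (r : 'rV_n.+1) (V : 'M_(j, n.+1)) x (b : R) :
  (forall k, `|(r *m Hmx Q x) 0 k| <= b) -> psi Q (col_mx r V) x <= j.+1%:R * (b * psi Q V x).
Proof.
move=> rb.
have b0 : 0 <= b by apply: le_trans (rb 0).
apply/bigmax_leP; split=> [|S _]; first by rewrite !mulr_ge0 ?psi_ge0.
rewrite /minor (expand_det_row _ (ord0 : 'I_(1 + j))) (le_trans (ler_norm_sum _ _ _)) //.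
have -> (y : R) : j.+1%:R * y = \sum_(i < j.+1) y by rewrite sumr_const card_ord mulr_natl.
apply: ler_sum => k _.
have e0 : (ord0 : 'I_(1 + j)) = lshift j ord0 by apply/val_inj.
rewrite normrM; apply: ler_pM => //; first by rewrite mxE mul_col_mx e0 col_mxEu.
rewrite /cofactor normrM normrX normrN1 expr1n mul1r.
pose S' : {ffun 'I_j -> 'I_n.+1} := [ffun i => S (lift k i)].
have -> : row' ord0 (col' k (colsub S (col_mx r V *m Hmx Q x))) = colsub S' (V *m Hmx Q x).
  apply/matrixP => i l; rewrite mul_col_mx 3!mxE [RHS]mxE ffunE.
  have -> : lift ord0 i = rshift 1 i by apply/val_inj.
  by rewrite col_mxEd.
exact: minor_le_psi.
Qed.

(** Every minor is multiplied by [\det A], so the functions attached to two bases of one space are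
    proportional, with a ratio independent of [x]. *)
Lemma psi_span Q j (V W : 'M_(j, n.+1)) : (V <= W)%MS ->
  exists2 A : 'M_j, V = A *m W & forall x, psi Q V x = `|\det A| * psi Q W x.
Proof.
case/submxP => A ->; exists A => // x.
have minorA S : minor Q (A *m W) S x = \det A * minor Q W S x.
  rewrite /minor -mulmxA -det_mulmx; congr (\det _).
  by apply/matrixP => i k; rewrite !mxE; apply: eq_bigr => l _; rewrite !mxE.
apply/eqP; rewrite eq_le; apply/andP; split.
  apply/bigmax_leP; split=> [|S _]; first by rewrite mulr_ge0 ?psi_ge0.
  by rewrite minorA normrM ler_wpM2l // minor_le_psi.
have [->|dA] := eqVneq (\det A) 0; first by rewrite normr0 mul0r psi_ge0.
rewrite mulrC -ler_pdivlMr ?normr_gt0 //.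
apply/bigmax_leP; split=> [|S _]; first by rewrite divr_ge0 ?psi_ge0.
by rewrite ler_pdivlMr ?normr_gt0 // mulrC -normrM -minorA minor_le_psi.
Qed.

Lemma det_Hmx Q x : Q != 0 -> \det (Hmx Q x) = 1.
Proof.
move=> Q0; rewrite det_trig; last first.
  apply/is_trig_mxP => i j ij; rewrite mxE; case: eqP => [j0|_]; first by rewrite j0 in ij.
  by case: eqP => [e|_]; [rewrite e ltnn in ij|rewrite mul0r].
rewrite big_ord_recl mxE eqxx expr0 mulr1.
under eq_bigr => i _ do rewrite mxE eqxx mul1r.
by rewrite /= prodr_const card_ord exprVn divff // expf_neq0.
Qed.

Lemma psi_full Q x : Q != 0 -> 1 <= psi Q (1%:M : 'M_n.+1) x.
Proof.
move=> Q0; apply: le_trans (minor_le_psi Q _ [ffun i => i] x).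
rewrite /minor mul1mx.
have -> : colsub [ffun i => i] (Hmx Q x) = Hmx Q x by apply/matrixP => i j; rewrite mxE ffunE.
by rewrite det_Hmx // normr1.
Qed.

Lemma psi_bottom Q (V : 'M_(0, n.+1)) x : psi Q V x = 1.
Proof.
apply/eqP; rewrite eq_le; apply/andP; split.
  by apply/bigmax_leP; split=> // S _; rewrite /minor det_mx00 normr1.
apply: le_trans (minor_le_psi Q V [ffun i => ord0] x).
by rewrite /minor det_mx00 normr1.
Qed.

Lemma row_free_minor j (V : 'M[R]_(j, n.+1)) : row_free V ->
  exists2 T : {ffun 'I_j -> 'I_n.+1}, injective T & \det (colsub T V) != 0.
Proof.
move=> fV.
have full : row_full V^T by rewrite /row_full mxrank_tr.
exists (fullrankfun full); first exact: fullrankfun_inj.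
have := fullrowsub_unit full; rewrite unitmxE unitfE -det_tr.
by congr (\det _ != 0); apply/matrixP => i k; rewrite !mxE.
Qed.

(** Take [j] columns of [V] with nonzero minor and replace one of them by column 0, namely column 0
    itself if it is among them. The new minor of [V *m Hmx Q y] is [Q^(n-j+1)] times an integer
    polynomial in [y] that has the old minor among its coefficients. [int_poly_low] bounds this
    polynomial below at some [y], and the power of [Q], positive as [j <= n], absorbs the
    constant. *)
Lemma psi_low (u L : R) : 0 < L -> exists2 Q0 : R, 1 <= Q0 & forall Q, Q0 <= Q ->
  forall j (V : 'M[int]_(j, n.+1)), (0 < j <= n)%N -> row_free (zmx V) ->
  exists2 y : R, u <= y < u + L & 1 <= psi Q (zmx V) y.
Proof.
move=> L0; have [c c0 Hc] := @int_poly_low R n u L L0.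
exists (1 + c^-1); first by rewrite lerDl invr_ge0 ltW.
move=> Q QQ j V /andP[j0 jn] fV.
have Q1 : 1 <= Q by apply: le_trans QQ; rewrite lerDl invr_ge0 ltW.
have Qp : 0 < Q by apply: lt_le_trans Q1.
have [T inj_T detT] := row_free_minor fV.
have [i0 Ti0] : exists i0, forall i, T i = ord0 -> i = i0.
  case: (pickP (fun i => T i == ord0)) => [i0 /eqP e0|noT].
    by exists i0 => i ei; apply: inj_T; rewrite ei.
  by exists (Ordinal j0) => i ei; have := noT i; rewrite ei eqxx.
pose S : {ffun 'I_j -> 'I_n.+1} := [ffun i => if i == i0 then ord0 else T i].
pose cof i := cofactor (colsub T (zmx V)) i i0.
pose cofz i := cofactor (colsub T V) i i0.
have cofE i : cof i = (cofz i)%:~R.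
  rewrite /cof /cofz -cofactor_map_mx; congr (cofactor _ _ _).
  by apply/matrixP => a b; rewrite !mxE.
pose a l : int := \sum_i V i l * cofz i.
pose p : {poly R} := \poly_(l < n.+1) (a (inord l))%:~R.
have aT : (a (T i0))%:~R = \det (colsub T (zmx V)) :> R.
  rewrite (expand_det_col _ i0) /a rmorph_sum; apply: eq_bigr => i _.
  by rewrite rmorphM /= -[cofactor _ _ _]/(cof i) cofE !mxE.
pose M y : 'M[R]_j := \matrix_(i, k) if k == i0 then \sum_l (V i l)%:~R * y ^+ l else (V i (T k))%:~R.
have detM y : \det (M y) = p.[y].
  rewrite (expand_det_col _ i0) horner_poly.
  under eq_bigr => i _.
    have -> : cofactor (M y) i i0 = cof i.
      rewrite /cof /cofactor; congr (_ * \det _); apply/matrixP => b e; rewrite !mxE.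
      by rewrite eq_sym (negPf (neq_lift _ _)).
    rewrite mxE eqxx mulr_suml cofE; over.
  rewrite exchange_big; apply: eq_bigr => l _ /=.
  rewrite /a inord_val rmorph_sum mulr_suml; apply: eq_bigr => i _.
  by rewrite rmorphM /= mulrAC.
have [|y yu py] := Hc p (size_poly _ _).
  exists (T i0); rewrite coef_poly ltn_ord inord_val -intr_norm ler1z -gtz0_ge1 normr_gt0.
  by apply: contraNneq detT => e; rewrite -aT e.
exists y => //; apply: le_trans (minor_le_psi Q _ S y).
pose d : 'rV[R]_j := \row_k if k == i0 then Q ^+ n else Q^-1.
have -> : minor Q (zmx V) S y = \det (M y) * \det (diag_mx d).
  rewrite /minor -det_mulmx mul_mx_diag; congr (\det _); apply/matrixP => i k; rewrite !mxE ffunE.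
  case: (eqVneq k i0) => [_|ki].
    rewrite mulr_suml; apply: eq_bigr => l _; rewrite !mxE eqxx; ring.
  have T0 : (T k == ord0) = false by apply/negP => /eqP/Ti0 e; rewrite e eqxx in ki.
  rewrite (bigD1 (T k)) //= big1 ?addr0 => [|l lT]; last by rewrite !mxE T0 (negPf lT) mul0r mulr0.
  by rewrite !mxE T0 eqxx mul1r.
rewrite det_diag detM normrM (bigD1 i0) //= mxE eqxx.
have -> : \prod_(i | i != i0) d 0 i = Q ^- j.-1.
  rewrite (eq_bigr (fun=> Q^-1)) => [|i ii]; last by rewrite mxE (negPf ii).
  by rewrite prodr_const exprVn; congr (Q ^- _); have := cardC1 i0; rewrite card_ord => <-; apply: eq_card.
have -> : Q ^+ n / Q ^+ j.-1 = Q * Q ^+ (n - j).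
  have -> : n = ((n - j).+1 + j.-1)%N by lia.
  by rewrite exprD mulfK ?expf_neq0 ?gt_eqF // exprS; congr (_ * Q ^+ _); lia.
have Qn : 1 <= Q ^+ (n - j) by rewrite exprn_ege1.
have cQ : 1 <= c * Q.
  by rewrite -ler_pdivrMl // mulr1; apply: le_trans QQ; rewrite lerDr.
rewrite [X in _ * X]ger0_norm ?mulr_ge0 ?(ltW Qp) ?exprn_ge0 ?(ltW Qp) //.
apply: le_trans (_ : 1 <= c * Q * Q ^+ (n - j)) _; first by rewrite mulr_ege1.
by rewrite -mulrA ler_wpM2r // mulr_ge0 ?(ltW Qp) // (le_trans ler01).
Qed.

End Minors.

(** * Dyadic stopping times *)

Section Stopping.
Variables (R : realType) (Stop : R -> R -> Prop).

(** Intervals reached after exactly [d] halvings at which [Stop] holds for the first time; over all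
    [d] they are the maximal stopping intervals. *)
Fixpoint first_stops d (u L : R) : seq (R * R) :=
  if `[< Stop u L >] then (if d is 0 then [:: (u, L)] else [::])
  else if d is d'.+1 then first_stops d' u (L / 2) ++ first_stops d' (u + L / 2) (L / 2)
  else [::].

Fixpoint halving d (u L x : R) : R * R :=
  if d is d'.+1 then
    (if x < u + L / 2 then halving d' u (L / 2) x else halving d' (u + L / 2) (L / 2) x)
  else (u, L).

Lemma halvingP d (u L x : R) : u <= x < u + L ->
  (halving d u L x).2 = L / 2 ^+ d /\
  (halving d u L x).1 <= x < (halving d u L x).1 + (halving d u L x).2.
Proof.
elim: d u L => [|d IHd] u L xu /=; first by rewrite expr0 divr1.
rewrite exprS invfM mulrA; move: xu => /andP[x1 x2].
by case: ltP => h; apply: IHd; apply/andP; split=> //; lra.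
Qed.

Lemma first_stops_sum N (u L : R) : 0 <= L ->
  \sum_(d < N) \sum_(J <- first_stops d u L) J.2 <= L.
Proof.
elim: N u L => [|N IHN] u L L0; first by rewrite big_ord0.
rewrite big_ord_recl /=; case: asboolP => h.
  by rewrite big_seq1 big1 ?addr0 // => d _; rewrite /bump /= big_nil.
rewrite big_nil add0r.
have -> : \sum_(i < N) \sum_(J <- first_stops (0 + i) u (L / 2) ++
                                    first_stops (0 + i) (u + L / 2) (L / 2)) J.2 =
  \sum_(i < N) \sum_(J <- first_stops i u (L / 2)) J.2 +
  \sum_(i < N) \sum_(J <- first_stops i (u + L / 2) (L / 2)) J.2.
  by rewrite -big_split; apply: eq_bigr => i _; rewrite big_cat.
have L2 : 0 <= L / 2 by lra.
have := IHN u _ L2; have := IHN (u + L / 2) _ L2; lra.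
Qed.

Lemma first_stops_parent d (u L : R) J : 0 < L -> ~ Stop u L -> J \in first_stops d u L ->
  exists u0 L0 : R, [/\ 0 < L0, ~ Stop u0 L0, Stop J.1 J.2, J.2 = L0 / 2
    & J.1 = u0 \/ J.1 = u0 + L0 / 2].
Proof.
elim: d u L => [|d IHd] u L L0 nS /=; first by case: asboolP.
case: asboolP => // _.
have L2 : 0 < L / 2 by lra.
have base u' : u' = u \/ u' = u + L / 2 -> J \in first_stops d u' (L / 2) ->
  exists u0 L0 : R, [/\ 0 < L0, ~ Stop u0 L0, Stop J.1 J.2, J.2 = L0 / 2
    & J.1 = u0 \/ J.1 = u0 + L0 / 2].
  move=> eu; have [S'|nS'] := pselect (Stop u' (L / 2)); last exact: IHd.
  case: d {IHd} => [|d] /=; case: asboolP => // _.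
  by rewrite inE => /eqP -> /=; exists u, L.
by rewrite mem_cat => /orP[]; apply: base; [left|right].
Qed.

Lemma first_stops_cover d (u L x : R) : u <= x < u + L ->
  Stop (halving d u L x).1 (halving d u L x).2 ->
  exists d' J, J \in first_stops d' u L /\ J.1 <= x < J.1 + J.2.
Proof.
elim: d u L => [|d IHd] u L xu /=.
  by move=> S; exists 0, (u, L); split=> //=; case: asboolP => //; rewrite inE eqxx.
have [S _|nS] := pselect (Stop u L).
  by exists 0, (u, L); split=> //=; case: asboolP => //; rewrite inE eqxx.
move: xu => /andP[x1 x2].
case: ltP => h S.
  have xu : u <= x < u + L / 2 by apply/andP.
  have [d' [J [J1 J2]]] := IHd _ _ xu S; exists d'.+1, J; split=> //=.
  by case: asboolP => // _; rewrite mem_cat J1.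
have xu : u + L / 2 <= x < u + L / 2 + L / 2 by apply/andP; split=> //; lra.
have [d' [J [J1 J2]]] := IHd _ _ xu S; exists d'.+1, J; split=> //=.
by case: asboolP => // _; rewrite mem_cat J1 orbT.
Qed.

(** Local bounds add up because the maximal stopping intervals are disjoint. Maximality is handed to
    the local hypothesis in the form of a parent that does not stop, the only trace of it that
    doubling requires. *)
Lemma stopping_cov (Z : R -> Prop) (u L K : R) : 0 < L -> 0 <= K ->
  (forall x, Z x -> u <= x < u + L /\ exists d, Stop (halving d u L x).1 (halving d u L x).2) ->
  ~ Stop u L ->
  (forall u0 L0 u' : R, 0 < L0 -> ~ Stop u0 L0 -> Stop u' (L0 / 2) -> u' = u0 \/ u' = u0 + L0 / 2 ->
     cov (fun x => Z x /\ u' <= x < u' + L0 / 2) (K * (L0 / 2))) ->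
  cov Z (K * L).
Proof.
move=> L0 K0 hZ nS hS.
pose A d x := Z x /\ exists2 J, J \in first_stops d u L & J.1 <= x < J.1 + J.2.
pose c d := K * \sum_(J <- first_stops d u L) J.2.
apply: (@cov_sub _ _ (fun x => exists d, A d x) _ (K * L)) => //.
  move=> x Zx; have [xu [d Sd]] := hZ _ Zx.
  by have [d' [J [J1 J2]]] := first_stops_cover xu Sd; exists d'; split=> //; exists J.
apply: (@cov_bigcup R A c) => [d|N]; last first.
  by rewrite -mulr_sumr ler_wpM2l // first_stops_sum // ltW.
have := @cov_bigcup_seq R (R * R)%type (first_stops d u L)
  (fun J x => J \in first_stops d u L /\ (Z x /\ J.1 <= x < J.1 + J.2))
  (fun J => if J \in first_stops d u L then K * J.2 else 0).
move=> H; apply: cov_sub (H _) => {H}.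
- move=> x [Zx [J J1 J2]].
  have : List.In J (first_stops d u L).
    elim: (first_stops d u L) J1 => //= J' s IHs; rewrite inE => /orP[/eqP ->|/IHs]; [by left|by right].
  by move=> inJ; apply/List.Exists_exists; exists J.
- rewrite /c mulr_sumr [leLHS]big_seq [leRHS]big_seq; apply: ler_sum => J ->; exact: lexx.
move=> J; case: ifP => [JS|_]; last by apply: cov_sub (lexx _) (@cov0 R) => x [].
have [u0 [L1 [L10 nS0 SJ e1 e2]]] := first_stops_parent L0 nS JS.
rewrite e1 in SJ *; apply: cov_sub (hS u0 L1 J.1 L10 nS0 SJ e2) => //.
by move=> x [_ []].
Qed.

End Stopping.

Lemma halving_small (R : realType) (u L x d : R) : u <= x < u + L -> 0 < d ->
  exists k, forall y, (halving k u L x).1 <= y < (halving k u L x).1 + (halving k u L x).2 -> `|y - x| <= d.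
Proof.
move=> xu d0; pose k := (Num.truncn (L / d)).+1; exists k => y.
have [e /andP[h1 h2]] := halvingP k xu.
have L0 : 0 <= L by move: xu => /andP[? ?]; lra.
have kL : L / d <= k%:R.
  by have /andP[_ /ltW] := truncn_itv (divr_ge0 L0 (ltW d0)).
have k2 : k%:R <= 2 ^+ k :> R by rewrite -natrX ler_nat ltnW // ltn_expl.
have : L / 2 ^+ k <= d.
  by rewrite ler_pdivrMr ?exprn_gt0 // mulrC -ler_pdivrMr // (le_trans kL).
rewrite -e => h3 /andP[h4 h5]; rewrite ler_norml; apply/andP; split; lra.
Qed.

(** * Flags of integer row tuples *)

Section Flags.
Variables (R : realType) (n : nat) (Q : R).

(** Tuples of varying length are packed so that a flag is a plain list. A free tuple stands for a
    subgroup of [Z^(n+1)], its row space for a rational subspace. *)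
Definition tup := {j : nat & 'M[int]_(j, n.+1)}.
Implicit Types (s t f g : tup) (F : seq tup).

Definition rmx s : 'M[R]_(tag s, n.+1) := zmx R (tagged s).
Definition ps s x := psi Q (rmx s) x.
Definition cmp s t := (rmx s <= rmx t)%MS || (rmx t <= rmx s)%MS.

Definition isflag F := [/\ {in F, forall f, row_free (rmx f)}, {in F &, forall f g, cmp f g},
  uniq (map tag F), exists2 f, f \in F & tag f = 0%N & exists2 f, f \in F & tag f = n.+1].

Definition adm F s := [/\ row_free (rmx s), {in F, forall f, cmp s f} & tag s \notin map tag F].

Lemma cmpC s t : cmp s t = cmp t s. Proof. by rewrite /cmp orbC. Qed.

Lemma rank_rmx s : row_free (rmx s) -> \rank (rmx s) = tag s.
Proof. by move/eqP. Qed.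

Lemma tag_le s : row_free (rmx s) -> (tag s <= n.+1)%N.
Proof. by move/rank_rmx <-; exact: rank_leq_col. Qed.

Lemma cmp_le s t : row_free (rmx s) -> row_free (rmx t) -> cmp s t -> (tag s <= tag t)%N ->
  (rmx s <= rmx t)%MS.
Proof.
move=> fs ft /orP[//|ts] st; have := mxrank_leqif_sup ts.
by rewrite !rank_rmx // => -[h1 <-]; rewrite eqn_leq h1 st.
Qed.

Lemma ps_same s t : tag s = tag t -> (rmx s <= rmx t)%MS ->
  exists2 c, 0 <= c & forall x, ps s x = c * ps t x.
Proof.
case: s t => [j V] [k W] /= e; case: _ / e W => W.
by case/(psi_span Q) => A _ h; exists `|\det A| => //; exact: h.
Qed.

Lemma ps_near s x r : (tag s <= n.+1)%N -> 0 < r -> ps s x < r ->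
  exists2 d, 0 < d & forall y, `|y - x| <= d -> ps s y < r.
Proof.
move=> sn r0 psr.
have near (S : {ffun 'I_(tag s) -> 'I_n.+1}) :
    exists d : R, 0 < d /\ forall y, `|y - x| <= d -> `|minor Q (rmx s) S y| < r.
  have [p _ hp] := minor_poly Q (rmx s) S sn.
  have : `|p.[x]| < r by rewrite -hp; apply: le_lt_trans psr; exact: minor_le_psi.
  by case/horner_near => d d0 hd; exists d; split=> // y /hd; rewrite hp.
have [d hd] := choice near.
have s0 : 0 <= \sum_S (d S)^-1 by apply: sumr_ge0 => S _; rewrite invr_ge0 ltW // (hd S).1.
exists (1 + \sum_S (d S)^-1)^-1; first by rewrite invr_gt0; lra.
move=> y yx; apply/bigmax_ltP; split=> // S _; apply: (hd S).2.
apply: le_trans yx _; rewrite -[leRHS]invrK lef_pV2 ?posrE ?invr_gt0 ?(hd S).1 //; last by lra.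
rewrite (bigD1 S) //=; have : 0 <= \sum_(i | i != S) (d i)^-1; last by lra.
by apply: sumr_ge0 => T _; rewrite invr_ge0 ltW // (hd T).1.
Qed.

Definition push (r : 'rV[int]_n.+1) f : tup :=
  @Tagged nat (1 + tag f)%N (fun j => 'M[int]_(j, n.+1)) (col_mx r (tagged f)).

Lemma rmx_push r f : rmx (push r f) = col_mx (zmx R r) (rmx f).
Proof. by rewrite /rmx /push /= /zmx map_col_mx. Qed.

(** Let [f] be the member of largest rank whose space omits [r]. The members omitting [r] lie in
    [f], the others contain both [f] and [r]; so all are comparable with the space spanned by [f]
    and [r]. *)
Lemma flag_push F (r : 'rV[int]_n.+1) : isflag F -> r != 0 ->
  exists2 f, f \in F & [/\ (tag f <= n)%N, row_free (rmx (push r f))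
    & {in F, forall e, cmp (push r f) e}].
Proof.
move=> [fF cF uF [b bF b0] [t tF tn]] r0.
pose P f := ~~ (zmx R r <= rmx f)%MS.
have Pb : P b.
  have e0 : rmx b = 0 by apply/eqP; rewrite -mxrank_eq0 rank_rmx ?fF // b0.
  rewrite /P e0; apply: contra r0 => /submx0null /matrixP e; apply/eqP/matrixP => i k.
  by have := e i k; rewrite !mxE => /eqP; rewrite intr_eq0 => /eqP.
have Pt f : f \in F -> P f -> (tag f <= n)%N.
  move=> fF' Pf; have := tag_le (fF _ fF'); rewrite leq_eqVlt => /orP[/eqP e|//].
  case/negP: Pf; apply: submx_full; rewrite /row_full rank_rmx ?fF // e //.
have [f [fF' Pf fmax]] : exists f, [/\ f \in F, P f & forall g, g \in F -> P g -> (tag g <= tag f)%N].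
  pose q k := has (fun f => P f && (tag f == k)) F.
  have q0 : exists k, q k by exists (tag b); apply/hasP; exists b; rewrite // Pb eqxx.
  have qn k : q k -> (k <= n)%N by case/hasP => f fF' /andP[Pf /eqP <-]; exact: Pt.
  case: (ex_maxnP q0 qn) => k /hasP[f fF' /andP[Pf /eqP <-]] kmax.
  by exists f; split=> // g gF Pg; apply: kmax; apply/hasP; exists g; rewrite // Pg eqxx.
have sub_f : (rmx f <= rmx (push r f))%MS by rewrite rmx_push -addsmxE addsmxSr.
have sub_r : (zmx R r <= rmx (push r f))%MS by rewrite rmx_push -addsmxE addsmxSl.
have fP : row_free (rmx (push r f)).
  have : (\rank (rmx f) < \rank (rmx (push r f)))%N.
    by apply: rank_ltmx; rewrite ltmxE sub_f /=; apply: contra Pf; exact: submx_trans.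
  by rewrite (rank_rmx (fF _ fF')) => lt; rewrite /row_free eqn_leq rank_leq_row; exact: lt.
exists f => //; split=> [||e eF] //; first exact: Pt.
have [Pe|/negPn re] := boolP (P e); rewrite /cmp.
  apply/orP; right; apply: submx_trans sub_f.
  by apply: cmp_le => //; [exact: fF|exact: fF|exact: cF|exact: fmax].
apply/orP; left; rewrite rmx_push -addsmxE addsmx_sub re /=.
apply: cmp_le; [exact: fF|exact: fF|exact: cF|].
rewrite leqNgt; apply/negP => lt; case/negP: Pf; apply: submx_trans re _.
by apply: cmp_le; [exact: fF|exact: fF|exact: cF|exact: ltnW].
Qed.

End Flags.

(** * Quantitative nondivergence *)

Section Nondivergence.
Variables (R : realType) (n : nat).
Implicit Types (F : seq (tup n)).

Definition short_at (Q e x : R) :=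
  exists2 r : 'rV[int]_n.+1, r != 0 & forall k, `|(zmx R r *m Hmx n Q x) 0 k| <= e.

(** Upper bounds are asked only in rank at most [n], where a vector can still be adjoined; the lower
    bound [eps] prevents the adjoined tuple from repeating a rank of the flag. *)
Definition flag_bad Q eps e F (u L x : R) :=
  [/\ u <= x < u + L,
      forall f, f \in F -> eps <= ps Q f x /\ ((tag f <= n)%N -> ps Q f x <= 1)
    & short_at Q e x].

(** Adjoining the short vector to a member with [ps] at most 1 leaves at most [(n+1) e]. If the
    resulting rank were already present, the pushed tuple would span the space of a member [g], and
    the near-minimality of [g] would force [ps Q g x] below [eps]. *)
Lemma flag_push_small Q C eps e F (x u L : R) :
  isflag R F -> 1 <= C -> flag_bad Q eps e F u L x ->
  (forall f s, f \in F -> row_free (rmx R s) -> tag s = tag f -> (rmx R s <= rmx R f)%MS ->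
     ps Q f x <= C * ps Q s x) ->
  C * (n.+1%:R * e) < eps ->
  exists2 s, adm R F s & ps Q s x <= n.+1%:R * e.
Proof.
move=> flF C1 [xu hF [r r0 re]] hyp2 eC.
have e0 : 0 <= e by apply: le_trans (re ord0).
have [f fF [fn fs cs]] := flag_push flF r0.
have [fF' cF uF _ _] := flF.
have psx : ps Q (push r f) x <= n.+1%:R * e.
  rewrite /ps rmx_push; apply: le_trans (psi_col_mx (rmx R f) re) _.
  have [_ /(_ fn) h1] := hF f fF.
  apply: ler_pM; rewrite ?mulr_ge0 ?psi_ge0 // ?ler_nat //.
  by rewrite -[leRHS]mulr1 ler_wpM2l.
exists (push r f) => //; split=> //; apply/negP => /mapP[g gF tg].
have sg : (rmx R (push r f) <= rmx R g)%MS.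
  by apply: cmp_le; [exact: fs|exact: fF'|exact: cs|rewrite tg].
have [h _] := hF g gF.
have := hyp2 g _ gF fs tg sg.
have := ler_wpM2l (le_trans ler01 C1) psx; lra.
Qed.

Lemma isflag_cons F s : isflag R F -> adm R F s -> isflag R (s :: F).
Proof.
move=> [fF cF uF [b bF b0] [t tF tn]] [fs cs ts]; split.
- by move=> f; rewrite inE => /orP[/eqP ->|/fF].
- move=> f g; rewrite !inE => /orP[/eqP ->|ff] /orP[/eqP ->|gg].
  + by rewrite /cmp submx_refl.
  + exact: cs.
  + by rewrite cmpC; exact: cs.
  + exact: cF.
- by rewrite /= ts.
- by exists b; rewrite // inE bF orbT.
- by exists t; rewrite // inE tF orbT.
Qed.

Lemma full_flag_adm F s : isflag R F -> size F = n.+2 -> ~ adm R F s.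
Proof.
move=> [fF cF uF _ _] sF [fs _ /negP ts]; apply: ts.
have sub : {subset map tag F <= iota 0 n.+2}.
  by move=> k /mapP[f /fF/tag_le fn ->]; rewrite mem_iota.
have [|_ e] := uniq_min_size uF sub; first by rewrite size_iota size_map sF.
by rewrite e mem_iota /= add0n ltnS; exact: tag_le fs.
Qed.

Let D := (n.+1 * n)%N.

Lemma ps_doubling : exists2 C : R, 1 <= C & forall Q (s : tup n) (u0 L0 u' r : R),
  row_free (rmx R s) -> 0 < L0 -> 0 < r -> u' = u0 \/ u' = u0 + L0 / 2 ->
  (exists2 y, u0 <= y < u0 + L0 & r <= ps Q s y) ->
  exists2 y, u' <= y < u' + L0 / 2 & r / C <= ps Q s y.
Proof.
have [C C1 HC] := doubling R D.
exists (2 * C); first by lra.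
move=> Q s u0 L0 u' r fs L00 r0 eu [y yu ry].
have [S rS] := psi_geP r0 ry.
have [p sp hp] := minor_poly Q (rmx R s) S (tag_le fs).
have L2 : 0 < L0 / 2 by lra.
apply: contrapT => nex.
have small z : u' <= z < u' + L0 / 2 -> `|p.[z]| <= r / (2 * C).
  move=> zu; rewrite leNgt; apply/negP => h; apply: nex; exists z => //.
  by apply: le_trans (minor_le_psi Q _ S z); rewrite hp ltW.
have := HC p u' (L0 / 2) (r / (2 * C)) sp L2 small y.
rewrite -hp => /(_ _)/wrap[|h].
  by move: yu => /andP[? ?]; case: eu => ->; apply/andP; split; lra.
have e : C * (r / (2 * C)) = r / 2 by field; rewrite gt_eqF //; lra.
rewrite e in h; lra.
Qed.

(* Induction on the number [m] of ranks missing from the flag [F].  A short vector at [x] yields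
   an admissible [s] that is small at [x]; on a maximal dyadic interval where some such [s] is
   small it is adjoined to [F], and doubling from the parent interval keeps the lower bounds. *)
Lemma nondiv_ind (C kap rhom eps e Q : R) : 1 <= C -> 0 < kap -> 0 < rhom ->
  (forall (s : tup n) (u0 L0 u' r : R), row_free (rmx R s) -> 0 < L0 -> 0 < r ->
     u' = u0 \/ u' = u0 + L0 / 2 -> (exists2 y, u0 <= y < u0 + L0 & r <= ps Q s y) ->
     exists2 y, u' <= y < u' + L0 / 2 & r / C <= ps Q s y) ->
  (forall (p : {poly R}) (u L : R), (size p <= D.+1)%N -> 0 < L ->
    (exists2 y : R, u <= y < u + L & rhom <= `|p.[y]|) ->
    cov (fun x : R => u <= x < u + L /\ `|p.[x]| < eps) (kap * L)) ->
  n.+1%:R * e < rhom -> C * (n.+1%:R * e) < eps ->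
  forall m F (u L rho : R), isflag R F -> (size F + m = n.+2)%N -> 0 < L ->
    rhom * C ^+ m <= rho <= 1 ->
    (forall s, adm R F s -> exists2 y, u <= y < u + L & rho <= ps Q s y) ->
    (forall f s, f \in F -> row_free (rmx R s) -> tag s = tag f -> (rmx R s <= rmx R f)%MS ->
       forall x, ps Q f x <= C * ps Q s x) ->
    cov (flag_bad Q eps e F u L) (m%:R * kap * L).
Proof.
move=> C1 kap0 rhom0 dbl sublev e1 e2.
have Cp : 0 < C by apply: lt_le_trans C1.
elim=> [|m IHm] F u L rho flF sF L0 /andP[rho1 rho2] hyp1 hyp2.
  rewrite !mul0r; apply: cov_sub (lexx _) (@cov0 R) => x bad.
  have [s sA _] := flag_push_small flF C1 bad (fun f s a b c d => hyp2 f s a b c d x) e2.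
  by apply: (full_flag_adm flF) sA; rewrite -sF addn0.
have Cm : 1 <= C ^+ m by rewrite exprn_ege1.
have rhoC : rhom * C ^+ m <= rho / C by rewrite ler_pdivlMr // -mulrA -exprSr.
have rhomC : rhom <= rho / C by apply: le_trans rhoC; rewrite ler_peMr // ltW.
have rhomrho : rhom <= rho.
  by have := rhomC; rewrite ler_pdivlMr //; apply: le_trans; rewrite ler_peMr // ltW.
have rho0 : 0 < rho by exact: lt_le_trans rhomrho.
pose Stop (u L : R) := exists2 s, adm R F s & forall y, u <= y < u + L -> ps Q s y < rho.
apply: (@stopping_cov R Stop _ u L (m.+1%:R * kap)) => //; first by rewrite !mulr_ge0 // ltW.
- move=> x bad; have [xu _ _] := bad; split=> //.
  have [s sA sx] := flag_push_small flF C1 bad (fun f s a b c d => hyp2 f s a b c d x) e2.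
  have sx' : ps Q s x < rho by lra.
  have [fs _ _] := sA.
  have [d d0 hd] := ps_near (tag_le fs) rho0 sx'.
  have [k hk] := halving_small xu d0; exists k, s => // y yk.
  by apply: hd; exact: hk.
- case=> s /hyp1[y yu h] /(_ y yu); lra.
move=> u0 L1 u' L10 nS [s sA hs] eu.
have hyp1' t : adm R F t -> exists2 y, u' <= y < u' + L1 / 2 & rho / C <= ps Q t y.
  move=> tA; have [ft _ _] := tA; apply: (dbl t u0 L1 u' rho ft L10 rho0 eu).
  apply: contrapT => nex; apply: nS; exists t => // y yu; rewrite ltNge; apply/negP => h.
  by apply: nex; exists y.
have L2 : 0 < L1 / 2 by lra.
have [fs cs ts] := sA.
have [fF cF _ _ _] := flF.
have covF : cov (flag_bad Q eps e (s :: F) u' (L1 / 2)) (m%:R * kap * (L1 / 2)).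
  apply: (IHm _ _ _ (rho / C)) => //.
  - exact: isflag_cons.
  - by rewrite /= addSnnS.
  - by rewrite rhoC /= ler_pdivrMr // mul1r; lra.
  - move=> t [ft ct tt]; apply: hyp1'; split=> //; first by move=> f fF'; apply: ct; rewrite inE fF' orbT.
    by move: tt; rewrite /= inE negb_or => /andP[].
  (* Near-minimality of the new member [s]: a tuple [t] spanning its space is itself admissible, so
     it reaches [rho / C] on this interval, where [s] stays below [rho]. As the two functions are
     proportional, the ratio of [t] to [s] is at least [1 / C] everywhere. *)
  - move=> f t; rewrite inE => /orP[/eqP ->|fF'] ft tt st x; last exact: hyp2.
    have tA : adm R F t.
      split=> //; last by rewrite tt.
      move=> g gF; have st' : (rmx R s <= rmx R t)%MS.
        by apply: cmp_le; rewrite ?tt // cmpC /cmp st.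
      have := cs _ gF; rewrite /cmp => /orP[h|h]; apply/orP; [left; exact: submx_trans st h|right; exact: submx_trans h st'].
    have [c c0 hc] := ps_same Q tt st.
    have [y yu hy] := hyp1' t tA.
    have cC : 1 <= C * c.
      rewrite leNgt; apply/negP => h.
      have := hs y yu; have := hy; rewrite hc ler_pdivrMr //.
      have := psi_ge0 Q (rmx R s) y; rewrite -/(ps Q s y) => h0 h1 h2.
      have : c * ps Q s y * C = (C * c) * ps Q s y by ring.
      nra.
    by rewrite hc mulrA ler_peMl // psi_ge0.
have [y yu hy] := hyp1' s sA.
have [S hS] := psi_geP rhom0 (le_trans rhomC hy).
have [p sp hp] := minor_poly Q (rmx R s) S (tag_le fs).
rewrite hp in hS.
have covp := sublev p u' (L1 / 2) sp L2 (ex_intro2 _ _ y yu hS).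
(* Either one fixed minor of [s] is below [eps] at [x], or [s] meets the bounds required of flag
   members and [x] is bad for the enlarged flag. *)
apply: cov_sub (covU covp covF).
  move=> x [[xu hF shx] xu'].
  have [px|px] := ltP `|p.[x]| eps; first by left.
  right; split=> // f; rewrite inE => /orP[/eqP ->|]; last exact: hF.
  split; first by apply: le_trans px _; rewrite -hp; exact: minor_le_psi.
  by move=> _; apply/ltW/(lt_le_trans (hs _ xu')).
by rewrite -natr1; lra.
Qed.

(** The induction starts from the flag of ranks 0 and [n+1]. Intermediate ranks reach 1 by
    [psi_low], and the top member is minimal because a nonzero integer determinant has absolute
    value at least 1. The interval enters only through [Q0]; [e] depends on [n] and [kap]. *)
Lemma nondivergence (kap : R) : 0 < kap -> exists2 e : R, 0 < e &
  forall u L : R, 0 < L -> exists2 Q0 : R, 1 <= Q0 &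
  forall Q, Q0 <= Q -> cov (fun x => u <= x < u + L /\ short_at Q e x) (kap * L).
Proof.
move=> kap0.
have [C C1 dbl] := ps_doubling.
have Cp : 0 < C by apply: lt_le_trans C1.
(* There are [n] ranks missing at the start, and each adjunction divides the initial lower bound 1
   by [C]. *)
pose rhom := (C ^+ n)^-1.
have rhom0 : 0 < rhom by rewrite invr_gt0 exprn_gt0.
have n1 : 0 < n.+1%:R :> R by rewrite ltr0n.
have kap'0 : 0 < kap / n.+1%:R by rewrite divr_gt0.
have [eps eps0 sublev] := @poly_sub_cov R D (kap / n.+1%:R) rhom kap'0 rhom0.
pose eps' := Num.min eps 1.
have eps'0 : 0 < eps' by rewrite lt_min eps0 ltr01.
pose e := Num.min (rhom / (2 * n.+1%:R)) (eps' / (2 * C * n.+1%:R)).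
have e0 : 0 < e by rewrite lt_min !divr_gt0 ?mulr_gt0.
have e1 : n.+1%:R * e < rhom.
  have : e <= rhom / (2 * n.+1%:R) by rewrite ge_min lexx.
  rewrite ler_pdivlMr ?mulr_gt0 //; nra.
have e2 : C * (n.+1%:R * e) < eps'.
  have : e <= eps' / (2 * C * n.+1%:R) by rewrite ge_min lexx orbT.
  rewrite ler_pdivlMr ?mulr_gt0 // => h.
  have : e * (2 * C * n.+1%:R) = 2 * (C * (n.+1%:R * e)) by ring.
  nra.
exists e => // u L L0.
have [Q0 Q01 low] := @psi_low R n u L L0; exists Q0 => // Q QQ.
have Qn0 : Q != 0 by rewrite gt_eqF // (lt_le_trans _ QQ) // (lt_le_trans ltr01).
pose bot : tup n := @Tagged nat 0%N (fun j => 'M[int]_(j, n.+1)) 0.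
pose top : tup n := @Tagged nat n.+1 (fun j => 'M[int]_(j, n.+1)) 1%:M.
have rtop : rmx R top = 1%:M by rewrite /rmx /top /zmx /= map_mx1.
pose F := [:: bot; top].
have psbot (s : tup n) x : tag s = 0%N -> ps Q s x = 1.
  by case: s => j V /= ej; subst j; exact: psi_bottom.
have flF : isflag R F.
  split.
  - move=> f; rewrite !inE => /orP[] /eqP ->; first by rewrite /row_free mxrank.unlock.
    by rewrite rtop row_free_unit unitmx1.
  - have bt (s : tup n) : cmp R bot s by rewrite /cmp /rmx [zmx R _]flatmx0 sub0mx.
    have tt (s : tup n) : cmp R top s by rewrite cmpC /cmp rtop submx1.
    by move=> f g; rewrite !inE => /orP[] /eqP -> _.
  - by [].
  - by exists bot; rewrite // inE eqxx.
  - by exists top; rewrite // !inE eqxx orbT.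
have := @nondiv_ind C (kap / n.+1%:R) rhom eps' e Q C1 kap'0 rhom0 (dbl Q) _ e1 e2 n F u L 1 flF _ L0.
move=> H; have {}H : cov (flag_bad Q eps' e F u L) (n%:R * (kap / n.+1%:R) * L).
  apply: H => //.
  - move=> p u1 L1 sp L10 hy; apply: cov_sub (sublev p u1 L1 sp L10 hy) => // x [xu px].
    by split=> //; apply: lt_le_trans px _; rewrite ge_min lexx.
  - by rewrite /rhom mulVf ?expf_neq0 ?gt_eqF ?lexx.
  - move=> s [fs _]; rewrite /= !inE negb_or => /andP[s0 sn]; apply: low => //.
    by rewrite lt0n s0 /= -ltnS ltn_neqAle sn (tag_le fs).
  move=> f s; rewrite !inE => /orP[] /eqP -> fs ts st x.
    by rewrite !psbot // mulr1.
  case: s fs ts st => j V /= fs ej _; subst j.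
  rewrite /ps rtop; have [A VA hA] := psi_span Q (submx1 (zmx R V)).
  rewrite /rmx /= hA mulrA ler_peMl ?psi_ge0 //.
  have : 1 <= `|\det A|; last by move=> ?; apply: le_trans C1 _; rewrite ler_peMr // ltW.
  have <- : zmx R V = A by rewrite VA mulmx1.
  rewrite /zmx det_map_mx -intr_norm ler1z -gtz0_ge1 normr_gt0.
  move: fs; rewrite /rmx /= row_free_unit unitmxE unitfE det_map_mx intr_eq0 //.
apply: cov_sub H.
  move=> x [xu sx]; split=> // f; rewrite !inE => /orP[] /eqP ->.
    by rewrite psbot // ge_min lexx orbT.
  have h1 : eps' <= 1 by rewrite ge_min lexx orbT.
  have h2 : 1 <= ps Q top x by rewrite /ps rtop; exact: psi_full.
  by split; [exact: le_trans h1 h2|rewrite /= ltnn].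
apply: ler_wpM2r; first exact: ltW.
rewrite mulrCA; apply: ler_piMr; first exact: ltW.
by rewrite ler_pdivrMr // mul1r ler_nat.
Qed.

End Nondivergence.

(** * Regular systems of algebraic numbers *)

Section RegularSystem.
Variable R : realType.

Lemma short_atE n Q e (x : R) (p : {poly int}) : 0 < Q -> (size p <= n.+1)%N -> p != 0 ->
  Q ^+ n * `|(map_poly intr p).[x]| <= e -> (forall i, (0 < i)%N -> `|p`_i|%:~R <= e * Q) ->
  short_at n Q e x.
Proof.
move=> Q0 sp p0 px pi; exists (\row_(i < n.+1) p`_i).
  apply: contra_neq p0 => /rowP e0; apply/polyP => i; rewrite coef0.
  have [lt|ge] := ltnP i n.+1; last by rewrite nth_default // (leq_trans sp).
  by have := e0 (Ordinal lt); rewrite !mxE.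
move=> k; rewrite mxE; have [->|k0] := eqVneq k ord0.
  have -> : \sum_j zmx R (\row_i p`_i) 0 j * Hmx n Q x j ord0 = Q ^+ n * (map_poly intr p).[x].
    rewrite (@horner_coef_wide _ n.+1) ?(leq_trans (size_poly _ _)) // mulr_sumr.
    by apply: eq_bigr => j _; rewrite !mxE eqxx coef_map /=; ring.
  by rewrite normrM ger0_norm // exprn_ge0 // ltW.
rewrite (bigD1 k) //= big1 ?addr0 => [|j jk]; last by rewrite !mxE (negPf k0) (negPf jk) mul0r mulr0.
rewrite !mxE (negPf k0) eqxx mul1r normrM -intr_norm normfV (gtr0_norm Q0) ler_pdivrMr //.
by apply: pi; rewrite lt0n.
Qed.

Lemma posz_dist (a b c : nat) : (a <= c)%N -> (b <= c)%N -> (`|Posz a - Posz b| <= Posz c)%R.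
Proof. lia. Qed.

(* Pigeonhole with only the coefficient of X allowed to be large: if x admits no
   short polynomial, that coefficient must be large and dominates the derivative at x. *)
Lemma good_poly m (e A : R) : 0 < e -> 1 <= A -> exists2 Lam : R, 1 <= Lam &
  forall Q x : R, 1 <= Q -> `|x| <= A -> ~ short_at m.+1 Q e x ->
  exists p : {poly int}, [/\ (size p <= m.+2)%N, Q ^+ m.+1 * `|(map_poly intr p).[x]| <= 1,
    forall i, `|p`_i|%:~R <= Lam * Q & e / 2 * Q <= `|((map_poly intr p)^`()).[x]|].
Proof.
move=> e0 A1.
have A0 : 0 < A by lra.
pose CA : R := 1 + \sum_(i < m) i.+2%:R * A ^+ i.+1.
have CA1 : 1 <= CA by rewrite lerDl sumr_ge0 // => i _; rewrite mulr_ge0 ?ler0n ?exprn_ge0 // ltW.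
have CA0 : 0 < CA by lra.
(* Coefficients of [X^2] and above will be at most [e2 Q], so that they contribute at most [e Q / 2]
   to the derivative at [x]. *)
pose e2 := Num.min 1 (e / (2 * CA)).
have e20 : 0 < e2 by rewrite lt_min ltr01 divr_gt0 // mulr_gt0.
have e21 : e2 <= 1 by rewrite ge_min lexx.
have e2C : e2 * CA <= e / 2.
  have : e2 <= e / (2 * CA) by rewrite ge_min lexx orbT.
  by rewrite invfM mulrA ler_pdivlMr.
(* The box of coefficients has more than [Lam e2^m Q^(m+1)] points, against at most [2 Q^(m+1) / e2]
   cells for the fractional parts; hence the requirement [Lam e2^(m+1) >= 2]. *)
pose Lam : R := 1 + 2 / e2 ^+ m.+1 + e2.
have e2m : 0 < e2 ^+ m.+1 by rewrite exprn_gt0.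
have LL : 2 / e2 ^+ m.+1 <= Lam by rewrite /Lam; lra.
have q0 : 0 < 2 / e2 ^+ m.+1 by rewrite divr_gt0.
have Lam1 : 1 <= Lam by rewrite /Lam; lra.
have Lame : e2 <= Lam by rewrite /Lam; lra.
pose S : R := 1 + \sum_(i < m.+1) A ^+ i.+1.
have S1 : 1 <= S by rewrite lerDl sumr_ge0 // => i _; rewrite exprn_ge0 // ltW.
exists (Lam * S + 1); first by nra.
move=> Q x Q1 xA good.
have Q0 : 0 < Q by lra.
have Qm : 0 < Q ^+ m.+1 by rewrite exprn_gt0.
have Qm1 : 1 <= Q ^+ m.+1 by rewrite exprn_ege1.
pose K := Num.truncn (Lam * Q); pose k := Num.truncn (e2 * Q).
have KP : K%:R <= Lam * Q < K.+1%:R by apply: truncn_itv; rewrite mulr_ge0 //; lra.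
have kP : k%:R <= e2 * Q < k.+1%:R by apply: truncn_itv; rewrite mulr_ge0 // ltW.
pose N := (Num.truncn (Q ^+ m.+1 / e2)).+1.
have N0 : 0 < N%:R :> R by rewrite ltr0n.
have /andP[NP1 NP2] : (Num.truncn (Q ^+ m.+1 / e2))%:R <= Q ^+ m.+1 / e2 < N%:R.
  by apply: truncn_itv; rewrite divr_ge0 // ltW.
pose T : finType := ('I_K.+1 * {ffun 'I_m -> 'I_k.+1})%type.
pose w (t : T) : R := t.1%:R * x + \sum_(i < m) (t.2 i)%:R * x ^+ i.+2.
pose v (t : T) : R := w t - (Num.floor (w t))%:~R.
have vP t : 0 <= v t < 1.
  have := real_floor_itv (num_real (w t)); rewrite intrD /v => /andP[? ?]; apply/andP; split; lra.
have boxP t : exists i : 'I_N, i%:R <= v t * N%:R < i%:R + 1.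
  have /andP[? ?] := vP t; apply: grid_index; rewrite mulr_ge0 ?ler0n //=.
  by rewrite -[ltRHS]mul1r ltr_pM2r.
have [box hbox] := choice boxP.
have ninj : ~ injective box.
  move=> /leq_card; rewrite card_prod card_ffun !card_ord leqNgt => /negP; apply.
  rewrite -(ltr_nat R) natrM natrX.
  have h1 : N%:R <= 2 * (Q ^+ m.+1 / e2).
    have eN : N%:R = (Num.truncn (Q ^+ m.+1 / e2))%:R + 1 :> R by rewrite natr1.
    rewrite eN; have : 1 <= Q ^+ m.+1 / e2 by rewrite ler_pdivlMr // mul1r (le_trans e21).
    by lra.
  apply: le_lt_trans h1 _.
  have h2 : (e2 * Q) ^+ m <= k.+1%:R ^+ m.
    by apply: lerXn2r; rewrite ?nnegrE ?ler0n ?mulr_ge0 ?(ltW e20) ?(ltW Q0) //; case/andP: kP => _ /ltW.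
  have h3 : 0 < (e2 * Q) ^+ m by rewrite exprn_gt0 // mulr_gt0.
  apply: (@lt_le_trans _ _ (K.+1%:R * (e2 * Q) ^+ m)); last by rewrite ler_wpM2l.
  apply: (@le_lt_trans _ _ (Lam * Q * (e2 * Q) ^+ m)); last by rewrite ltr_pM2r //; case/andP: KP.
  have -> : Lam * Q * (e2 * Q) ^+ m = Lam * e2 ^+ m.+1 * (Q ^+ m.+1 / e2).
    rewrite exprMn !exprS; field; rewrite gt_eqF //.
  by apply: ler_wpM2r; [rewrite divr_ge0 // ltW|rewrite -ler_pdivrMr].
have [t1 [t2 [t12 ebox]]] : exists t1 t2, t1 <> t2 /\ box t1 = box t2.
  apply: contrapT => nex; apply: ninj => t1 t2 e12; apply: contrapT => ne.
  by apply: nex; exists t1, t2.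
pose P (t : T) : {poly int} := (- Num.floor (w t))%:P + (Posz t.1) *: 'X +
  \sum_(i < m) (Posz (t.2 i)) *: 'X^(i.+2).
have Px t : (map_poly intr (P t)).[x] = v t.
  rewrite /P !rmorphD rmorph_sum /= map_polyC map_polyZ map_polyX /= !hornerD hornerC hornerZ hornerX.
  rewrite horner_sum /v /w rmorphN /= -addrA addrC; congr (_ + _ - _).
  by apply: eq_bigr => i _; rewrite map_polyZ map_polyXn /= hornerZ hornerXn.
have Pcoef t i : (P t)`_i = if i is i'.+1 then (if i' is i''.+1 then
     (if insub i'' is Some j then Posz (t.2 j) else 0) else Posz t.1) else - Num.floor (w t).
  rewrite /P !coefD coefC coefZ coefX coef_sum.
  case: i => [|[|i]] /=.
  - rewrite mulr0 addr0 big1 ?addr0 // => j _; by rewrite coefZ coefXn mulr0.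
  - rewrite mulr1 add0r big1 ?addr0 // => j _; by rewrite coefZ coefXn mulr0.
  rewrite mulr0 !add0r; case: insubP => [j _ ej|im].
    rewrite (bigD1 j) //= coefZ coefXn ej eqxx mulr1 big1 ?addr0 // => l lj.
    by rewrite coefZ coefXn -ej !eqSS eq_sym val_eqE (negPf lj) mulr0.
  rewrite big1 // => l _; rewrite coefZ coefXn !eqSS.
  by case: eqP => [el|_]; rewrite ?mulr0 //; move: im; rewrite el ltn_ord.
pose p := P t1 - P t2.
have sp : (size p <= m.+2)%N.
  apply/leq_sizeP => -[|[|j]] // mj; rewrite coefB !Pcoef; case: insubP => [l|_] //=; rewrite ?subrr //.
  by rewrite ltnNge => /negP.
have pc (a b c : nat) : (a <= c)%N -> (b <= c)%N -> `|Posz a - Posz b|%:~R <= c%:R :> R.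
  move=> ac bc; rewrite -[c%:R]/((Posz c)%:~R) ler_int; exact: posz_dist.
have p1 : `|p`_1|%:~R <= Lam * Q.
  apply: (@le_trans _ _ K%:R); last by case/andP: KP.
  by rewrite coefB !Pcoef; apply: pc; rewrite -ltnS ltn_ord.
have p2 i : `|p`_i.+2|%:~R <= e2 * Q.
  rewrite coefB !Pcoef; case: insubP => [j _ _|_].
    apply: (@le_trans _ _ k%:R); last by case/andP: kP.
    by apply: pc; rewrite -ltnS ltn_ord.
  by rewrite subrr normr0 mulr_ge0 // ltW.
have pn0 : p != 0.
  apply: contra_not_neq t12 => /eqP; rewrite subr_eq0 => /eqP eP.
  have ei i : (P t1)`_i = (P t2)`_i by rewrite eP.
  case: t1 t2 {p sp p1 p2 ebox eP} ei => [a1 f1] [a2 f2] ei; congr (_, _).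
    by have := ei 1%N; rewrite !Pcoef /= => -[] /val_inj.
  apply/ffunP => i; have := ei i.+2; rewrite !Pcoef /=.
  case: insubP => [j _ /val_inj ->|]; last by rewrite ltn_ord.
  by case=> /val_inj.
have px : Q ^+ m.+1 * `|(map_poly intr p).[x]| <= e2.
  rewrite rmorphB hornerD hornerN !Px.
  have := hbox t1; have := hbox t2; rewrite ebox => /andP[h1 h2] /andP[h3 h4].
  have : `|(v t1 - v t2) * N%:R| <= 1 by rewrite ler_norml; apply/andP; split; lra.
  rewrite normrM (gtr0_norm N0) => h5.
  move: NP2; rewrite ltr_pdivrMr // => /ltW h6.
  have h7 := normr_ge0 (v t1 - v t2).
  apply: le_trans (ler_wpM2r h7 h6) _.
  have -> : N%:R * e2 * `|v t1 - v t2| = e2 * (`|v t1 - v t2| * N%:R) by ring.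
  by rewrite ler_piMr // ltW.
have e2e : e2 <= e.
  by have := ler_peMr (ltW e20) CA1; lra.
have pbig : e * Q < `|p`_1|%:~R.
  rewrite ltNge; apply/negP => h; apply: good; apply: (short_atE Q0 sp pn0); first exact: le_trans px e2e.
  by case=> [|[|i]] // _; apply: le_trans (p2 i) _; rewrite ler_pM2r.
have xi i : `|x| ^+ i <= A ^+ i by apply: lerXn2r; rewrite ?nnegrE ?normr_ge0 // ltW.
exists p; split=> //; first exact: le_trans px e21.
- case=> [|[|i]]; last 2 first.
  + by apply: le_trans p1 _; rewrite ler_pM2r //; nra.
  + by apply: le_trans (p2 i) _; rewrite ler_pM2r //; nra.
  have ep : (p`_0)%:~R = (map_poly intr p).[x] - \sum_(i < m.+1) (p`_i.+1)%:~R * x ^+ i.+1.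
    rewrite (@horner_coef_wide _ m.+2) ?(leq_trans (size_poly _ _)) // big_ord_recl expr0 mulr1 coef_map /=.
    rewrite (_ : \sum_(i < m.+1) (map_poly intr p)`_(bump 0 i) * x ^+ bump 0 i = \sum_(i < m.+1) (p`_i.+1)%:~R * x ^+ i.+1) ?addrK //.
    by apply: eq_bigr => i _; rewrite coef_map.
  rewrite intr_norm ep; apply: le_trans (ler_normB _ _) _.
  have h1 : `|(map_poly intr p).[x]| <= 1.
    apply: le_trans e21; apply: le_trans px; exact: ler_peMl.
  have h2 : `|\sum_(i < m.+1) (p`_i.+1)%:~R * x ^+ i.+1| <= Lam * Q * \sum_(i < m.+1) A ^+ i.+1.
    apply: le_trans (ler_norm_sum _ _ _) _; rewrite mulr_sumr; apply: ler_sum => i _.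
    rewrite normrM normrX -intr_norm; apply: ler_pM; rewrite ?exprn_ge0 ?ler0z //.
    by case: (nat_of_ord i) => [//|j]; apply: le_trans (p2 j) _; rewrite ler_pM2r.
  rewrite /S; nra.
have ed : ((map_poly intr p)^`()).[x] = (p`_1)%:~R + \sum_(i < m) (p`_i.+2)%:~R * i.+2%:R * x ^+ i.+1.
  rewrite (@horner_coef_wide _ m.+1); last first.
    by apply/leq_sizeP => j mj; rewrite coef_deriv nth_default ?mul0rn // (leq_trans (size_poly _ _)) // (leq_trans sp).
  rewrite big_ord_recl expr0 mulr1 coef_deriv coef_map /= mulr1n; congr (_ + _).
  by apply: eq_bigr => i _; rewrite coef_deriv coef_map /= mulr_natr.
rewrite ed.
have h2 : `|\sum_(i < m) (p`_i.+2)%:~R * i.+2%:R * x ^+ i.+1| <= e2 * Q * CA.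
  apply: le_trans (ler_norm_sum _ _ _) _.
  apply: (@le_trans _ _ (e2 * Q * \sum_(i < m) i.+2%:R * A ^+ i.+1)).
    rewrite mulr_sumr; apply: ler_sum => i _.
    rewrite -mulrA normrM; apply: ler_pM => //; first by rewrite -intr_norm.
    by rewrite normrM normr_nat normrX ler_wpM2l ?ler0n.
  by rewrite ler_pM2l ?mulr_gt0 // /CA; lra.
have h3 : e2 * Q * CA <= e / 2 * Q by have := ler_wpM2r (ltW Q0) e2C; lra.
rewrite intr_norm in pbig.
have := ler_normB ((p`_1)%:~R + \sum_(i < m) (p`_i.+2)%:~R * i.+2%:R * x ^+ i.+1)
   (\sum_(i < m) (p`_i.+2)%:~R * i.+2%:R * x ^+ i.+1); rewrite addrK; lra.
Qed.

(** At distance [h = 2 / kap / Q^(n+2)] the linear Taylor term is at least [2 / Q^(n+1)], while the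
    value at [x] and, for large [Q], the remainder of order two are each at most [1 / Q^(n+1)]. The
    intermediate value theorem applies on [[x - h, x + h]]. *)
Lemma root_near n (kap Lam A : R) : 0 < kap -> 0 < Lam -> 1 <= A -> exists2 Q0 : R, 1 <= Q0 &
  forall (p : {poly R}) (Q x : R), Q0 <= Q -> `|x| <= A -> (size p <= n.+2)%N ->
  Q ^+ n.+1 * `|p.[x]| <= 1 -> (forall i, `|p`_i| <= Lam * Q) -> kap * Q <= `|p^`().[x]| ->
  exists2 a, root p a & `|x - a| <= 2 / kap / Q ^+ n.+2.
Proof.
move=> kap0 Lam0 A1.
have A0 : 0 < A by lra.
pose B : R := \sum_(i < n) \sum_(l < n.+2) 'C(i.+2 + l, i.+2)%:R * A ^+ l.
have B0 : 0 <= B.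
  by rewrite !sumr_ge0 // => i _; rewrite sumr_ge0 // => l _; rewrite mulr_ge0 ?ler0n ?exprn_ge0 // ltW.
have k2 : 0 < kap ^+ 2 by rewrite exprn_gt0.
have q1 : 0 < 2 / kap by rewrite divr_gt0.
have q2 : 0 <= 4 * Lam * B / kap ^+ 2 by rewrite divr_ge0 ?mulr_ge0 // ltW.
exists (1 + 2 / kap + 4 * Lam * B / kap ^+ 2); first by lra.
move=> p Q x QQ xA sp px pLam dpx.
have Q1 : 1 <= Q by lra.
have Q0 : 0 < Q by lra.
have Qn0 : 0 < Q ^+ n.+1 by rewrite exprn_gt0.
have QQn : Q <= Q ^+ n.+2 by rewrite exprS ler_peMr ?exprn_ege1 // ltW.
wlog dp0 : p sp px pLam dpx / 0 < p^`().[x].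
  move=> H; have [dp|dp] := ltP 0 p^`().[x]; first exact: H.
  have [|||||a ra xa] := H (- p); rewrite ?size_polyN //.
  - by rewrite hornerN normrN.
  - by move=> i; rewrite coefN normrN.
  - by rewrite derivN hornerN normrN.
  - rewrite derivN hornerN oppr_gt0 lt_neqAle dp andbT; apply/eqP => e.
    by move: dpx; rewrite e normr0 leNgt mulr_gt0.
  by exists a => //; move: ra; rewrite /root hornerN oppr_eq0.
rewrite (gtr0_norm dp0) in dpx.
pose h := 2 / kap / Q ^+ n.+2.
have h0 : 0 < h by rewrite !divr_gt0 // exprn_gt0.
have h1 : h <= 1 by rewrite ler_pdivrMr ?exprn_gt0 // mul1r; lra.
have tay (s : R) : `|s| = h -> `|p.[x + s] - p.[x] - s * p^`().[x]| <= h ^+ 2 * (Lam * Q * B).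
  move=> sh.
  have -> : p.[x + s] - p.[x] - s * p^`().[x] = \sum_(i < n) p^`N(i.+2).[x] * s ^+ i.+2.
    rewrite (@nderiv_taylor_wide _ n.+2) //; last exact: mulrC.
    rewrite !big_ord_recl /= nderivn0 expr0 mulr1 expr1 nderivn1 /bump /=; ring.
  apply: le_trans (ler_norm_sum _ _ _) _; rewrite /B !mulr_sumr; apply: ler_sum => i _.
  rewrite normrM normrX sh mulrC; apply: ler_pM; rewrite ?exprn_ge0 // ?(ltW h0) //.
    by rewrite -addn2 exprD ler_piMl ?exprn_ge0 ?exprn_ile1 // ltW.
  rewrite (@horner_coef_wide _ n.+2); last by rewrite (leq_trans (size_poly _ _)) // leq_subLR (leq_trans sp) // leq_addl.
  apply: le_trans (ler_norm_sum _ _ _) _; rewrite mulr_sumr; apply: ler_sum => l _.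
  rewrite normrM normrX coef_nderivn -[_ *+ _]mulr_natr normrM normr_nat -mulrA.
  apply: ler_pM; rewrite ?mulr_ge0 ?ler0n ?exprn_ge0 //.
  by rewrite ler_wpM2l ?ler0n // lerXn2r // ?nnegrE ?normr_ge0 // ltW.
have key : h ^+ 2 * (Lam * Q * B) <= 1 / Q ^+ n.+1.
  have z1 : 1 <= Q ^+ n.+1 by rewrite exprn_ege1.
  rewrite /h [Q ^+ n.+2]exprS; move: (Q ^+ n.+1) Qn0 z1 => z z0 z1.
  have -> : (2 / kap / (Q * z)) ^+ 2 * (Lam * Q * B) = 4 * Lam * B / kap ^+ 2 / Q / z / z.
    by field; rewrite !gt_eqF.
  rewrite ler_pM2r ?invr_gt0 // ler_pdivrMr // mul1r ler_pdivrMr //; nra.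
have hdp : 2 / Q ^+ n.+1 <= h * p^`().[x].
  apply: (@le_trans _ _ (h * (kap * Q))); last by rewrite ler_pM2l.
  rewrite /h [Q ^+ n.+2]exprS le_eqVlt; apply/orP; left; apply/eqP; field; rewrite !gt_eqF //.
have px' : `|p.[x]| <= 1 / Q ^+ n.+1 by rewrite ler_pdivlMr // mulrC.
have := tay h; have := tay (- h); rewrite normrN (gtr0_norm h0) => /(_ erefl) t1 /(_ erefl) t2.
have [||a /andP[a1 a2] ra] := @poly_ivt R p (x - h) (x + h).
  by lra.
  by move: t1 t2 px'; rewrite !ler_norml => /andP[? ?] /andP[? ?] /andP[? ?]; apply/andP; split; lra.
by exists a => //; rewrite -/h ler_norml; apply/andP; split; lra.
Qed.

End RegularSystem.

(** * Minimal polynomials and heights *)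

Section MinimalPolynomial.
Variable R : realType.

(** [M] is the primitive part of a nonzero integer polynomial of least size vanishing at [a].
    Pseudo-division shows that it divides [D] over the rationals, and Gauss's lemma that the
    quotient is integral. *)
Lemma minpoly_exists (a : R) (D : {poly int}) : D != 0 -> root (map_poly intr D) a ->
  exists M : {poly int}, [/\ M != 0, root (map_poly intr M) a,
    forall p : {poly int}, p != 0 -> root (map_poly intr p) a -> (size M <= size p)%N,
    forall k : int, (forall i, (k %| M`_i)%Z) -> (k %| 1)%Z & exists g, D = M * g].
Proof.
move=> D0 Da.
pose P k := `[< exists p : {poly int}, [/\ p != 0, root (map_poly intr p) a & size p = k] >].
have [|k /asboolP[M0 [M00 M0a M0k]] kmin] := ex_minnP (P := P).
  by exists (size D); apply/asboolP; exists D.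
have M0min (p : {poly int}) : p != 0 -> root (map_poly intr p) a -> (size M0 <= size p)%N.
  by move=> p0 pa; rewrite M0k; apply: kmin; apply/asboolP; exists p.
have cM : zcontents M0 != 0 by rewrite zcontents_eq0.
have eM : M0 = zcontents M0 *: zprimitive M0 := zpolyEprim M0.
exists (zprimitive M0); split.
- by rewrite zprimitive_eq0.
- by move: M0a; rewrite {1}eM map_polyZ /= rootZ // intr_eq0.
- by move=> p p0 pa; rewrite size_zprimitive M0min.
- move=> k0 hk; have : (k0 %| zcontents (zprimitive M0))%Z.
    by rewrite dvdz_contents; apply/polyOverP.
  by rewrite zcontents_primitive M00.
have : M0 %| D.
  rewrite /dvdp; apply: contrapT => /negP r0.
  have ra : root (map_poly intr (D %% M0)) a.
    have := Pdiv.Idomain.divp_eq D M0 => /(congr1 (fun q => (map_poly intr q).[a] : R)).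
    rewrite map_polyZ rmorphD rmorphM /= hornerZ hornerD hornerM.
    by rewrite (rootP Da) (rootP M0a) !mulr0 add0r => e; apply/rootP.
  by have := M0min _ r0 ra; rewrite leqNgt ltn_modp M00.
by case/dvdpP_int => r ->; exists r.
Qed.

Lemma roots_list (p : {poly R}) : p != 0 ->
  exists2 s : seq R, (size s < size p)%N & forall x, root p x -> x \in s.
Proof.
have [m] := ubnP (size p); elim: m p => // m IHm p; rewrite ltnS => sp p0.
have [[x rx]|nr] := pselect (exists x, root p x); last first.
  by exists [::]; rewrite ?size_poly_gt0 // => x rx; case: nr; exists x.
have [q eq] := factor_theorem _ _ rx.
have q0 : q != 0 by apply: contraNneq p0 => q0; rewrite eq q0 mul0r.
have sq : size p = (size q).+1 by rewrite eq size_Mmonic ?monicXsubC // size_XsubC addn2.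
have [|s ss hs] := IHm q _ q0; first by rewrite -ltnS -sq.
exists (x :: s) => [|y]; first by rewrite sq /= ltnS.
by rewrite eq rootM root_XsubC inE => /orP[/hs ->|->]; rewrite ?orbT.
Qed.

End MinimalPolynomial.

Section Bridge.
Import Defs.
Local Notation R := Rdefinitions.R.
Local Notation IZR := Rdefinitions.IZR.
Local Open Scope ring_scope.

Lemma IZR_int (z : BinNums.Z) : IZR z = (int_of_Z z)%:~R :> R.
Proof.
case: z => [|p|p] //=; rewrite ?[IZR _]IZRposE ?INRE //.
  by rewrite Pos_to_natE.
rewrite NegzE -[IZR (BinNums.Zneg p)]/(Rdefinitions.Ropp (IZR (BinNums.Zpos p))) IZRposE INRE RoppE.
have p0 : (0 < BinPos.Pos.to_nat p)%N by apply/ssrnat.ltP; exact: Pnat.Pos2Nat.is_pos.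
by rewrite (prednK p0) mulrNz Pos_to_natE.
Qed.

Lemma zpoly_evalE m c (a : R) : zpoly_eval m c a = \sum_(i < m.+1) (int_of_Z (c i))%:~R * a ^+ i.
Proof.
elim: m => [|m IHm]; first by rewrite big_ord1 expr0 mulr1 -IZR_int.
by rewrite big_ord_recr -IHm -IZR_int -RpowE.
Qed.

Definition polyZ m (c : nat -> BinNums.Z) : {poly int} := \poly_(i < m.+1) int_of_Z (c i).

Lemma polyZ_eval m c (a : R) : (map_poly intr (polyZ m c)).[a] = zpoly_eval m c a.
Proof.
rewrite zpoly_evalE (@horner_coef_wide _ m.+1).
  by apply: eq_bigr => i _; rewrite coef_map coef_poly ltn_ord.
by rewrite (leq_trans (size_poly _ _)) // size_poly.
Qed.

Lemma zpoly_rootP m c (a : R) : zpoly_root m c a ->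
  [/\ polyZ m c != 0, root (map_poly intr (polyZ m c)) a & size (polyZ m c) = m.+1].
Proof.
case=> cm ev.
have cm0 : (polyZ m c)`_m != 0.
  rewrite coef_poly ltnSn; apply/eqP => e; apply: cm.
  by rewrite -(int_of_ZK (c m)) e.
split.
- by apply: contraNneq cm0 => ->; rewrite coef0.
- by apply/rootP; rewrite polyZ_eval ev.
apply/eqP; rewrite eqn_leq size_poly /=; rewrite ltnNge; apply/negP => h.
by move: cm0; rewrite nth_default ?eqxx.
Qed.

Lemma zpoly_root_of (p : {poly int}) (a : R) : p != 0 -> root (map_poly intr p) a ->
  zpoly_root (size p).-1 (fun i => Z_of_int p`_i) a.
Proof.
move=> p0 pa; split.
  move=> e; move/eqP: p0; apply; apply/eqP; rewrite -lead_coef_eq0 /lead_coef.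
  by rewrite -(Z_of_intK p`__) e.
rewrite zpoly_evalE -[RHS](rootP pa) (@horner_coef_wide _ (size p).-1.+1).
  by apply: eq_bigr => i _; rewrite coef_map Z_of_intK.
by rewrite (leq_trans (size_poly _ _)) // leqSpred.
Qed.

Lemma zmax_abs_le (m : nat) (c : nat -> BinNums.Z) (B : R) : (forall i, (i <= m)%N -> IZR (BinInt.Z.abs (c i)) <= B) ->
  IZR (zmax_abs m c) <= B.
Proof.
elim: m => [|m IHm] h /=; first exact: h.
case: (BinInt.Z.max_spec (zmax_abs m c) (BinInt.Z.abs (c m.+1))) => -[_ ->]; first exact: h.
by apply: IHm => i im; apply: h; exact: leqW.
Qed.

Lemma zmax_abs_ge (m : nat) (c : nat -> BinNums.Z) (i : nat) : (i <= m)%N -> BinInt.Z.le (BinInt.Z.abs (c i)) (zmax_abs m c).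
Proof.
elim: m => [|m IHm] /=; first by rewrite leqn0 => /eqP ->; exact: BinInt.Z.le_refl.
rewrite leq_eqVlt => /orP[/eqP ->|/IHm h]; first exact: BinInt.Z.le_max_r.
exact: BinInt.Z.le_trans h (BinInt.Z.le_max_l _ _).
Qed.

Lemma IZR_abs (z : int) : IZR (BinInt.Z.abs (Z_of_int z)) = `|z|%:~R.
Proof. by rewrite Rbasic_fun.abs_IZR RabsE IZR_int Z_of_intK intr_norm. Qed.

(** The minimal polynomial is an integral factor of [D], so [factor_height] transfers the bound on
    coefficients. *)
Lemma height_exists (n : nat) : exists2 C : R, 1 <= C &
  forall (D : {poly int}) (a B : R), D != 0 -> root (map_poly intr D) a -> (size D <= n.+1)%N ->
    (forall i, `|D`_i|%:~R <= B) ->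
    alg_deg_le n a /\ exists2 h, height a h & IZR h <= C * B.
Proof.
have [C C1 HC] := factor_height R n; exists C => // D a B D0 Da sD DB.
have [M [M0 Ma Mmin Mprim [g eD]]] := minpoly_exists D0 Da.
have sM : (size M <= n.+1)%N by apply: leq_trans (Mmin _ D0 Da) sD.
have zM := zpoly_root_of M0 Ma.
have s0 : (0 < size M)%N by rewrite size_poly_gt0.
split.
  exists (size M).-1, (fun i => Z_of_int M`_i); split=> //.
  by apply/ssrnat.leP; rewrite -ltnS prednK.
exists (zmax_abs (size M).-1 (fun i => Z_of_int M`_i)).
  exists (size M).-1, (fun i => Z_of_int M`_i); split=> //; split=> //; split.
    move=> m' c' /zpoly_rootP[p0 pa sp]; apply/ssrnat.leP.
    by have := Mmin _ p0 pa; rewrite sp => h; rewrite -ltnS prednK.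
  move=> k hk.
  have : (int_of_Z k %| 1)%Z.
    apply: Mprim => i; have [im|im] := ltnP i (size M); last by rewrite nth_default.
    have [|q hq] := hk i; first by apply/ssrnat.leP; rewrite -ltnS prednK.
    apply/dvdzP; exists (int_of_Z q); rewrite -[LHS]Z_of_intK hq.
    by rewrite -[BinInt.Z.mul q k]/(q * k)%R rmorphM.
  case/dvdzP => q hq; exists (Z_of_int q).
  by rewrite -[BinInt.Z.mul _ _]/(Z_of_int q * k)%R -[k in RHS]int_of_ZK -rmorphM -hq.
apply: zmax_abs_le => i _; rewrite IZR_abs.
by rewrite eD in D0 sD DB; exact: HC D0 sD DB i.
Qed.

(** Off the points with a short vector, [good_poly] gives the polynomial, [root_near] the root and
    [height_exists] its height. The exceptional share 1/4 is what later lets at least half of the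
    blocks survive. *)
Lemma regular_system (n : nat) (A : R) : 1 <= A -> exists Lam K : R, [/\ 1 <= Lam, 0 < K &
  forall u L : R, 0 < L -> - A <= u -> u + L <= A -> exists2 Q0 : R, 1 <= Q0 &
  forall Q, Q0 <= Q -> exists2 Z : R -> Prop, cov Z (L / 4) &
  forall x, u <= x < u + L -> ~ Z x -> exists a h,
    [/\ alg_deg_le n.+1 a, height a h, IZR h <= Lam * Q & `|x - a| <= K / Q ^+ n.+2]].
Proof.
move=> A1.
have k4 : 0 < 4^-1 :> R by rewrite invr_gt0.
have [e e0 nondiv] := @nondivergence R n.+1 4^-1 k4.
have [Lam Lam1 gp] := @good_poly R n e A e0 A1.
have [C C1 hex] := height_exists n.+1.
have e2 : 0 < e / 2 by rewrite divr_gt0.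
have Lam0 : 0 < Lam by lra.
have [Q1 Q11 rn] := @root_near R n (e / 2) Lam A e2 Lam0 A1.
exists (C * Lam), (2 / (e / 2)); split; [by nra|by rewrite divr_gt0|].
move=> u L L0 uA uLA.
have [Q0 Q01 covb] := nondiv u L L0.
exists (Num.max Q0 Q1); first by rewrite le_max Q01.
move=> Q; rewrite ge_max => /andP[QQ0 QQ1].
exists (fun x => u <= x < u + L /\ short_at n.+1 Q e x); first by rewrite mulrC; exact: covb.
move=> x xu nb.
have xA : `|x| <= A by rewrite ler_norml; move: xu => /andP[? ?]; apply/andP; split; lra.
have ns : ~ short_at n.+1 Q e x by move=> sx; apply: nb.
have Q1' : 1 <= Q by exact: le_trans QQ0.
have Qp : 0 < Q by lra.
have [p [sp px pL dp]] := gp Q x Q1' xA ns.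
have [||||a ra xa] := rn (map_poly intr p) Q x QQ1 xA; rewrite ?(leq_trans (size_poly _ _)) //.
  by move=> i; rewrite coef_map /= -intr_norm.
have p0 : p != 0.
  apply: contraTneq dp => ->; rewrite rmorph0 deriv0 horner0 normr0 -ltNge; exact: mulr_gt0.
have [an [h ah hB]] := hex p a (Lam * Q) p0 ra sp pL.
by exists a, h; split=> //; rewrite -mulrA.
Qed.

Lemma absz_int_of_Z_le z H : BinInt.Z.le (BinInt.Z.abs z) (BinInt.Z.of_nat H) ->
  (`|int_of_Z z| <= H)%N.
Proof. lia. Qed.

Lemma recenter (z : int) H : (`|z| <= H)%N ->
  (absz (z + Posz H)%R < (2 * H).+1)%N /\ Posz (absz (z + Posz H)) - Posz H = z.
Proof. by move=> h; split; lia. Qed.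

Lemma alg_list (n H : nat) : exists2 l : seq R, (size l <= (2 * H).+1 ^ n.+1 * n.+1)%N &
  forall a h, alg_deg_le n a -> height a h -> BinInt.Z.le h (BinInt.Z.of_nat H) -> List.In a l.
Proof.
pose pf (f : {ffun 'I_n.+1 -> 'I_(2 * H).+1}) : {poly int} :=
  \poly_(i < n.+1) (Posz (f (inord i)) - Posz H).
have /choice[r hr] : forall f, exists s : seq R, (size s <= n.+1)%N /\ (pf f != 0 -> forall x, root (map_poly intr (pf f)) x -> x \in s).
  move=> f; have [->|f0] := eqVneq (pf f) 0; first by exists [::].
  have [|s ss hs] := @roots_list R (map_poly intr (pf f)).
    by rewrite map_poly_eq0_id0 ?intr_eq0 // lead_coef_eq0.
  exists s; split=> //; apply: leq_trans (ltnW ss) _.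
  by rewrite (leq_trans (size_poly _ _)) // size_poly.
exists (flatten [seq r f | f <- enum {ffun 'I_n.+1 -> 'I_(2 * H).+1}]).
  rewrite size_flatten /shape -map_comp.
  have -> : ((2 * H).+1 ^ n.+1 * n.+1)%N = sumn [seq n.+1 | f <- enum {ffun 'I_n.+1 -> 'I_(2 * H).+1}].
    have es (s : seq {ffun 'I_n.+1 -> 'I_(2 * H).+1}) : sumn [seq n.+1 | _ <- s] = (size s * n.+1)%N.
      by elim: s => //= _ s ->.
    by rewrite es -cardE card_ffun !card_ord.
  elim: (enum _) => //= f s IHs; apply: leq_add => //; exact: (hr f).1.
move=> a h [m' [c' [m'n ra']]] [m [c [[ra [mmin _]] eh]]] hH.
have mn : (m <= n)%N by apply/ssrnat.leP; apply: PeanoNat.Nat.le_trans (mmin _ _ ra') m'n.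
have [p0 pa sp] := zpoly_rootP ra.
have cH i : (i <= m)%N -> (`|int_of_Z (c i)| <= H)%N.
  move=> im; apply: absz_int_of_Z_le; apply: BinInt.Z.le_trans hH.
  by rewrite eh; exact: zmax_abs_ge.
pose f : {ffun 'I_n.+1 -> 'I_(2 * H).+1} :=
  [ffun i : 'I_n.+1 => inord (absz ((if (i <= m)%N then int_of_Z (c i) else 0) + Posz H))].
have ef : pf f = polyZ m c.
  apply/polyP => i; rewrite !coef_poly; case: ltnP => [i_n|ni]; last first.
    by rewrite ltnS leqNgt (leq_ltn_trans mn ni).
  have ei : (inord i : 'I_n.+1) = i :> nat by rewrite inordK.
  rewrite ffunE !ei !ltnS; set z := (if _ then _ else _).
  have zH : (`|z| <= H)%N by rewrite /z; case: ifP => // /cH.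
  by have [h1 h2] := recenter zH; rewrite inordK // h2.
have : a \in r f by apply: (hr f).2; rewrite ef.
move=> ar; have : a \in flatten [seq r f | f <- enum {ffun 'I_n.+1 -> 'I_(2 * H).+1}].
  by apply/flattenP; exists (r f) => //; apply: map_f; rewrite mem_enum.
elim: (flatten _) => //= x s IHs; rewrite inE => /orP[/eqP ->|/IHs]; [by left|by right].
Qed.

End Bridge.

(** * The arithmetic results over the standard library reals *)

Section StdlibForms.
Import Defs.
Local Notation R := Rdefinitions.R.
Local Notation IZR := Rdefinitions.IZR.
Local Open Scope ring_scope.

Fixpoint rsum (u : nat -> R) (n : nat) : R :=
  match n with O => Rdefinitions.IZR BinNums.Z0 | S k => Rdefinitions.Rplus (rsum u k) (u k) end.

Definition scov (Z : R -> Prop) (c : R) : Prop :=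
  exists a b : nat -> R, (forall n, Rdefinitions.Rle (a n) (b n)) /\
    (forall x, Z x -> exists n, Rdefinitions.Rlt (a n) x /\ Rdefinitions.Rlt x (b n)) /\
    forall n, Rdefinitions.Rle (rsum (fun i => Rdefinitions.Rminus (b i) (a i)) n) c.

Lemma rsumE u n : rsum u n = \sum_(i < n) u i.
Proof. by elim: n => [|n IHn]; rewrite ?big_ord0 // big_ord_recr -IHn. Qed.

Lemma scov_cov Z c : cov Z c -> scov Z c.
Proof.
case=> a [b [ab cvr sm]]; exists a, b; split; first by move=> n; apply/RleP.
split=> [x /cvr[n /andP[h1 h2]]|n]; first by exists n; split; apply/RltP.
by rewrite rsumE; apply/RleP.
Qed.

Lemma regular_system_R (n : nat) (A : R) : Rdefinitions.Rle (IZR (BinNums.Zpos BinNums.xH)) A -> exists Lam K : R,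
  Rdefinitions.Rle (IZR (BinNums.Zpos BinNums.xH)) Lam /\ Rdefinitions.Rlt (IZR BinNums.Z0) K /\
  forall u L : R, Rdefinitions.Rlt (IZR BinNums.Z0) L -> Rdefinitions.Rle (Rdefinitions.Ropp A) u ->
    Rdefinitions.Rle (Rdefinitions.Rplus u L) A ->
  exists Q0 : R, Rdefinitions.Rle (IZR (BinNums.Zpos BinNums.xH)) Q0 /\ forall Q, Rdefinitions.Rle Q0 Q ->
  exists Z : R -> Prop, scov Z (Rdefinitions.Rdiv L (IZR (BinNums.Zpos (BinNums.xO (BinNums.xO BinNums.xH))))) /\
  forall x, Rdefinitions.Rle u x /\ Rdefinitions.Rlt x (Rdefinitions.Rplus u L) -> ~ Z x ->
    exists a h, alg_deg_le (S n) a /\ height a h /\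
      Rdefinitions.Rle (IZR h) (Rdefinitions.Rmult Lam Q) /\
      Rdefinitions.Rle (Rbasic_fun.Rabs (Rdefinitions.Rminus x a)) (Rdefinitions.Rdiv K (Rpow_def.pow Q (S (S n)))).
Proof.
move=> /RleP A1; have [Lam [K [L1 K0 H]]] := @regular_system n A A1.
exists Lam, K; split; first exact/RleP; split; first exact/RltP.
move=> u L /RltP L0 /RleP uA /RleP uLA; have [Q0 Q01 HQ] := H u L L0 uA uLA.
exists Q0; split; first exact/RleP.
move=> Q /RleP QQ; have [Z cZ HZ] := HQ Q QQ; exists Z; split.
  have -> : Rdefinitions.Rdiv L (IZR (BinNums.Zpos (BinNums.xO (BinNums.xO BinNums.xH)))) = L / 4.
    by rewrite RdivE IZRposE INRE.
  exact: scov_cov.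
move=> x [/RleP x1 /RltP x2] nZ; have xu : u <= x < u + L by apply/andP.
have [a [h [h1 h2 h3 h4]]] := HZ x xu nZ.
by exists a, h; split=> //; split=> //; split; [apply/RleP|apply/RleP; rewrite RdivE RpowE RabsE].
Qed.

Lemma alg_list_R (n H : nat) : exists l : list R,
  Peano.le (length l) (Nat.mul (Nat.pow (S (Nat.mul 2 H)) (S n)) (S n)) /\
  forall a h, alg_deg_le n a -> height a h -> BinInt.Z.le h (BinInt.Z.of_nat H) -> List.In a l.
Proof.
have [l sl hl] := alg_list n H; exists l; split=> //.
have pw a b : Nat.pow a b = expn a b by elim: b => //= b ->; rewrite expnS.
by rewrite pw -[length l]/(size l); apply/ssrnat.leP.
Qed.

Lemma height_ge1 a h : height a h -> BinInt.Z.le 1 h.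
Proof.
case=> m [c [[[cm _] _] ->]]; apply: BinInt.Z.le_trans (zmax_abs_ge (m := m) (c := c) (i := m) _) => //.
by move: cm; case: (c m) => // p _; case: p.
Qed.

End StdlibForms.

End NumberTheory.

From Stdlib Require Import Reals Lra Lia Psatz ZArith Classical ClassicalEpsilon List.
From Stdlib Require Import FunctionalExtensionality PropExtensionality.
Require Import Defs.
Import NumberTheory(rsum, scov, regular_system_R, alg_list_R, height_ge1).
Open Scope R_scope.

(** * Extended reals and sums *)

Lemma Rbar_le_refl x : Rbar_le x x.
Proof. destruct x; simpl; auto; lra. Qed.

Lemma Rbar_le_trans x y z : Rbar_le x y -> Rbar_le y z -> Rbar_le x z.
Proof. destruct x, y, z; simpl; auto; try tauto; lra. Qed.

Lemma Rbar_le_antisym x y : Rbar_le x y -> Rbar_le y x -> x = y.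
Proof. destruct x, y; simpl; try tauto; intros; f_equal; lra. Qed.

Lemma Rbar_le_total x y : Rbar_le x y \/ Rbar_le y x.
Proof. destruct x as [a| |], y as [b| |]; simpl; auto. destruct (Rle_dec a b); [left|right]; lra. Qed.

Lemma Rbar_le_p_infty x : Rbar_le x p_infty.
Proof. destruct x; simpl; auto. Qed.

Lemma Rbar_le_dense x c : (forall e, 0 < e -> Rbar_le x (Finite (c + e))) -> Rbar_le x (Finite c).
Proof.
  destruct x as [a| |]; simpl; auto.
  - intros H. destruct (Rle_dec a c) as [|n]; auto.
    specialize (H ((a - c) / 2)). lra.
  - intros H. apply (H 1). lra.
Qed.

Lemma is_sup_ex (S : Rbar -> Prop) : exists v, is_sup S v.
Proof.
  destruct (classic (exists r, S (Finite r))) as [[r0 Hr0]|Hn].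
  - destruct (classic (S p_infty)) as [Hp|Hp].
    { exists p_infty. split; [intros; apply Rbar_le_p_infty|]. intros u Hu. apply Hu. exact Hp. }
    destruct (classic (bound (fun r => S (Finite r)))) as [Hb|Hb].
    + destruct (completeness _ Hb (ex_intro _ r0 Hr0)) as [m [Hm1 Hm2]].
      exists (Finite m). split.
      * intros [r| |] Hy; simpl; auto.
      * intros [u| |] Hu; simpl; auto.
        -- apply Hm2. intros r Hr. apply (Hu _ Hr).
        -- apply (Hu _ Hr0).
    + exists p_infty. split; [intros; apply Rbar_le_p_infty|].
      intros [u| |] Hu; simpl; auto.
      * apply Hb. exists u. intros r Hr. apply (Hu _ Hr).
      * apply (Hu _ Hr0).
  - destruct (classic (S p_infty)) as [Hp|Hp].
    { exists p_infty. split; [intros; apply Rbar_le_p_infty|]. intros u Hu. apply Hu. exact Hp. }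
    exists m_infty. split; [|intros; simpl; auto].
    intros [r| |] Hy; simpl; auto. apply Hn. now exists r.
Qed.

Definition Rbar_opp (x : Rbar) : Rbar :=
  match x with Finite r => Finite (- r) | p_infty => m_infty | m_infty => p_infty end.

Lemma Rbar_opp_le x y : Rbar_le (Rbar_opp x) (Rbar_opp y) -> Rbar_le y x.
Proof. destruct x, y; simpl; auto; try tauto; lra. Qed.

Lemma Rbar_opp_opp x : Rbar_opp (Rbar_opp x) = x.
Proof. destruct x as [r| |]; simpl; auto. f_equal; lra. Qed.

Lemma is_inf_ex (S : Rbar -> Prop) : exists v, is_inf S v.
Proof.
  destruct (is_sup_ex (fun x => S (Rbar_opp x))) as [v [H1 H2]].
  exists (Rbar_opp v). split.
  - intros y Hy. apply Rbar_opp_le. rewrite Rbar_opp_opp. apply H1. now rewrite Rbar_opp_opp.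
  - intros u Hu. apply Rbar_opp_le. rewrite Rbar_opp_opp. apply H2.
    intros y Hy. apply Rbar_opp_le. rewrite Rbar_opp_opp. apply Hu, Hy.
Qed.

Lemma Rbar_sup_spec S : is_sup S (Rbar_sup S).
Proof. exact (epsilon_spec (inhabits p_infty) (is_sup S) (is_sup_ex S)). Qed.

Lemma Rbar_inf_spec S : is_inf S (Rbar_inf S).
Proof. exact (epsilon_spec (inhabits p_infty) (is_inf S) (is_inf_ex S)). Qed.

Lemma Rbar_sup_ub (S : Rbar -> Prop) y : S y -> Rbar_le y (Rbar_sup S).
Proof. apply Rbar_sup_spec. Qed.

Lemma Rbar_sup_lub (S : Rbar -> Prop) u : (forall y, S y -> Rbar_le y u) -> Rbar_le (Rbar_sup S) u.
Proof. apply Rbar_sup_spec. Qed.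

Lemma Rbar_inf_lb (S : Rbar -> Prop) y : S y -> Rbar_le (Rbar_inf S) y.
Proof. apply Rbar_inf_spec. Qed.

Lemma Rbar_inf_glb (S : Rbar -> Prop) u : (forall y, S y -> Rbar_le u y) -> Rbar_le u (Rbar_inf S).
Proof. apply Rbar_inf_spec. Qed.

Lemma Rbar_sup_eq S v : is_sup S v -> Rbar_sup S = v.
Proof.
  intros [H1 H2]. apply Rbar_le_antisym; [now apply Rbar_sup_lub|].
  apply H2. intros; now apply Rbar_sup_ub.
Qed.

Lemma Rbar_inf_lt (S : Rbar -> Prop) c e : 0 < e -> Rbar_le (Rbar_inf S) (Finite c) ->
  exists y, S y /\ Rbar_le y (Finite (c + e)).
Proof.
  intros He H. apply NNPP. intros Hn.
  assert (Hg : Rbar_le (Finite (c + e)) (Rbar_inf S)).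
  { apply Rbar_inf_glb. intros y Hy. destruct (Rbar_le_total y (Finite (c + e))) as [h|h]; auto.
    exfalso. apply Hn. now exists y. }
  generalize (Rbar_le_trans _ _ _ Hg H). simpl. lra.
Qed.

Lemma Rbar_sup_gt (S : Rbar -> Prop) c : ~ Rbar_le (Rbar_sup S) (Finite c) ->
  exists y, S y /\ ~ Rbar_le y (Finite c).
Proof.
  intros H. apply NNPP. intros Hn. apply H. apply Rbar_sup_lub. intros y Hy.
  apply NNPP. intros h. apply Hn. now exists y.
Qed.

Lemma rsum_nonneg u n : (forall i, 0 <= u i) -> 0 <= rsum u n.
Proof. intros H. induction n; simpl; [lra|]. specialize (H n). lra. Qed.

Lemma rsum_le u v n : (forall i, (i < n)%nat -> u i <= v i) -> rsum u n <= rsum v n.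
Proof.
  intros H. induction n; simpl; [lra|].
  assert (u n <= v n) by (apply H; lia).
  assert (rsum u n <= rsum v n) by (apply IHn; intros; apply H; lia). lra.
Qed.

Lemma rsum_ext u v n : (forall i, (i < n)%nat -> u i = v i) -> rsum u n = rsum v n.
Proof. intros H. apply Rle_antisym; apply rsum_le; intros; rewrite H; auto; lra. Qed.

Lemma rsum_mono u n m : (forall i, 0 <= u i) -> (n <= m)%nat -> rsum u n <= rsum u m.
Proof. intros H Hl. induction Hl; simpl; [lra|]. specialize (H m). lra. Qed.

Lemma rsum_plus u v n : rsum (fun i => u i + v i) n = rsum u n + rsum v n.
Proof. induction n; simpl; [lra|]. rewrite IHn. lra. Qed.

Lemma rsum_scal c u n : rsum (fun i => c * u i) n = c * rsum u n.
Proof. induction n; simpl; [lra|]. rewrite IHn. lra. Qed.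

Lemma rsum_zero n : rsum (fun _ => 0) n = 0.
Proof. induction n; simpl; lra. Qed.

Lemma rsum_swap (u : nat -> nat -> R) n m :
  rsum (fun i => rsum (fun j => u i j) m) n = rsum (fun j => rsum (fun i => u i j) n) m.
Proof.
  induction n; simpl.
  - now rewrite rsum_zero.
  - rewrite IHn, <- rsum_plus. apply rsum_ext. auto.
Qed.

Lemma rsum_geom n : rsum (fun i => / 2 ^ S i) n = 1 - / 2 ^ n.
Proof.
  induction n; [simpl; lra|]. cbn [rsum]. rewrite IHn. simpl.
  assert (2 ^ n <> 0) by (apply pow_nonzero; lra). field. auto.
Qed.

Lemma rsum_geom_le n : rsum (fun i => / 2 ^ S i) n <= 1.
Proof.
  rewrite rsum_geom. assert (0 < / 2 ^ n) by (apply Rinv_0_lt_compat, pow_lt; lra). lra.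
Qed.

Lemma psum_Finite u v n : (forall i, (i < n)%nat -> u i = Finite (v i)) -> Rbar_psum u n = Finite (rsum v n).
Proof.
  induction n; intros H; simpl; auto. rewrite IHn by (intros; apply H; lia).
  rewrite H by lia. reflexivity.
Qed.

Lemma series_le u v c : (forall n, u n = Finite (v n)) -> (forall n, rsum v n <= c) ->
  Rbar_le (Rbar_series u) (Finite c).
Proof.
  intros H1 H2. apply Rbar_sup_lub. intros y [n ->]. rewrite (psum_Finite u v) by auto. apply H2.
Qed.

(** A finite sum of nonnegative terms forces every term to be finite; this is the passage from
    extended to real sequences. *)
Lemma series_le_inv u c : (forall n, Rbar_le (Finite 0) (u n)) -> Rbar_le (Rbar_series u) (Finite c) ->
  exists v, (forall n, u n = Finite (v n) /\ 0 <= v n) /\ forall n, rsum v n <= c.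
Proof.
  intros H0 H.
  assert (Hp : forall n, Rbar_le (Rbar_psum u n) (Finite c)).
  { intros n. eapply Rbar_le_trans; [|exact H]. apply Rbar_sup_ub. now exists n. }
  assert (Hn : forall n, Rbar_le (Finite 0) (Rbar_psum u n)).
  { induction n; simpl; [lra|]. specialize (H0 n).
    destruct (Rbar_psum u n), (u n); simpl in *; auto; lra. }
  assert (Hf : forall n, exists r, u n = Finite r).
  { intros n. specialize (Hp (S n)). specialize (Hn n). specialize (H0 n). simpl in Hp.
    destruct (u n) as [r| |]; [now exists r| |]; destruct (Rbar_psum u n); simpl in *; tauto. }
  exists (fun n => fin (u n)).
  assert (Hu : forall n, u n = Finite (fin (u n))) by (intros n; destruct (Hf n) as [r ->]; auto).
  split.
  - intros n. split; auto. specialize (H0 n). rewrite Hu in H0. exact H0.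
  - intros n. specialize (Hp n). rewrite (psum_Finite u (fun n => fin (u n))) in Hp; auto.
Qed.

Lemma series_nonneg u : Rbar_le (Finite 0) (Rbar_series u).
Proof. apply Rbar_sup_ub. now exists O. Qed.

Section ListSums.
Context {T : Type}.

Definition lsum (f : T -> R) (l : list T) : R := fold_right (fun x s => f x + s) 0 l.

Lemma lsum_le f g l : (forall x, In x l -> f x <= g x) -> lsum f l <= lsum g l.
Proof.
  induction l; simpl; intros H; [lra|].
  assert (f a <= g a) by auto. assert (lsum f l <= lsum g l) by auto. lra.
Qed.

Lemma lsum_ext f g l : (forall x, In x l -> f x = g x) -> lsum f l = lsum g l.
Proof. intros H. apply Rle_antisym; apply lsum_le; intros; rewrite H; auto; lra. Qed.

Lemma lsum_nonneg f l : (forall x, In x l -> 0 <= f x) -> 0 <= lsum f l.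
Proof.
  intros H. induction l; simpl; [lra|].
  assert (0 <= f a) by (apply H; now left). assert (0 <= lsum f l) by (apply IHl; intros; apply H; now right). lra.
Qed.

Lemma lsum_const c l : lsum (fun _ => c) l = INR (length l) * c.
Proof. induction l; [simpl; lra|]. cbn [length]. rewrite S_INR. simpl. rewrite IHl. lra. Qed.

Lemma lsum_rsum (u : T -> nat -> R) l n :
  lsum (fun x => rsum (u x) n) l = rsum (fun i => lsum (fun x => u x i) l) n.
Proof.
  induction l; simpl; [now rewrite rsum_zero|]. rewrite IHl, <- rsum_plus. reflexivity.
Qed.

Lemma lsum_filter f (p : T -> bool) l : lsum (fun x => if p x then f x else 0) l = lsum f (filter p l).
Proof. induction l; simpl; auto. destruct (p a); simpl; rewrite IHl; lra. Qed.

Lemma lsum_single f l a : NoDup l -> In a l -> (forall x, In x l -> x <> a -> f x = 0) -> lsum f l = f a.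
Proof.
  induction l as [|b l IH]; simpl; intros Hd Hi Hz; [tauto|]. inversion Hd; subst.
  destruct Hi as [->|Hi].
  - rewrite (lsum_ext f (fun _ => 0)), lsum_const; [lra|].
    intros x Hx. apply Hz; auto. intros ->. auto.
  - rewrite Hz, IH; auto; [lra|]. intros ->. auto.
Qed.

End ListSums.

(** * Length of countable covers of an interval *)

Definition clamp (a b t : R) := Rmax a (Rmin t b).

Lemma clamp_mono a b s t : s <= t -> clamp a b s <= clamp a b t.
Proof. intros. unfold clamp. apply Rle_max_compat_l. apply Rle_min_compat_r. auto. Qed.

Lemma clamp_bounds a b t : a <= b -> a <= clamp a b t <= b.
Proof.
  intros. unfold clamp. split; [apply Rmax_l|]. apply Rmax_lub; auto. apply Rmin_r.
Qed.

Lemma clamp_lt a b s t x : a < x < b -> s < x < t -> clamp a b s < x < clamp a b t.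
Proof.
  intros. unfold clamp. split.
  - apply Rmax_lub_lt; [lra|]. eapply Rle_lt_trans; [apply Rmin_l|lra].
  - eapply Rlt_le_trans; [|apply Rmax_r]. apply Rmin_glb_lt; lra.
Qed.

(* Remove the interval containing the right endpoint and recurse. *)
Lemma finite_cover_length (l : list (R * R)) : forall u v, u <= v ->
  (forall i, In i l -> fst i <= snd i) ->
  (forall x, u <= x <= v -> exists i, In i l /\ fst i < x < snd i) ->
  v - u <= lsum (fun i => snd i - fst i) l.
Proof.
  induction l as [l IH] using (well_founded_induction (well_founded_ltof _ (@length (R * R)))).
  intros u v Huv Hle Hc.
  destruct (Hc v) as [i [Hi Hv]]; [lra|].
  destruct (in_split _ _ Hi) as [l1 [l2 ->]].
  assert (Hsum : lsum (fun i => snd i - fst i) (l1 ++ i :: l2) =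
    snd i - fst i + lsum (fun i => snd i - fst i) (l1 ++ l2)).
  { clear. induction l1; simpl; [reflexivity|]. rewrite IHl1. lra. }
  rewrite Hsum.
  assert (Hn : 0 <= lsum (fun i => snd i - fst i) (l1 ++ l2)).
  { apply lsum_nonneg. intros x Hx. assert (fst x <= snd x); [|lra].
    apply Hle. apply in_app_iff in Hx. apply in_app_iff. simpl. tauto. }
  destruct (Rle_dec u (fst i)) as [h|h]; [|lra].
  assert (fst i - u <= lsum (fun i => snd i - fst i) (l1 ++ l2)); [|lra].
  apply IH; auto.
  - unfold ltof. rewrite !length_app. simpl. lia.
  - intros j Hj. apply Hle. apply in_app_iff in Hj. apply in_app_iff. simpl. tauto.
  - intros x Hx. destruct (Hc x) as [j [Hj Hxj]]; [lra|]. exists j. split; auto.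
    apply in_app_iff in Hj. apply in_app_iff. destruct Hj as [|[<-|]]; auto. lra.
Qed.

(** Heine-Borel: the supremum of the [t] for which [[u, t]] has a finite subcover is [v] and is
    attained. *)
Lemma cover_length (a b : nat -> R) u v : (forall n, a n <= b n) -> u <= v ->
  (forall x, u <= x <= v -> exists n, a n < x < b n) ->
  exists n, v - u <= rsum (fun i => b i - a i) n.
Proof.
  intros Hab Huv Hc.
  set (E := fun t => u <= t <= v /\ exists n, forall x, u <= x <= t -> exists i, (i < n)%nat /\ a i < x < b i).
  assert (Eu : E u).
  { split; [lra|]. destruct (Hc u) as [n Hn]; [lra|]. exists (S n). intros x Hx. exists n. split; [lia|].
    replace x with u by lra. auto. }
  destruct (completeness E) as [s [Hs1 Hs2]].
  { exists v. intros t [Ht _]. lra. }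
  { now exists u. }
  assert (us : u <= s) by (apply Hs1; auto).
  assert (sv : s <= v) by (apply Hs2; intros t [Ht _]; lra).
  destruct (Hc s) as [n Hn]; [lra|].
  assert (exists t, E t /\ a n < t) as [t [[Ht [m Hm]] Hat]].
  { apply NNPP. intros Hno. assert (s <= a n); [|lra]. apply Hs2. intros t Ht.
    destruct (Rle_dec t (a n)); auto. exfalso. apply Hno. exists t. split; auto. lra. }
  set (t' := Rmin v ((s + b n) / 2)).
  assert (Ht' : E t').
  { assert (u <= t' <= v /\ t' < b n).
    { unfold t', Rmin. destruct Rle_dec; lra. }
    split; [lra|]. exists (S (Nat.max m n)). intros x Hx.
    destruct (Rle_dec x t) as [h|h].
    - destruct (Hm x) as [i [Hi Hxi]]; [lra|]. exists i. split; auto. lia.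
    - exists n. split; [lia|]. lra. }
  assert (s = v).
  { apply Hs1 in Ht'. unfold t', Rmin in Ht'. destruct Rle_dec; lra. }
  assert (t' = v) by (unfold t'; rewrite Rmin_left; lra).
  rewrite H0 in Ht'. destruct Ht' as [_ [N HN]].
  exists N.
  assert (Hl : forall M, lsum (fun i => snd i - fst i) (map (fun i => (a i, b i)) (seq 0 M)) = rsum (fun i => b i - a i) M).
  { induction M; [reflexivity|]. rewrite seq_S, map_app. simpl.
    rewrite <- IHM. clear. induction (map (fun i => (a i, b i)) (seq 0 M)); simpl; lra. }
  rewrite <- Hl. apply finite_cover_length; auto.
  - intros i Hi. apply in_map_iff in Hi. destruct Hi as [k [<- _]]. simpl. auto.
  - intros x Hx. destruct (HN x Hx) as [i [Hi Hxi]]. exists (a i, b i). split; auto.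
    apply in_map_iff. exists i. split; auto. apply in_seq. lia.
Qed.

(* Clipping the covering intervals to the consecutive blocks [u + i l, u + (i+1) l) loses
   no length, since the clipped lengths telescope. *)
Lemma bad_blocks (Z : R -> Prop) (bad : nat -> bool) (u l c : R) (m : nat) : 0 < l -> scov Z c ->
  (forall i x, (i < m)%nat -> bad i = true -> u + INR i * l + l / 4 <= x <= u + INR i * l + 3 * l / 4 -> Z x) ->
  rsum (fun i => if bad i then l / 2 else 0) m <= c.
Proof.
  intros Hl [a [b [Hab [Hc Hs]]]] Hbad.
  set (F := fun n i => clamp (a n) (b n) (u + INR (S i) * l) - clamp (a n) (b n) (u + INR i * l)).
  assert (F0 : forall n i, 0 <= F n i).
  { intros n i. unfold F. rewrite S_INR.
    assert (clamp (a n) (b n) (u + INR i * l) <= clamp (a n) (b n) (u + (INR i + 1) * l)); [|lra].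
    apply clamp_mono. lra. }
  assert (Hone : forall i, (i < m)%nat -> exists n, (if bad i then l / 2 else 0) <= rsum (fun n => F n i) n).
  { intros i Hi. destruct (bad i) eqn:E; [|exists O; simpl; lra].
    destruct (cover_length (fun n => clamp (a n) (b n) (u + INR i * l))
       (fun n => clamp (a n) (b n) (u + INR (S i) * l))
       (u + INR i * l + l / 4) (u + INR i * l + 3 * l / 4)) as [n Hn].
    - intros n. apply clamp_mono. rewrite S_INR. lra.
    - lra.
    - intros x Hx. destruct (Hc x) as [n Hn]; [apply (Hbad i); auto|]. exists n.
      apply clamp_lt; auto. rewrite S_INR. lra.
    - exists n. unfold F. lra. }
  assert (exists n, rsum (fun i => if bad i then l / 2 else 0) m <= rsum (fun i => rsum (fun n => F n i) n) m) as [n Hn].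
  { clear Hbad. induction m; [exists O; simpl; lra|].
    destruct IHm as [n1 H1]; [intros; apply Hone; lia|].
    destruct (Hone m) as [n2 H2]; [lia|]. exists (Nat.max n1 n2). simpl.
    assert (rsum (fun n => F n m) n2 <= rsum (fun n => F n m) (Nat.max n1 n2)) by (apply rsum_mono; auto; lia).
    assert (rsum (fun i => rsum (fun n => F n i) n1) m <= rsum (fun i => rsum (fun n => F n i) (Nat.max n1 n2)) m).
    { apply rsum_le. intros i _. apply rsum_mono; auto. lia. }
    lra. }
  rewrite rsum_swap in Hn.
  eapply Rle_trans; [exact Hn|]. eapply Rle_trans; [|apply (Hs n)].
  apply rsum_le. intros j _.
  assert (Ht : rsum (fun i => F j i) m = clamp (a j) (b j) (u + INR m * l) - clamp (a j) (b j) (u + INR 0 * l)).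
  { clear. induction m; [simpl; lra|]. cbn [rsum]. rewrite IHm. unfold F. lra. }
  rewrite Ht.
  generalize (clamp_bounds (a j) (b j) (u + INR m * l) (Hab j)) (clamp_bounds (a j) (b j) (u + INR 0 * l) (Hab j)). lra.
Qed.

(** * Dyadic intervals *)

Definition len (j : Z) : R := powerRZ 2 (- j).

Lemma len_pos j : 0 < len j.
Proof. apply powerRZ_lt. lra. Qed.

Lemma powerRZ_of_nat n : powerRZ 2 (Z.of_nat n) = IZR (2 ^ Z.of_nat n).
Proof. rewrite <- pow_powerRZ, pow_IZR. reflexivity. Qed.

Lemma powerRZ_IZR d : (0 <= d)%Z -> powerRZ 2 d = IZR (2 ^ d).
Proof. intros H. rewrite <- (Z2Nat.id d) by auto. apply powerRZ_of_nat. Qed.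

Lemma len_split i j : (i <= j)%Z -> len i = IZR (2 ^ (j - i)) * len j.
Proof.
  intros H. rewrite <- powerRZ_IZR by lia. unfold len. rewrite <- powerRZ_add by lra. f_equal. lia.
Qed.

Lemma len_succ j : len j = 2 * len (j + 1).
Proof. rewrite (len_split j (j + 1)) by lia. replace (j + 1 - j)%Z with 1%Z by lia. simpl. lra. Qed.

Lemma IZR_pow2_ge1 d : 1 <= IZR (2 ^ d) \/ (d < 0)%Z.
Proof.
  destruct (Z_lt_dec d 0); auto. left. apply IZR_le. assert (0 < 2 ^ d)%Z by (apply Z.pow_pos_nonneg; lia). lia.
Qed.

Lemma len_le i j : (i <= j)%Z -> len j <= len i.
Proof.
  intros H. rewrite (len_split i j) by auto. destruct (IZR_pow2_ge1 (j - i)) as [h|h]; [|lia].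
  generalize (len_pos j). nra.
Qed.

Lemma len_small e : 0 < e -> exists j0, forall j, (j0 <= j)%Z -> len j < e.
Proof.
  intros He. destruct (pow_lt_1_zero (/ 2)) with (y := e) as [n Hn]; auto.
  { rewrite Rabs_pos_eq; lra. }
  exists (Z.of_nat n). intros j Hj.
  specialize (Hn (Z.to_nat j)). rewrite Rabs_pos_eq in Hn by (apply pow_le; lra).
  unfold len. rewrite <- (Z2Nat.id j) by lia. rewrite powerRZ_neg' , <- pow_powerRZ, <- pow_inv.
  apply Hn. lia.
Qed.

Lemma len_bracket e : 0 < e -> exists j, len j <= e < 2 * len j.
Proof.
  intros He.
  destruct (len_small e He) as [j1 H1].
  destruct (len_small (/ e)) as [j2 H2]; [now apply Rinv_0_lt_compat|].
  assert (Hbig : e < len (- (Z.max j2 0))).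
  { specialize (H2 (Z.max j2 0) ltac:(lia)). unfold len in *.
    rewrite Z.opp_involutive. rewrite powerRZ_neg' in H2.
    rewrite <- (Rinv_inv e), <- (Rinv_inv (powerRZ 2 (Z.max j2 0))).
    apply Rinv_lt_contravar; auto. apply Rmult_lt_0_compat; apply Rinv_0_lt_compat; auto. apply powerRZ_lt; lra. }
  set (P := fun n => len (- (Z.max j2 0) + Z.of_nat n) <= e).
  assert (HP : exists n, P n).
  { exists (Z.to_nat (j1 + Z.max j2 0)). unfold P. left. apply H1. lia. }
  destruct (dec_inh_nat_subset_has_unique_least_element P) as [n [[Hn Hmin] _]]; auto.
  { intros n. apply classic. }
  exists (- (Z.max j2 0) + Z.of_nat n)%Z. split; [exact Hn|].
  destruct n as [|n].
  - unfold P in Hn. simpl in Hn. rewrite Z.add_0_r in Hn. lra.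
  - apply Rnot_le_lt. intros h. assert (Pn : P n); [|specialize (Hmin n Pn); lia].
    unfold P. rewrite len_succ. replace (- Z.max j2 0 + Z.of_nat n + 1)%Z with (- Z.max j2 0 + Z.of_nat (S n))%Z by lia. exact h.
Qed.

Definition dset (l : Z * Z) : R -> Prop := dyadic (fst l) (snd l).

(** Inclusion of dyadic intervals expressed on indices, hence decidable: floor division by a power
    of two yields the ancestor in the coarser generation. *)
Definition inc (l m : Z * Z) : Prop :=
  (fst m <= fst l)%Z /\ (snd l / 2 ^ (fst l - fst m) = snd m)%Z.

Lemma inc_dec l m : {inc l m} + {~ inc l m}.
Proof.
  unfold inc. destruct (Z_le_dec (fst m) (fst l)); [|right; tauto].
  destruct (Z.eq_dec (snd l / 2 ^ (fst l - fst m)) (snd m)); [left|right]; tauto.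
Qed.

Definition incb l m : bool := if inc_dec l m then true else false.

Lemma incb_true l m : incb l m = true <-> inc l m.
Proof. unfold incb. destruct inc_dec; split; intros; auto; discriminate. Qed.

Lemma dset_left l : dset l (IZR (snd l) * len (fst l)).
Proof.
  unfold dset, dyadic. fold (len (fst l)). generalize (len_pos (fst l)). nra.
Qed.

Lemma inc_range l m : inc l m ->
  (snd m * 2 ^ (fst l - fst m) <= snd l)%Z /\ (snd l + 1 <= (snd m + 1) * 2 ^ (fst l - fst m))%Z.
Proof.
  intros [H1 H2]. assert (Hp : (0 < 2 ^ (fst l - fst m))%Z) by (apply Z.pow_pos_nonneg; lia).
  generalize (Z.div_mod (snd l) (2 ^ (fst l - fst m)) ltac:(lia)) (Z.mod_pos_bound (snd l) _ Hp).
  rewrite H2. nia.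
Qed.

Lemma inc_of_range l m : (fst m <= fst l)%Z -> (snd m * 2 ^ (fst l - fst m) <= snd l)%Z ->
  (snd l < (snd m + 1) * 2 ^ (fst l - fst m))%Z -> inc l m.
Proof.
  intros H1 H2 H3. split; auto. assert (Hp : (0 < 2 ^ (fst l - fst m))%Z) by (apply Z.pow_pos_nonneg; lia).
  symmetry. apply (Z.div_unique _ _ _ (snd l - snd m * 2 ^ (fst l - fst m))); [left|]; nia.
Qed.

Lemma inc_bounds l m : inc l m ->
  IZR (snd m) * len (fst m) <= IZR (snd l) * len (fst l) /\
  (IZR (snd l) + 1) * len (fst l) <= (IZR (snd m) + 1) * len (fst m).
Proof.
  intros H. destruct (inc_range _ _ H) as [Ha Hb]. destruct H as [H _].
  rewrite (len_split (fst m) (fst l)) by auto.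
  apply IZR_le in Ha, Hb. rewrite mult_IZR in Ha, Hb. rewrite !plus_IZR in Hb.
  generalize (len_pos (fst l)). split; nra.
Qed.

Lemma inc_sub l m x : inc l m -> dset l x -> dset m x.
Proof.
  intros H Hx. destruct (inc_bounds _ _ H) as [Ha Hb].
  unfold dset, dyadic in *. fold (len (fst l)) in Hx. fold (len (fst m)). lra.
Qed.

Lemma inter_inc l m x : dset l x -> dset m x -> (fst m <= fst l)%Z -> inc l m.
Proof.
  unfold dset, dyadic. fold (len (fst l)) (len (fst m)). intros Hl Hm H.
  rewrite (len_split (fst m) (fst l)) in Hm by auto. generalize (len_pos (fst l)). intros Hp.
  apply inc_of_range; auto.
  - apply le_IZR. assert (snd m * 2 ^ (fst l - fst m) < snd l + 1)%Z; [|apply IZR_le; lia].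
    apply lt_IZR. rewrite mult_IZR, plus_IZR. nra.
  - apply lt_IZR. rewrite mult_IZR, plus_IZR. nra.
Qed.

Lemma inc_refl l : inc l l.
Proof. apply (inter_inc l l (IZR (snd l) * len (fst l))); try apply dset_left. lia. Qed.

Lemma inc_trans l m p : inc l m -> inc m p -> inc l p.
Proof.
  intros H1 H2. apply (inter_inc l p (IZR (snd l) * len (fst l))).
  - apply dset_left.
  - eapply inc_sub; [exact H2|]. eapply inc_sub; [exact H1|]. apply dset_left.
  - destruct H1, H2. lia.
Qed.

Lemma inc_common l m p : inc l m -> inc l p -> (fst p <= fst m)%Z -> inc m p.
Proof.
  intros H1 H2 H. apply (inter_inc m p (IZR (snd l) * len (fst l))); auto;
  eapply inc_sub; eauto; apply dset_left.
Qed.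

Lemma inc_eq l m : inc l m -> fst l = fst m -> l = m.
Proof.
  intros [_ H2] H. destruct l as [j k], m as [j' k']. simpl in *. subst j'.
  replace (j - j)%Z with 0%Z in H2 by lia. rewrite Z.pow_0_r, Z.div_1_r in H2. now subst.
Qed.

Lemma dyadic_ex j x : exists k, dyadic j k x.
Proof.
  exists (up (x / len j) - 1)%Z. unfold dyadic. fold (len j). generalize (len_pos j). intros Hp.
  destruct (archimed (x / len j)) as [H1 H2]. rewrite minus_IZR.
  assert (e : x = x / len j * len j) by (field; lra).
  set (q := x / len j) in *. clearbody q. subst x. split; nra.
Qed.

Definition desc (l : Z * Z) (d : nat) : list (Z * Z) :=
  map (fun i => (fst l + Z.of_nat d, snd l * 2 ^ Z.of_nat d + Z.of_nat i)%Z) (seq 0 (2 ^ d)).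

Lemma pow2_Z d : Z.of_nat (2 ^ d) = (2 ^ Z.of_nat d)%Z.
Proof. rewrite Nat2Z.inj_pow. reflexivity. Qed.

Lemma length_desc l d : length (desc l d) = (2 ^ d)%nat.
Proof. unfold desc. now rewrite length_map, length_seq. Qed.

Lemma in_desc l d m : In m (desc l d) <-> inc m l /\ fst m = (fst l + Z.of_nat d)%Z.
Proof.
  unfold desc. rewrite in_map_iff. split.
  - intros [i [<- Hi]]. apply in_seq in Hi. split; auto. simpl.
    assert (Z.of_nat i < 2 ^ Z.of_nat d)%Z by (rewrite <- pow2_Z; lia).
    apply inc_of_range; simpl; [lia| |]; replace (fst l + Z.of_nat d - fst l)%Z with (Z.of_nat d) by lia; nia.
  - intros [H1 H2]. destruct (inc_range _ _ H1) as [Ha Hb].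
    replace (fst m - fst l)%Z with (Z.of_nat d) in * by lia.
    exists (Z.to_nat (snd m - snd l * 2 ^ Z.of_nat d)). split.
    + rewrite Z2Nat.id by lia. destruct m; simpl in *. f_equal; lia.
    + apply in_seq. split; [lia|]. apply Nat2Z.inj_lt. rewrite Z2Nat.id by lia.
      rewrite Nat.add_0_l, pow2_Z. nia.
Qed.

Lemma NoDup_desc l d : NoDup (desc l d).
Proof.
  apply FinFun.Injective_map_NoDup; [|apply seq_NoDup].
  intros i j H. inversion H. lia.
Qed.

Definition cnt (ms : list (Z * Z)) (l : Z * Z) : R := INR (length (filter (fun m => incb m l) ms)).

Lemma cnt_le (ms : list (Z * Z)) (g : Z) (l : Z * Z) : NoDup ms -> (forall m, In m ms -> fst m = g) ->
  (fst l <= g)%Z -> cnt ms l <= IZR (2 ^ (g - fst l)).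
Proof.
  intros Hd Hg Hl. unfold cnt.
  assert (length (filter (fun m => incb m l) ms) <= length (desc l (Z.to_nat (g - fst l))))%nat as H.
  { apply NoDup_incl_length; [now apply NoDup_filter|]. intros m Hm. apply filter_In in Hm.
    destruct Hm as [Hm Hi]. apply incb_true in Hi. apply in_desc. split; auto. rewrite (Hg m Hm). lia. }
  rewrite length_desc in H. apply le_INR in H. rewrite (INR_IZR_INZ (2 ^ _)%nat), pow2_Z, Z2Nat.id in H by lia. exact H.
Qed.

Lemma cnt_zero (ms : list (Z * Z)) (g : Z) (l : Z * Z) : (forall m, In m ms -> fst m = g) ->
  (g < fst l)%Z -> cnt ms l = 0.
Proof.
  intros Hg Hl. unfold cnt.
  assert (H : filter (fun m => incb m l) ms = nil); [|now rewrite H].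
  induction ms as [|m ms IH]; simpl; auto.
  destruct (incb m l) eqn:E.
  - apply incb_true in E. destruct E as [E _]. rewrite (Hg m) in E by now left. lia.
  - apply IH. intros; apply Hg; now right.
Qed.

(** * Light and heavy dyadic intervals *)

Lemma common_bound {T : Type} (l : list T) (P : T -> nat -> Prop) :
  (forall x i j, (i <= j)%nat -> P x i -> P x j) -> (forall x, In x l -> exists i, P x i) ->
  exists i, forall x, In x l -> P x i.
Proof.
  intros Hm. induction l as [|a l IH]; intros H.
  - exists 0%nat. intros x [].
  - destruct IH as [i Hi]; [intros; apply H; now right|].
    destruct (H a) as [j Hj]; [now left|]. exists (Nat.max i j). intros x [<-|Hx].
    + apply (Hm a j); auto; lia.
    + apply (Hm x i); auto; lia.
Qed.

Section Content.
Variables (H : Z -> R) (j0 : Z).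
Hypothesis H_pos : forall j, (j0 <= j)%Z -> 0 < H j.
Variable lam : nat -> option (Z * Z).

Definition cost (l : Z * Z) (n : nat) : R :=
  match lam n with Some m => if incb m l then H (fst m) else 0 | None => 0 end.

Definition covered (l : Z * Z) : Prop := exists n m, lam n = Some m /\ inc l m.

(** The invariant of the descent. A point common to light intervals of unbounded generation is
    missed by [lam], since a member containing it would contain one of these intervals. *)
Definition light (th : R) (l : Z * Z) : Prop :=
  ~ covered l /\ forall M, rsum (cost l) M < th * H (fst l).

(* If every cube of [ms] were covered or heavy, then charging to each of them either its own
   cost or an equal share [A] of the piece containing it would exceed the cost inside [l]. *)
Lemma pigeon l ms g A A' tau : (j0 <= fst l)%Z -> NoDup ms ->
  (forall m, In m ms -> fst m = g /\ inc m l) -> 0 <= A' <= A -> A' <= tau * H g ->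
  (forall l', inc l' l -> cnt ms l' * A <= H (fst l')) ->
  ~ covered l -> (forall M, rsum (cost l) M < INR (length ms) * A') ->
  exists m, In m ms /\ light tau m.
Proof.
  intros Hl Hd Hms HA Htau Hreg Hcov Hlt. apply NNPP. intros Hno.
  set (share := fun m n => match lam n with
    | Some m' => if incb m' m then H (fst m') else if incb m m' then if incb m' l then A else 0 else 0
    | None => 0 end).
  assert (S0 : forall m n, In m ms -> 0 <= share m n).
  { intros m n Hm. unfold share. destruct (lam n) as [m'|]; [|lra].
    destruct (Hms m Hm) as [_ Hml].
    destruct (incb m' m) eqn:E.
    - apply incb_true in E. left. apply H_pos. destruct E, Hml. lia.
    - destruct (incb m m'), (incb m' l); lra. }
  assert (Sle : forall n, lsum (fun m => share m n) ms <= cost l n).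
  { intros n. unfold share, cost. destruct (lam n) as [m'|]; [|rewrite lsum_const; lra].
    destruct (classic (exists m1, In m1 ms /\ inc m' m1)) as [[m1 [Hm1 Hi]]|Hn].
    - rewrite (lsum_single _ ms m1); auto.
      + assert (E : incb m' m1 = true) by now apply incb_true. rewrite E.
        assert (E' : incb m' l = true).
        { apply incb_true. apply inc_trans with m1; auto. apply Hms; auto. }
        rewrite E'. lra.
      + intros m Hm Hne. destruct (Hms m Hm) as [g1 _], (Hms m1 Hm1) as [g2 _].
        destruct (incb m' m) eqn:E.
        { exfalso. apply Hne. apply incb_true in E. apply inc_eq; [|lia].
          apply inc_common with m'; auto. lia. }
        destruct (incb m m') eqn:E'; auto. exfalso. apply Hne. apply incb_true in E'.
        apply inc_eq; [|lia]. apply inc_trans with m'; auto.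
    - destruct (incb m' l) eqn:E.
      + apply incb_true in E. eapply Rle_trans; [|apply (Hreg m' E)]. unfold cnt.
        rewrite <- lsum_const, <- lsum_filter. apply lsum_le. intros m Hm.
        destruct (incb m' m) eqn:E'.
        { exfalso. apply Hn. exists m. split; auto. now apply incb_true. }
        lra.
      + rewrite (lsum_ext _ (fun _ => 0)), lsum_const; [lra|]. intros m Hm.
        destruct (incb m' m) eqn:E'.
        { exfalso. apply Hn. exists m. split; auto. now apply incb_true. }
        destruct (incb m m'); auto. }
  assert (Hone : forall m, In m ms -> exists M, A' <= rsum (share m) M).
  { intros m Hm. destruct (Hms m Hm) as [Hg Hml].
    destruct (classic (covered m)) as [[n [m' [En Hi]]]|Hc].
    - exists (S n). simpl. assert (0 <= rsum (share m) n).
      { assert (Hs : rsum (fun _ => 0) n <= rsum (share m) n) by (apply rsum_le; auto).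
        rewrite rsum_zero in Hs. exact Hs. }
      assert (A' <= share m n); [|lra].
      assert (Hi' : inc m' l).
      { destruct (Z_le_dec (fst l) (fst m')); [apply inc_common with m; auto|].
        exfalso. apply Hcov. exists n, m'. split; auto. apply inc_common with m; auto. lia. }
      unfold share. rewrite En. destruct (incb m' m) eqn:E.
      + apply incb_true in E. assert (m' = m).
        { symmetry. apply inc_eq; auto. destruct E, Hi. lia. }
        subst m'. specialize (Hreg m Hml).
        assert (1 <= cnt ms m).
        { unfold cnt. apply (le_INR 1).
          assert (In m (filter (fun m0 => incb m0 m) ms)).
          { apply filter_In. split; auto. apply incb_true, inc_refl. }
          destruct (filter (fun m0 => incb m0 m) ms); [easy|simpl; lia]. }
        nra.
      + apply incb_true in Hi. rewrite Hi. apply incb_true in Hi'. rewrite Hi'. lra.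
    - apply NNPP. intros Hn. apply Hno. exists m. split; auto. split; auto.
      intros M. apply Rnot_le_lt. intros h. apply Hn. exists M.
      apply Rle_trans with (rsum (cost m) M); [rewrite Hg in h; lra|].
      apply rsum_le. intros n _. unfold cost, share. destruct (lam n) as [m'|]; [|lra].
      destruct (incb m' m); [lra|]. destruct (incb m m'), (incb m' l); lra. }
  destruct (common_bound ms (fun m M => In m ms -> A' <= rsum (share m) M)) as [M HM].
  { intros m i j Hij Hi Hm. specialize (Hi Hm).
    assert (rsum (share m) i <= rsum (share m) j); [|lra].
    clear Hi. induction Hij; [lra|]. simpl. specialize (S0 m m0 Hm). lra. }
  { intros m Hm. destruct (Hone m Hm) as [M HM]. now exists M. }
  specialize (Hlt M).
  assert (INR (length ms) * A' <= rsum (cost l) M); [|lra].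
  rewrite <- lsum_const.
  apply Rle_trans with (lsum (fun m => rsum (share m) M) ms).
  - apply lsum_le. auto.
  - rewrite lsum_rsum. apply rsum_le. auto.
Qed.

Section Nested.
Variables (W : nat -> R -> Prop) (th : R).
Hypothesis step : forall i l, (j0 <= fst l)%Z -> light th l -> exists m, (fst l < fst m)%Z /\ light th m /\
  forall y, IZR (snd m) * len (fst m) <= y <= (IZR (snd m) + 1) * len (fst m) -> W i y /\ dset l y.

(** The hypothesis [step] concerns the closed hull of the new interval, so the supremum of the left
    endpoints lies in every interval chosen and in every [W i]. *)
Lemma nested_point l : (j0 <= fst l)%Z -> light th l ->
  exists y, dset l y /\ (forall i, W i y) /\ forall n m, lam n = Some m -> ~ dset m y.
Proof.
  intros Hl Hlight.
  set (good := fun i l m => (fst l < fst m)%Z /\ light th m /\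
    forall y, IZR (snd m) * len (fst m) <= y <= (IZR (snd m) + 1) * len (fst m) -> W i y /\ dset l y).
  set (next := fun i l => epsilon (inhabits l) (good i l)).
  set (s := fix s (i : nat) : Z * Z := match i with 0%nat => l | S i => next i (s i) end).
  assert (Hs : forall i, (fst l + Z.of_nat i <= fst (s i))%Z /\ light th (s i)).
  { induction i as [|i [IH1 IH2]]; [split; [simpl; lia|exact Hlight]|].
    assert (G : good i (s i) (s (S i))).
    { apply epsilon_spec. apply step; auto. lia. }
    destruct G as [G1 [G2 _]]. split; auto. lia. }
  assert (G : forall i, good i (s i) (s (S i))).
  { intros i. destruct (Hs i). apply epsilon_spec. apply step; auto. lia. }
  set (left := fun i => IZR (snd (s i)) * len (fst (s i))).
  set (right := fun i => (IZR (snd (s i)) + 1) * len (fst (s i))).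
  assert (Hlr : forall i, left i <= left (S i) /\ right (S i) <= right i /\ left i <= right i).
  { intros i. assert (Hle : forall i, left i <= right i).
    { intros k. unfold left, right. generalize (len_pos (fst (s k))). lra. }
    destruct (G i) as [_ [_ G3]].
    assert (D1 : dset (s i) (left (S i))) by (apply G3; split; [right; reflexivity|apply Hle]).
    assert (D2 : dset (s i) (right (S i))) by (apply G3; split; [apply Hle|right; reflexivity]).
    unfold dset, dyadic in D1, D2. fold (len (fst (s i))) in D1, D2.
    fold (left i) in D1, D2. fold (right i) in D1, D2. split; [lra|]. split; [lra|apply Hle]. }
  assert (Hmono : forall i j, (i <= j)%nat -> left i <= left j /\ right j <= right i).
  { intros i j Hij. induction Hij; [lra|]. specialize (Hlr m). lra. }
  assert (Hcross : forall i j, left i <= right j).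
  { intros i j. destruct (Hmono i (Nat.max i j)) as [h1 _]; [lia|].
    destruct (Hmono j (Nat.max i j)) as [_ h2]; [lia|]. specialize (Hlr (Nat.max i j)). lra. }
  destruct (completeness (fun x => exists i, x = left i)) as [y [Hy1 Hy2]].
  { exists (right 0%nat). intros x [i ->]. apply Hcross. }
  { exists (left 0%nat). now exists 0%nat. }
  assert (Hy : forall i, left i <= y <= right i).
  { intros i. split; [apply Hy1; now exists i|]. apply Hy2. intros x [k ->]. apply Hcross. }
  assert (HD : forall i, W i y /\ dset (s i) y).
  { intros i. apply (proj2 (proj2 (G i))). apply Hy. }
  exists y. split; [apply (HD 0%nat)|]. split; [intros; apply HD|].
  intros n m En Hm.
  set (i := Z.to_nat (fst m - fst l)).
  destruct (Hs i) as [h1 [h2 _]]. apply h2. exists n, m. split; auto.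
  apply (inter_inc _ _ y); auto; [apply HD|]. lia.
Qed.

Definition heavy (l : Z * Z) : Prop := (j0 <= fst l)%Z /\ exists M, th * H (fst l) <= rsum (cost l) M.

(** Maximal heavy intervals. They exist above every heavy interval because generations of heavy
    intervals are bounded below by [j0]. *)
Definition top (l : Z * Z) : Prop := heavy l /\ forall l', heavy l' -> inc l l' -> l' = l.

Lemma heavy_top l : heavy l -> exists l', top l' /\ inc l l'.
Proof.
  remember (Z.to_nat (fst l - j0)) as n eqn:En. revert l En.
  induction n as [n IH] using (well_founded_induction lt_wf). intros l En Hh.
  destruct (classic (top l)) as [Ht|Ht]; [exists l; split; auto; apply inc_refl|].
  assert (exists l', heavy l' /\ inc l l' /\ l' <> l) as [l' [h1 [h2 h3]]].
  { apply NNPP. intros Hn. apply Ht. split; auto. intros l' h1 h2. apply NNPP. intros h3. apply Hn. now exists l'. }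
  assert (fst l' < fst l)%Z.
  { destruct (Z.eq_dec (fst l) (fst l')) as [e|e]; [|destruct h2; lia].
    exfalso. apply h3. symmetry. now apply inc_eq. }
  destruct (IH (Z.to_nat (fst l' - j0))) with (l := l') as [l'' [h4 h5]]; auto.
  - destruct h1, Hh. lia.
  - exists l''. split; auto. apply inc_trans with l'; auto.
Qed.

Lemma top_unique m l l' : inc m l -> inc m l' -> top l -> top l' -> l = l'.
Proof.
  intros h1 h2 [t1 u1] [t2 u2]. destruct (Z_le_dec (fst l') (fst l)).
  - symmetry. apply u1; auto. apply inc_common with m; auto.
  - apply u2; auto. apply inc_common with m; auto. lia.
Qed.

Definition top_of (n : nat) : option (Z * Z) :=
  match lam n with
  | Some m => match excluded_middle_informative (exists l, top l /\ inc m l) with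
              | left p => Some (proj1_sig (constructive_indefinite_description _ p))
              | right _ => None end
  | None => None end.

Lemma top_of_Some n l : top_of n = Some l -> exists m, lam n = Some m /\ top l /\ inc m l.
Proof.
  unfold top_of. destruct (lam n) as [m|]; [|discriminate].
  destruct excluded_middle_informative as [p|p]; [|discriminate].
  destruct constructive_indefinite_description as [l' [h1 h2]]. simpl. intros E. inversion E; subst.
  now exists m.
Qed.

Lemma top_of_complete n m l : lam n = Some m -> top l -> inc m l -> top_of n = Some l.
Proof.
  intros En Ht Hi. unfold top_of. rewrite En. destruct excluded_middle_informative as [p|p].
  - destruct constructive_indefinite_description as [l' [h1 h2]]. simpl. f_equal. now apply top_unique with m.
  - exfalso. apply p. now exists l.
Qed.

Definition first_index (n k : nat) : Prop := top_of k = top_of n /\ forall k', top_of k' = top_of n -> (k <= k')%nat.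

(** The least index among the members lying in the same top interval; it is the one at which this
    interval is entered in the new family, so that it is paid only once. *)
Definition own (n : nat) : nat :=
  match top_of n with Some _ => epsilon (inhabits n) (first_index n) | None => n end.

Lemma own_spec n l : top_of n = Some l -> first_index n (own n).
Proof.
  intros E. unfold own. rewrite E. apply epsilon_spec.
  destruct (dec_inh_nat_subset_has_unique_least_element (fun k => top_of k = top_of n)) as [k [[h1 h2] _]].
  - intros k. apply classic.
  - now exists n.
  - exists k. split; auto.
Qed.

Lemma own_same n n' l : top_of n = Some l -> top_of n' = Some l -> own n = own n'.
Proof.
  intros E E'. destruct (own_spec _ _ E) as [a1 a2], (own_spec _ _ E') as [b1 b2].
  rewrite E in *. rewrite E' in *. apply Nat.le_antisymm; auto.
Qed.

Definition new_lam (n : nat) : option (Z * Z) :=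
  match top_of n with Some l => if Nat.eq_dec (own n) n then Some l else None | None => lam n end.

Definition new_cost (v : nat -> R) (n : nat) : R :=
  match top_of n with Some l => if Nat.eq_dec (own n) n then H (fst l) else 0 | None => v n end.

(** By heaviness a top interval costs at most [1 / th] times the members inside it, and distinct top
    intervals are charged to disjoint sets of members, namely the fibres of [own]. *)
Lemma new_cost_sum v S : 0 < th <= 1 -> (forall n, 0 <= v n) ->
  (forall n m, lam n = Some m -> (j0 <= fst m)%Z -> v n = H (fst m)) ->
  (forall M, rsum v M <= S) -> forall M, rsum (new_cost v) M <= S / th.
Proof.
  intros Hth Hv HvH HS N.
  set (c := fun n n' => if Nat.eq_dec (own n') n then v n' else 0).
  assert (c0 : forall n n', 0 <= c n n') by (intros; unfold c; destruct Nat.eq_dec; auto; lra).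
  assert (Hone : forall n, exists M, th * new_cost v n <= rsum (c n) M).
  { intros n. unfold new_cost. destruct (top_of n) as [l|] eqn:E.
    - destruct (Nat.eq_dec (own n) n) as [e|e]; [|exists 0%nat; simpl; lra].
      destruct (top_of_Some _ _ E) as [m [Em [[[hl [M hM]] hu] Hi]]].
      exists M. eapply Rle_trans; [exact hM|]. apply rsum_le. intros n' _. unfold cost, c.
      destruct (lam n') as [m'|] eqn:E'; [|destruct Nat.eq_dec; auto; lra].
      destruct (incb m' l) eqn:Ei; [|destruct Nat.eq_dec; auto; lra].
      apply incb_true in Ei.
      assert (T' : top_of n' = Some l).
      { apply top_of_complete with m'; auto. split; auto. split; auto. now exists M. }
      rewrite (own_same n' n l), e by auto. destruct Nat.eq_dec; [|easy].
      rewrite (HvH n' m'); auto; [lra|]. destruct Ei. lia.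
    - exists (Datatypes.S n). simpl. assert (0 <= rsum (c n) n) by (apply rsum_nonneg; auto).
      assert (c n n = v n); [|specialize (Hv n); nra].
      unfold c, own. rewrite E. destruct Nat.eq_dec; easy. }
  destruct (common_bound (seq 0 N) (fun n M => th * new_cost v n <= rsum (c n) M)) as [M HM].
  { intros n i j Hij Hi. eapply Rle_trans; [exact Hi|]. now apply rsum_mono. }
  { intros; apply Hone. }
  assert (th * rsum (new_cost v) N <= S).
  { rewrite <- rsum_scal. apply Rle_trans with (rsum (fun n => rsum (c n) M) N).
    - apply rsum_le. intros n Hn. apply HM. apply in_seq. lia.
    - rewrite rsum_swap. eapply Rle_trans; [|apply (HS M)]. apply rsum_le. intros n' _.
      assert (forall K, rsum (fun n => c n n') K <= v n' /\ ((K <= own n')%nat -> rsum (fun n => c n n') K = 0)) as HK.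
      { induction K as [|K [IH1 IH2]]; [split; [apply Hv|auto]|]. cbn [rsum]. unfold c at 2 4.
        destruct Nat.eq_dec as [e|e].
        - rewrite IH2 by lia. split; [lra|lia].
        - split; [lra|]. intros. rewrite IH2 by lia. lra. }
      apply HK. }
  apply Rmult_le_reg_l with th; [lra|]. replace (th * (S / th)) with S by (field; lra). exact H0.
Qed.

(** A point of [V] outside all members of [lam] lies in a small dyadic interval contained in [V] and
    in no member. It is not light, since [nested_point] would then contradict the covering
    hypothesis; so it is heavy and lies in a top interval. That interval contains a member, by
    positivity of its cost, and therefore appears in [new_lam]. *)
Lemma new_cover (V : R -> Prop) : 0 < th -> open_set V ->
  (forall x, (forall i, W i x) -> V x -> exists n m, lam n = Some m /\ dset m x) ->
  forall x, V x -> exists n m, new_lam n = Some m /\ dset m x.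
Proof.
  intros Hth HV Hcov x Vx.
  assert (Htop : forall l n, top l -> top_of n = Some l -> dset l x -> exists n m, new_lam n = Some m /\ dset m x).
  { intros l n Ht E Hx. destruct (own_spec _ _ E) as [h1 h2]. exists (own n), l. split; auto.
    unfold new_lam. rewrite h1, E. rewrite E in h1. rewrite (own_same (own n) n l) by auto.
    destruct Nat.eq_dec; easy. }
  destruct (classic (exists n m, lam n = Some m /\ dset m x)) as [[n [m [En Hm]]]|Hn].
  - destruct (top_of n) as [l|] eqn:E.
    + destruct (top_of_Some _ _ E) as [m' [E' [Ht Hi]]]. rewrite En in E'. inversion E'; subst.
      apply (Htop l n); auto. now apply inc_sub with m'.
    + exists n, m. split; auto. unfold new_lam. now rewrite E.
  - destruct (HV x Vx) as [e [He HVe]].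
    destruct (len_small e He) as [j1 Hj1].
    destruct (dyadic_ex (Z.max j0 j1) x) as [k Hk].
    set (l := (Z.max j0 j1, k)).
    assert (Hxl : dset l x) by exact Hk.
    assert (HlV : forall y, dset l y -> V y).
    { intros y Hy. apply HVe. unfold dset, dyadic in *. simpl in *. fold (len (Z.max j0 j1)) in *.
      specialize (Hj1 (Z.max j0 j1) ltac:(lia)). apply Rabs_def1; lra. }
    assert (Hh : heavy l).
    { apply NNPP. intros Hh. destruct (nested_point l) as [y [h1 [h2 h3]]].
      - simpl. lia.
      - split.
        + intros [n [m [En Hi]]]. apply Hn. exists n, m. split; auto. now apply inc_sub with l.
        + intros M. apply Rnot_le_lt. intros h. apply Hh. split; [simpl; lia|]. now exists M.
      - destruct (Hcov y h2 (HlV y h1)) as [n [m [En Hm]]]. now apply (h3 n m). }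
    destruct (heavy_top l Hh) as [l' [Ht Hi]].
    destruct Ht as [[Hj [M HM]] Hu].
    assert (exists n m, lam n = Some m /\ inc m l') as [n [m [En Hm]]].
    { apply NNPP. intros Hno. assert (rsum (cost l') M = 0).
      { rewrite <- (rsum_zero M). apply rsum_ext. intros n _. unfold cost.
        destruct (lam n) as [m|] eqn:E; auto. destruct (incb m l') eqn:Ei; auto.
        exfalso. apply Hno. exists n, m. split; auto. now apply incb_true. }
      specialize (H_pos _ Hj). nra. }
    assert (Ht : top l') by (split; auto; split; auto; now exists M).
    apply (Htop l' n); auto.
    + now apply top_of_complete with m.
    + now apply inc_sub with l.
Qed.

End Nested.
End Content.

(** * The approximation step *)

Lemma Rpower_pos x t : 0 < Rpower x t.
Proof. apply exp_pos. Qed.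

Lemma Rpower_small t e : 0 < t -> 0 < e -> exists d, 0 < d /\ forall x, 0 < x <= d -> Rpower x t <= e.
Proof.
  intros Ht He. exists (Rpower e (/ t)). split; [apply Rpower_pos|]. intros x Hx.
  apply Rle_trans with (Rpower (Rpower e (/ t)) t).
  - apply Rle_Rpower_l; lra.
  - rewrite Rpower_mult, Rinv_l, Rpower_1; lra.
Qed.

Lemma Rpower_anti c x y : 0 <= c -> 0 < x <= y -> Rpower y (- c) <= Rpower x (- c).
Proof.
  intros Hc Hx. rewrite !Rpower_Ropp. apply Rinv_le_contravar; [apply Rpower_pos|].
  now apply Rle_Rpower_l.
Qed.

(* Since [y <> a], letting [N] grow produces infinitely many [a]. *)
Definition near_alg (w : R) (n N : nat) (y : R) : Prop :=
  exists a h, alg_deg_le (S n) a /\ height a h /\ 0 < Rabs (y - a) /\ Rabs (y - a) < / INR (S N) /\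
    Rabs (y - a) < Rpower (IZR h) (- (INR (S n) * w) - 1).

Lemma cnt_map_le (f b : nat -> Z * Z) (l : list nat) (l' : Z * Z) :
  (forall i, In i l -> inc (f i) l' -> inc (b i) l') -> cnt (map f l) l' <= cnt (map b l) l'.
Proof.
  intros H. unfold cnt. apply le_INR. induction l as [|i l IH]; simpl; auto.
  assert (IH' : (length (filter (fun m => incb m l') (map f l)) <= length (filter (fun m => incb m l') (map b l)))%nat).
  { apply IH. intros; apply H; auto. now right. }
  destruct (incb (f i) l') eqn:E.
  - apply incb_true in E. apply H in E; [|now left]. apply incb_true in E. rewrite E. simpl. lia.
  - destruct (incb (b i) l'); simpl; lia.
Qed.

Lemma cnt_le_1 ms l : NoDup ms -> (forall m m', In m ms -> In m' ms -> inc m l -> inc m' l -> m = m') -> cnt ms l <= 1.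
Proof.
  intros Hd H. unfold cnt. apply (le_INR _ 1).
  assert (Hd' := NoDup_filter (fun m => incb m l) Hd).
  destruct (filter (fun m => incb m l) ms) as [|m1 [|m2 r]] eqn:E; simpl; auto.
  exfalso. assert (I1 : In m1 (filter (fun m => incb m l) ms)) by (rewrite E; simpl; auto).
  assert (I2 : In m2 (filter (fun m => incb m l) ms)) by (rewrite E; simpl; auto).
  apply filter_In in I1, I2. destruct I1 as [a1 a2], I2 as [b1 b2].
  apply incb_true in a2, b2. inversion Hd'; subst. apply H2. left. symmetry. auto.
Qed.

Lemma count_filter (p : nat -> bool) c m :
  rsum (fun i => if p i then c else 0) m = c * INR (length (filter p (seq 0 m))).
Proof.
  induction m as [|m IH]; [simpl; lra|]. rewrite seq_S, filter_app, length_app, plus_INR. cbn [rsum].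
  rewrite IH. simpl. destruct (p m); simpl; lra.
Qed.

Lemma length_filter_negb {T} (p : T -> bool) l :
  (length (filter p l) + length (filter (fun x => negb (p x)) l) = length l)%nat.
Proof. induction l; simpl; auto. destruct (p a); simpl; lia. Qed.

Section Step.
Variables (H : Z -> R) (j0 : Z) (w : R).
Hypothesis w_gt1 : 1 < w.
Hypothesis H_pos : forall j, (j0 <= j)%Z -> 0 < H j.
Hypothesis H_anti : forall i j, (j0 <= i)%Z -> (i <= j)%Z -> H j <= H i.
Hypothesis H_ratio : forall i j, (j0 <= i)%Z -> (i <= j)%Z -> H i / len i <= H j / len j.
Hypothesis H_infty : forall M, exists J, forall j, (J <= j)%Z -> M <= H j / len j.
Hypothesis H_freq : forall s, / w < s -> exists eta, 0 < eta /\
  forall J, exists g, (J <= g)%Z /\ eta * Rpower (len g) s <= H g.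
Variables (lam : nat -> option (Z * Z)) (th : R).
Hypothesis th_range : 0 < th <= 1.

Lemma pow2_IZR d : IZR (2 ^ Z.of_nat d) = 2 ^ d.
Proof. rewrite pow_IZR. reflexivity. Qed.

(** The value of an interval of generation [i] may be spread evenly over its descendants [d]
    generations below without overloading any intermediate interval; this is the monotonicity of
    [H j / len j]. *)
Lemma share_le i j d : (j0 <= i)%Z -> (i <= j)%Z -> (j <= i + Z.of_nat d)%Z ->
  IZR (2 ^ (i + Z.of_nat d - j)) * (H i / 2 ^ d) <= H j.
Proof.
  intros h0 h1 h2. assert (h := H_ratio i j h0 h1).
  assert (e : len i * IZR (2 ^ (i + Z.of_nat d - j)) = len j * 2 ^ d).
  { assert (e1 := len_split i (i + Z.of_nat d) ltac:(lia)). assert (e2 := len_split j (i + Z.of_nat d) ltac:(lia)).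
    replace (i + Z.of_nat d - i)%Z with (Z.of_nat d) in e1 by lia. rewrite pow2_IZR in e1. rewrite e1, e2. lra. }
  generalize (len_pos i) (len_pos j). intros Hi Hj.
  assert (P : 0 < 2 ^ d) by (apply pow_lt; lra).
  assert (e' : IZR (2 ^ (i + Z.of_nat d - j)) = len j * 2 ^ d / len i) by (rewrite <- e; field; lra).
  rewrite e'. apply Rmult_le_reg_r with (/ len j); [now apply Rinv_0_lt_compat|].
  replace (len j * 2 ^ d / len i * (H i / 2 ^ d) * / len j) with (H i / len i) by (field; lra). exact h.
Qed.

(** Even spreading over all descendants at a depth where, [H j / len j] being unbounded, each is
    worth at least twice its share. The factor 2 gained is spent in [light_step], where up to half
    of the blocks are lost. *)
Lemma light_refine l : (j0 <= fst l)%Z -> light H lam th l ->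
  exists m, inc m l /\ light H lam (th / 2) m.
Proof.
  intros Hl [Hc HM].
  destruct (H_infty (2 * (H (fst l) / len (fst l)))) as [J HJ].
  set (d := Z.to_nat (J - fst l)).
  specialize (HJ (fst l + Z.of_nat d)%Z ltac:(lia)).
  assert (P : 0 < 2 ^ d) by (apply pow_lt; lra).
  assert (Hp := H_pos _ Hl).
  assert (A0 : 0 < H (fst l) / 2 ^ d) by (apply Rdiv_lt_0_compat; auto).
  assert (e : len (fst l) = 2 ^ d * len (fst l + Z.of_nat d)).
  { rewrite (len_split (fst l) (fst l + Z.of_nat d)) by lia.
    replace (fst l + Z.of_nat d - fst l)%Z with (Z.of_nat d) by lia. now rewrite pow2_IZR. }
  destruct (pigeon H j0 H_pos lam l (desc l d) (fst l + Z.of_nat d) (H (fst l) / 2 ^ d) (th * (H (fst l) / 2 ^ d)) (th / 2))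
    as [m [Hm1 Hm2]]; auto.
  - apply NoDup_desc.
  - intros m Hm. apply in_desc in Hm. tauto.
  - nra.
  - assert (2 * (H (fst l) / 2 ^ d) <= H (fst l + Z.of_nat d)); [|nra].
    generalize (len_pos (fst l + Z.of_nat d)). intros Hq. rewrite e in HJ.
    apply Rmult_le_reg_r with (/ len (fst l + Z.of_nat d)); [now apply Rinv_0_lt_compat|].
    replace (2 * (H (fst l) / 2 ^ d) * / len (fst l + Z.of_nat d)) with
      (2 * (H (fst l) / (2 ^ d * len (fst l + Z.of_nat d)))) by (field; lra). exact HJ.
  - intros l' Hi. destruct (Z_le_dec (fst l') (fst l + Z.of_nat d)).
    + assert (Hcnt := cnt_le (desc l d) (fst l + Z.of_nat d) l' (NoDup_desc l d)
        ltac:(intros m Hm; apply in_desc in Hm; tauto) l0).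
      eapply Rle_trans; [apply Rmult_le_compat_r; [lra|exact Hcnt]|].
      apply share_le; auto. apply Hi.
    + rewrite (cnt_zero _ (fst l + Z.of_nat d)); [|intros m Hm; apply in_desc in Hm; tauto|lia].
      assert (0 < H (fst l')); [|lra]. apply H_pos. destruct Hi. lia.
  - intros M. rewrite length_desc, INR_IZR_INZ, pow2_Z, pow2_IZR.
    replace (2 ^ d * (th * (H (fst l) / 2 ^ d))) with (th * H (fst l)) by (field; lra). apply HM.
  - exists m. split; auto. apply in_desc in Hm1. tauto.
Qed.

(* The scale: all algebraic numbers of height at most [Lam Q] carry intervals of length at
   least [len g], and they are spread out at scale about [K / Q^(n+2)]. *)
Lemma scale_choice (n N : nat) (j : Z) (Lam K Q0 : R) : (j0 <= j)%Z -> 1 <= Lam -> 0 < K ->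
  exists g q Q, (j + Z.of_nat q <= g)%Z /\ Q0 <= Q /\ 0 < Q /\
    8 * (K / Q ^ S (S n)) <= len (j + Z.of_nat q) /\
    8 * len g <= len (j + Z.of_nat q) /\ len g < / INR (S N) /\
    H j / 2 ^ q <= H (g + 2)%Z /\
    forall y, 0 < y <= Lam * Q -> len g <= Rpower y (- (INR (S n) * w) - 1).
Proof.
  intros Hj HLam HK.
  set (kap := INR (S n) * w + 1). set (bet := INR (S (S n)) / kap).
  assert (Hn : 1 <= INR (S n)) by (rewrite S_INR; generalize (pos_INR n); lra).
  assert (Hkap : 0 < kap) by (unfold kap; nra).
  assert (Hn2 : INR (S (S n)) = INR (S n) + 1) by (apply S_INR).
  assert (Hw : 0 < / w) by (apply Rinv_0_lt_compat; lra).
  assert (Hb1 : / w < bet).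
  { unfold bet. apply Rmult_lt_reg_r with (w * kap); [nra|].
    replace (/ w * (w * kap)) with kap by (field; lra).
    replace (INR (S (S n)) / kap * (w * kap)) with (INR (S (S n)) * w) by (field; lra).
    unfold kap. rewrite Hn2. lra. }
  assert (Hb2 : bet < 1).
  { unfold bet. apply Rmult_lt_reg_r with kap; auto.
    replace (INR (S (S n)) / kap * kap) with (INR (S (S n))) by (field; lra). unfold kap. rewrite Hn2. nra. }
  (* An exponent [s] strictly between [1/w] and [bet] leaves a positive power [x^(bet - s)], which
     beats all the constants once [x] is small. *)
  destruct (H_freq ((/ w + bet) / 2)) as [eta [Heta Hfreq]]; [lra|].
  set (s := (/ w + bet) / 2) in *.
  set (K' := K * Lam ^ S (S n)).
  assert (HLn : 0 < Lam ^ S (S n)) by (apply pow_lt; lra).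
  assert (HK' : 0 < K') by (unfold K'; nra).
  assert (Hlj := len_pos j). assert (HHj := H_pos j Hj).
  destruct (Rpower_small (/ kap) (/ (Lam * (Rabs Q0 + 1)))) as [d1 [D1 E1]].
  { now apply Rinv_0_lt_compat. }
  { apply Rinv_0_lt_compat. generalize (Rabs_pos Q0). nra. }
  destruct (Rpower_small bet (len j / (16 * K'))) as [d2 [D2 E2]]; [lra|apply Rdiv_lt_0_compat; lra|].
  destruct (Rpower_small (1 - bet) K') as [d3 [D3 E3]]; [lra|lra|].
  destruct (Rpower_small (bet - s) (eta * len j / (64 * H j * K'))) as [d4 [D4 E4]].
  { unfold s. lra. }
  { apply Rdiv_lt_0_compat; nra. }
  assert (HN : 0 < / INR (S N)) by (apply Rinv_0_lt_compat, lt_0_INR; lia).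
  set (d := Rmin (Rmin d1 d2) (Rmin (Rmin d3 d4) (/ INR (S N)))).
  assert (Hd : 0 < d) by (unfold d; repeat apply Rmin_glb_lt; auto).
  destruct (len_small d Hd) as [J HJ].
  destruct (Hfreq (Z.max J j0)) as [g [Hg Hgs]].
  specialize (HJ g ltac:(lia)). set (x := len g) in *.
  assert (Hx : 0 < x) by apply len_pos.
  assert (Hmin : x <= d1 /\ x <= d2 /\ x <= d3 /\ x <= d4 /\ x < / INR (S N)).
  { unfold d in HJ.
    generalize (Rmin_l (Rmin d1 d2) (Rmin (Rmin d3 d4) (/ INR (S N)))) (Rmin_r (Rmin d1 d2) (Rmin (Rmin d3 d4) (/ INR (S N))))
      (Rmin_l d1 d2) (Rmin_r d1 d2) (Rmin_l (Rmin d3 d4) (/ INR (S N))) (Rmin_r (Rmin d3 d4) (/ INR (S N)))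
      (Rmin_l d3 d4) (Rmin_r d3 d4). lra. }
  destruct Hmin as [M1 [M2 [M3 [M4 M5]]]].
  specialize (E1 x (conj Hx M1)). specialize (E2 x (conj Hx M2)). specialize (E3 x (conj Hx M3)). specialize (E4 x (conj Hx M4)).
  set (Q := / Lam * Rpower x (- / kap)).
  assert (HQ : 0 < Q) by (unfold Q; apply Rmult_lt_0_compat; [apply Rinv_0_lt_compat; lra|apply Rpower_pos]).
  assert (HLQ : Lam * Q = Rpower x (- / kap)) by (unfold Q; field; lra).
  set (E := K / Q ^ S (S n)).
  assert (HE : E = K' * Rpower x bet).
  { unfold E, K', Q. rewrite Rpow_mult_distr, pow_inv.
    rewrite <- (Rpower_pow (S (S n)) (Rpower x (- / kap))) by apply Rpower_pos.
    rewrite Rpower_mult. replace (- / kap * INR (S (S n))) with (- bet) by (unfold bet; field; lra).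
    rewrite Rpower_Ropp. assert (Hp := Rpower_pos x bet). field. split; lra. }
  assert (HEp : 0 < E) by (rewrite HE; apply Rmult_lt_0_compat; [auto|apply Rpower_pos]).
  (* Generation [b - 1] then has length between [8 E] and [16 E]; it is the generation of the
     blocks. *)
  destruct (len_bracket (8 * E)) as [b [Hb3 Hb4]]; [lra|].
  assert (Hlb : len (b - 1) = 2 * len b) by (rewrite len_succ; f_equal; f_equal; lia).
  assert (H16 : 16 * E <= len j).
  { rewrite HE. apply Rmult_le_reg_r with (/ (16 * K')); [apply Rinv_0_lt_compat; lra|].
    replace (16 * (K' * Rpower x bet) * / (16 * K')) with (Rpower x bet) by (field; lra). exact E2. }
  assert (Hxle : x <= E).
  { rewrite HE. replace x with (Rpower x (1 - bet) * Rpower x bet) at 1.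
    - apply Rmult_le_compat_r; auto. left. apply Rpower_pos.
    - rewrite <- Rpower_plus. replace (1 - bet + bet) with 1 by lra. now apply Rpower_1. }
  assert (Hbj : (j <= b - 1)%Z).
  { destruct (Z_le_dec j (b - 1)); auto. exfalso.
    assert (len (j - 1) <= len (b - 1)) by (apply len_le; lia).
    assert (len (j - 1) = 2 * len j) by (rewrite len_succ; f_equal; f_equal; lia). lra. }
  assert (Hq : (j + Z.of_nat (Z.to_nat (b - 1 - j)) = b - 1)%Z) by lia.
  exists g, (Z.to_nat (b - 1 - j)), Q. rewrite Hq. fold E x.
  split.
  { destruct (Z_le_dec (b - 1) g); auto. exfalso.
    assert (len (b - 1) <= len g) by (apply len_le; lia). fold x in H0. lra. }
  split.
  { apply Rmult_le_reg_l with Lam; [lra|]. rewrite HLQ, Rpower_Ropp.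
    apply Rle_trans with (Lam * (Rabs Q0 + 1)).
    - apply Rmult_le_compat_l; [lra|]. generalize (RRle_abs Q0). lra.
    - rewrite <- (Rinv_inv (Lam * (Rabs Q0 + 1))). apply Rinv_le_contravar; auto. apply Rpower_pos. }
  split; [exact HQ|]. split; [lra|]. split; [lra|]. split; [exact M5|]. split.
  - assert (H2q : 2 ^ Z.to_nat (b - 1 - j) = len j / len (b - 1)).
    { assert (Hs := len_split j (b - 1) Hbj). rewrite <- (Z2Nat.id (b - 1 - j)), pow2_IZR in Hs by lia.
      rewrite Hs. assert (Hlp := len_pos (b - 1)). field. lra. }
    rewrite H2q.
    assert (Hg2 : H g / 4 <= H (g + 2)%Z).
    { assert (Hr := H_ratio g (g + 2) ltac:(lia) ltac:(lia)).
      assert (Hl : len g = 4 * len (g + 2)).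
      { rewrite (len_succ g), (len_succ (g + 1)). replace (g + 1 + 1)%Z with (g + 2)%Z by lia. lra. }
      assert (Hlp := len_pos (g + 2)). rewrite Hl in Hr.
      apply Rmult_le_reg_r with (/ len (g + 2)); [now apply Rinv_0_lt_compat|].
      replace (H g / 4 * / len (g + 2)) with (H g / (4 * len (g + 2))) by (field; lra). exact Hr. }
    apply Rle_trans with (eta * Rpower x s / 4); [|lra].
    assert (Hps := Rpower_pos x s).
    assert (Hxb : Rpower x bet = Rpower x (bet - s) * Rpower x s).
    { rewrite <- Rpower_plus. f_equal. lra. }
    apply Rle_trans with (H j * (16 * E) / len j).
    + unfold Rdiv. rewrite Rinv_mult, Rinv_inv, <- Rmult_assoc, (Rmult_comm (H j * / len j)).
      assert (0 < H j * / len j) by (apply Rmult_lt_0_compat; [auto|now apply Rinv_0_lt_compat]).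
      nra.
    + rewrite HE, Hxb. 
      apply Rmult_le_reg_r with (4 * len j / (64 * H j * K' * Rpower x s)).
      { apply Rdiv_lt_0_compat; [lra|]. assert (0 < 64 * H j) by lra. assert (0 < 64 * H j * K') by (apply Rmult_lt_0_compat; auto). apply Rmult_lt_0_compat; auto. }
      replace (H j * (16 * (K' * (Rpower x (bet - s) * Rpower x s))) / len j * (4 * len j / (64 * H j * K' * Rpower x s)))
        with (Rpower x (bet - s)) by (field; repeat split; lra).
      replace (eta * Rpower x s / 4 * (4 * len j / (64 * H j * K' * Rpower x s))) with (eta * len j / (64 * H j * K'))
        by (field; repeat split; lra). exact E4.
  - intros y Hy. rewrite HLQ in Hy.
    replace (- (INR (S n) * w) - 1) with (- kap) by (unfold kap; lra).
    apply Rle_trans with (Rpower (Rpower x (- / kap)) (- kap)).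
    + rewrite Rpower_mult. replace (- / kap * - kap) with 1 by (field; lra). rewrite Rpower_1; lra.
    + apply Rpower_anti; lra.
Qed.

(** At least half of the blocks have a point off the exceptional set in their middle half, hence an
    algebraic number close to it and, beside that number, an interval of generation [g + 2] still
    inside the block. One such interval per block, with share [H j / 2^q], suits [pigeon]: coarse
    intervals are controlled by the number of blocks they contain, finer ones contain at most one
    chosen interval, which [scale_choice] makes affordable. *)
Lemma light_step (n N : nat) l : (j0 <= fst l)%Z -> light H lam th l ->
  exists m, (fst l < fst m)%Z /\ light H lam th m /\
  forall y, IZR (snd m) * len (fst m) <= y <= (IZR (snd m) + 1) * len (fst m) -> near_alg w n N y /\ dset l y.
Proof.
  intros Hl Hlight. destruct (light_refine l Hl Hlight) as [[j k] [Hsl [Hcov HM]]].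
  assert (Hj : (j0 <= j)%Z) by (destruct Hsl as [e _]; simpl in e; lia).
  assert (Hlj : (fst l <= j)%Z) by (destruct Hsl as [e _]; simpl in e; lia).
  simpl fst in HM. assert (HL := len_pos j). set (L := len j) in *. set (u := IZR k * L).
  destruct (@regular_system_R n (Rabs u + L + 1)) as [Lam [K [HLam [HK HR]]]].
  { generalize (Rabs_pos u). lra. }
  destruct (HR u L) as [Q0 [_ HQ0]]; auto.
  { generalize (Rle_abs (- u)). rewrite Rabs_Ropp. lra. }
  { generalize (Rle_abs u). lra. }
  destruct (scale_choice n N j Lam K Q0) as [g [q [Q [G1 [G2 [G3 [G4 [G5 [G6 [G7 G8]]]]]]]]]]; auto.
  destruct (HQ0 Q G2) as [Z [HZ HZa]]. clear HR HQ0.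
  set (B := fun i => (j + Z.of_nat q, k * 2 ^ Z.of_nat q + Z.of_nat i)%Z).
  set (el := len (j + Z.of_nat q)) in *. assert (Hel : 0 < el) by apply len_pos.
  assert (P : 0 < 2 ^ q) by (apply pow_lt; lra).
  assert (EL : L = 2 ^ q * el).
  { unfold L, el. rewrite (len_split j (j + Z.of_nat q)) by lia.
    replace (j + Z.of_nat q - j)%Z with (Z.of_nat q) by lia. now rewrite pow2_IZR. }
  assert (EB : forall i, IZR (snd (B i)) * len (fst (B i)) = u + INR i * el).
  { intros i. unfold B, u. cbn [fst snd]. rewrite plus_IZR, mult_IZR, pow2_IZR, <- INR_IZR_INZ. fold el. rewrite EL. ring. }
  assert (HB : forall i, (i < 2 ^ q)%nat -> inc (B i) (j, k)).
  { intros i Hi. apply Nat2Z.inj_lt in Hi. rewrite pow2_Z in Hi. apply inc_of_range; unfold B; cbn [fst snd];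
      replace (j + Z.of_nat q - j)%Z with (Z.of_nat q) by lia; nia. }
  set (mid := fun i x => u + INR i * el + el / 4 <= x <= u + INR i * el + 3 * el / 4).
  set (bad := fun i => if excluded_middle_informative (forall x, mid i x -> Z x) then true else false).
  set (good := filter (fun i => negb (bad i)) (seq 0 (2 ^ q))).
  (* A bad block has its middle half, of length [el / 2], inside a set covered by total length
     [L / 4]. *)
  assert (Hgood : 2 ^ q / 2 <= INR (length good)).
  { assert (Hb := bad_blocks Z bad u el (L / 4) (2 ^ q) Hel HZ).
    rewrite count_filter in Hb.
    assert (Hs := length_filter_negb bad (seq 0 (2 ^ q))). fold good in Hs. rewrite length_seq in Hs.
    apply (f_equal INR) in Hs. rewrite plus_INR, pow_INR in Hs. simpl INR in Hs.
    assert (el / 2 * INR (length (filter bad (seq 0 (2 ^ q)))) <= L / 4).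
    { apply Hb. intros i x _ Hbi. unfold bad in Hbi. destruct excluded_middle_informative as [h|]; [|discriminate]. apply h. }
    replace (1 + 1) with 2 in Hs by lra. rewrite EL in H0.
    assert (INR (length (filter bad (seq 0 (2 ^ q)))) <= 2 ^ q / 2) by nra. lra. }
  assert (Hg0 : forall i, In i good -> (i < 2 ^ q)%nat /\ exists x, mid i x /\ ~ Z x).
  { intros i Hi. apply filter_In in Hi. destruct Hi as [h1 h2]. apply in_seq in h1. split; [lia|].
    unfold bad in h2. destruct excluded_middle_informative as [h|h]; [discriminate|].
    apply not_all_ex_not in h. destruct h as [x h]. exists x. now apply imply_to_and. }
  assert (Hlg : len g = 4 * len (g + 2)).
  { rewrite (len_succ g), (len_succ (g + 1)). replace (g + 1 + 1)%Z with (g + 2)%Z by lia. lra. }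
  set (ok := fun i m => fst m = (g + 2)%Z /\ inc m (B i) /\
     forall y, IZR (snd m) * len (fst m) <= y <= (IZR (snd m) + 1) * len (fst m) -> near_alg w n N y /\ dset (B i) y).
  assert (Hok : forall i, In i good -> exists m, ok i m).
  { intros i Hi. destruct (Hg0 i Hi) as [Him [x [Hx HxZ]]]. unfold mid in Hx.
    assert (Hi' : INR i + 1 <= 2 ^ q).
    { replace 2 with (INR 2) by reflexivity. rewrite <- pow_INR, <- S_INR. apply le_INR. exact Him. }
    assert (Hi0 := pos_INR i).
    destruct (HZa x) as [a [h [A1 [A2 [A3 A4]]]]]; auto.
    { split; [nra|]. rewrite EL. nra. }
    assert (A5 : Rabs (x - a) <= el / 8) by lra.
    assert (A6 := Rle_abs (x - a)). assert (A7 := Rle_abs (- (x - a))). rewrite Rabs_Ropp in A7.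
    assert (Hlg0 := len_pos (g + 2)).
    (* An interval of length [len g / 4] through [a + len g / 2] avoids [a], while all its points
       stay within [len g] of [a]. *)
    destruct (dyadic_ex (g + 2) (a + len g / 2)) as [k' Hk].
    assert (Hk2 := Hk). unfold dyadic in Hk. fold (len (g + 2)) in Hk.
    assert (HD : forall y, IZR k' * len (g + 2) <= y <= (IZR k' + 1) * len (g + 2) -> dset (B i) y).
    { intros y Hy. unfold dset, dyadic. fold (len (fst (B i))). rewrite Rmult_plus_distr_r, EB, Rmult_1_l.
      unfold B at 1. cbn [fst]. fold el. lra. }
    exists (g + 2, k')%Z. split; [reflexivity|]. split.
    - apply (inter_inc _ _ (a + len g / 2)); [exact Hk2| |unfold B; simpl; lia].
      apply HD. lra.
    - cbn [fst snd]. intros y Hy. split; [|now apply HD].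
      assert (0 < y - a < len g) by lra.
      exists a, h. split; [exact A1|]. split; [exact A2|]. rewrite Rabs_right by lra. split; [lra|]. split; [lra|].
      apply Rlt_le_trans with (len g); [lra|]. apply G8. split; auto. apply IZR_lt.
      apply height_ge1 in A2. lia. }
  set (f := fun i => epsilon (inhabits (0, 0)%Z) (ok i)).
  assert (Hf : forall i, In i good -> ok i (f i)) by (intros i Hi; apply epsilon_spec, Hok, Hi).
  assert (HBinj : forall i i', B i = B i' -> i = i').
  { intros i i' e. unfold B in e. inversion e. lia. }
  assert (Hsame : forall i i' l', (j + Z.of_nat q <= fst l')%Z -> inc l' (B i) -> inc l' (B i') -> i = i').
  { intros i i' l' _ h1 h2. apply HBinj. apply inc_eq; [|reflexivity]. apply inc_common with l'; auto. simpl. lia. }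
  set (ms := map f good).
  assert (HA : 0 < H j / 2 ^ q) by (apply Rdiv_lt_0_compat; auto).
  assert (Hnd : NoDup ms).
  { apply FinFun.Injective_map_NoDup_in; [|apply NoDup_filter, seq_NoDup].
    intros i i' Hi Hi' e. apply (Hsame i i' (f i)).
    - destruct (Hf i Hi) as [-> _]. lia.
    - apply Hf, Hi.
    - rewrite e. apply Hf, Hi'. }
  destruct (pigeon H j0 H_pos lam (j, k) ms (g + 2) (H j / 2 ^ q) (th * (H j / 2 ^ q)) th) as [m [Hm1 Hm2]]; auto.
  - intros m Hm. apply in_map_iff in Hm. destruct Hm as [i [<- Hi]]. destruct (Hf i Hi) as [h1 [h2 _]].
    split; auto. apply inc_trans with (B i); auto. apply HB. now apply Hg0.
  - split; nra.
  - apply Rmult_le_compat_l; lra.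
  - intros l' Hi. assert (Hjl : (j <= fst l')%Z) by (destruct Hi; simpl in *; lia).
    destruct (Z_le_dec (fst l') (j + Z.of_nat q)).
    + apply Rle_trans with (IZR (2 ^ (j + Z.of_nat q - fst l')) * (H j / 2 ^ q)); [|apply share_le; auto].
      apply Rmult_le_compat_r; [lra|].
      apply Rle_trans with (cnt (map B good) l').
      * apply cnt_map_le. intros i Hig h. apply inc_common with (f i); auto. apply Hf, Hig.
      * apply cnt_le; auto.
        -- apply FinFun.Injective_map_NoDup_in; [|apply NoDup_filter, seq_NoDup]. intros; now apply HBinj.
        -- intros m Hm. apply in_map_iff in Hm. destruct Hm as [i [<- _]]. reflexivity.
    + destruct (Z_le_dec (fst l') (g + 2)).
      * apply Rle_trans with (1 * (H j / 2 ^ q)).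
        -- apply Rmult_le_compat_r; [lra|]. apply cnt_le_1; auto. intros m m' Hm Hm' h h'.
           apply in_map_iff in Hm, Hm'. destruct Hm as [i [<- Hig]], Hm' as [i' [<- Hig']].
           f_equal. apply (Hsame i i' l'); [lia| |]; eapply inc_common.
           ++ exact h.
           ++ apply Hf, Hig.
           ++ simpl. lia.
           ++ exact h'.
           ++ apply Hf, Hig'.
           ++ simpl. lia.
        -- assert (H (g + 2)%Z <= H (fst l')) by (apply H_anti; lia). lra.
      * rewrite (cnt_zero _ (g + 2)); [|intros m Hm; apply in_map_iff in Hm; destruct Hm as [i [<- Hig]]; apply Hf, Hig|lia].
        assert (0 < H (fst l')) by (apply H_pos; lia). lra.
  - intros M. unfold ms. rewrite length_map. eapply Rlt_le_trans; [apply HM|].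
    replace (th / 2 * H j) with (2 ^ q / 2 * (th * (H j / 2 ^ q))) by (field; lra).
    apply Rmult_le_compat_r; nra.
  - apply in_map_iff in Hm1. destruct Hm1 as [i [<- Hig]]. destruct (Hf i Hig) as [h1 [h2 h3]].
    exists (f i). split; [rewrite h1; lia|]. split; auto. intros y Hy. destruct (h3 y Hy) as [h4 h5]. split; auto.
    apply inc_sub with (j, k); auto. apply inc_sub with (B i); auto. apply HB. now apply Hg0.
Qed.

End Step.

(** * Gauge functions *)

Lemma scal_inv_l c x : 0 < c -> Rbar_scal (/ c) (Rbar_scal c x) = x.
Proof. intros H. destruct x; simpl; auto. f_equal. field. lra. Qed.

Lemma scal_inv_r c x : 0 < c -> Rbar_scal c (Rbar_scal (/ c) x) = x.
Proof. intros H. destruct x; simpl; auto. f_equal. field. lra. Qed.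

Lemma scal_le c x y : 0 < c -> Rbar_le x y -> Rbar_le (Rbar_scal c x) (Rbar_scal c y).
Proof. intros Hc. destruct x, y; simpl; auto. intros. apply Rmult_le_compat_l; lra. Qed.

Lemma scal_le_l c d x : 0 < c -> c <= d -> Rbar_le (Finite 0) x -> Rbar_le (Rbar_scal c x) (Rbar_scal d x).
Proof. intros Hc. destruct x; simpl; auto. intros. apply Rmult_le_compat_r; lra. Qed.

Lemma scal_nonneg c x : 0 < c -> Rbar_le (Finite 0) x -> Rbar_le (Finite 0) (Rbar_scal c x).
Proof. intros Hc. destruct x; simpl; auto. intros. apply Rmult_le_pos; lra. Qed.

Lemma finite_between x M : Rbar_le (Finite 0) x -> Rbar_le x (Finite M) -> x = Finite (fin x).
Proof. destruct x; simpl; auto; tauto. Qed.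

Lemma gauge_nonneg g r : is_gauge g -> 0 <= r -> Rbar_le (Finite 0) (g (Finite r)).
Proof. intros [H _] Hr. exact (H (Finite r) Hr). Qed.

Definition mean_inf (g : Rbar -> Rbar) (r : R) : Rbar :=
  Rbar_inf (fun w => exists rho, 0 < rho <= r /\ w = Rbar_scal (/ rho) (g (Finite rho))).

Lemma normalizeE g r : 0 < r -> normalize g (Finite r) = Rbar_scal r (mean_inf g r).
Proof. intros Hr. unfold normalize. destruct Rlt_dec; [reflexivity|lra]. Qed.

Lemma normalize0 g : normalize g (Finite 0) = Finite 0.
Proof. unfold normalize. destruct Rlt_dec; [lra|reflexivity]. Qed.

Lemma mean_inf_anti g r s : r <= s -> Rbar_le (mean_inf g s) (mean_inf g r).
Proof.
  intros H. apply Rbar_inf_glb. intros y [rho [h ->]]. apply Rbar_inf_lb. exists rho. split; [lra|reflexivity].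
Qed.

Lemma mean_inf_nonneg g r : is_gauge g -> Rbar_le (Finite 0) (mean_inf g r).
Proof.
  intros H. apply Rbar_inf_glb. intros y [rho [h ->]]. apply scal_nonneg; [apply Rinv_0_lt_compat; lra|].
  apply gauge_nonneg; auto. lra.
Qed.

Lemma mean_inf_self g r : 0 < r -> Rbar_le (mean_inf g r) (Rbar_scal (/ r) (g (Finite r))).
Proof. intros H. apply Rbar_inf_lb. exists r. split; [lra|reflexivity]. Qed.

Lemma normalize_le g r : 0 < r -> Rbar_le (normalize g (Finite r)) (g (Finite r)).
Proof.
  intros H. rewrite normalizeE by auto. rewrite <- (scal_inv_r r (g (Finite r)) H).
  apply scal_le; auto. now apply mean_inf_self.
Qed.

Lemma normalize_ratio g r s : 0 < r -> r <= s ->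
  Rbar_le (Rbar_scal (/ s) (normalize g (Finite s))) (Rbar_scal (/ r) (normalize g (Finite r))).
Proof.
  intros Hr Hs. rewrite !normalizeE, !scal_inv_l by lra. now apply mean_inf_anti.
Qed.

(** For monotonicity, compare the infimum at [s] with the value at [r <= s]: a quotient at
    [rho <= r] already enters the infimum at [r], and for [rho > r] one has [g(rho) >= g(r)], which
    dominates the normalization at [r]. *)
Lemma normalize_gauge g : is_gauge g -> is_gauge (normalize g).
Proof.
  intros Hg. assert (Hg' := Hg). destruct Hg' as [_ [[e [He Hm]] [Hlim [H0 Hinf]]]].
  split; [|split; [|split; [|split]]].
  - intros [r| |]; auto. intros Hr. destruct (Rle_lt_or_eq_dec 0 r Hr) as [h|<-].
    + rewrite normalizeE by auto. apply scal_nonneg; auto. now apply mean_inf_nonneg.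
    + rewrite normalize0. simpl. lra.
  - exists e. split; auto. intros r s Hr Hrs Hs. destruct (Rle_lt_or_eq_dec 0 r Hr) as [h|<-].
    + rewrite (normalizeE g s) by lra. rewrite <- (scal_inv_r s (normalize g (Finite r))) by lra.
      apply scal_le; [lra|]. apply Rbar_inf_glb. intros y [rho [Hrho ->]].
      destruct (Rle_dec rho r).
      * apply Rbar_le_trans with (Rbar_scal (/ r) (normalize g (Finite r))).
        -- apply scal_le_l; [apply Rinv_0_lt_compat; lra|apply Rinv_le_contravar; lra|].
           rewrite normalizeE by auto. apply scal_nonneg; auto. now apply mean_inf_nonneg.
        -- rewrite normalizeE, scal_inv_l by auto. apply Rbar_inf_lb. exists rho. split; [lra|reflexivity].
      * apply Rbar_le_trans with (Rbar_scal (/ rho) (normalize g (Finite r))).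
        -- apply scal_le_l; [apply Rinv_0_lt_compat; lra|apply Rinv_le_contravar; lra|].
           rewrite normalizeE by auto. apply scal_nonneg; auto. now apply mean_inf_nonneg.
        -- apply scal_le; [apply Rinv_0_lt_compat; lra|].
           apply Rbar_le_trans with (g (Finite r)); [now apply normalize_le|]. apply Hm; lra.
    + rewrite normalize0. destruct (Rle_lt_or_eq_dec 0 s Hrs) as [h|<-].
      * rewrite normalizeE by auto. apply scal_nonneg; auto. now apply mean_inf_nonneg.
      * rewrite normalize0. apply Rbar_le_refl.
  - intros eta Heta. destruct (Hlim eta Heta) as [rho [Hr H]]. exists rho. split; auto. intros r h.
    apply Rbar_le_trans with (g (Finite r)); auto. apply normalize_le. lra.
  - apply normalize0.
  - reflexivity.
Qed.

Lemma ratio_normalized h e : is_gauge h -> 0 < e ->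
  (forall r s, 0 < r -> r <= s -> s < e ->
     Rbar_le (Rbar_scal (/ s) (h (Finite s))) (Rbar_scal (/ r) (h (Finite r)))) -> d_normalized h.
Proof.
  intros Hh He H. split; auto. exists e. split; auto. intros r Hr.
  destruct (Rle_lt_or_eq_dec 0 r) as [h0|<-]; [lra| |].
  - rewrite normalizeE by auto. rewrite <- (scal_inv_r r (h (Finite r))) at 1 by auto. f_equal.
    apply Rbar_le_antisym; [|now apply mean_inf_self].
    apply Rbar_inf_glb. intros y [rho [h1 ->]]. apply H; lra.
  - rewrite normalize0. apply Hh.
Qed.

Lemma normalize_normalized g : is_gauge g -> d_normalized (normalize g).
Proof.
  intros Hg. apply ratio_normalized with 1; [now apply normalize_gauge|lra|].
  intros. now apply normalize_ratio.
Qed.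

Lemma normalized_near0 h : d_normalized h -> exists e, 0 < e /\
  (forall r, 0 <= r <= e -> h (Finite r) = Finite (fin (h (Finite r))) /\ 0 <= fin (h (Finite r))) /\
  (forall r s, 0 <= r -> r <= s -> s <= e -> fin (h (Finite r)) <= fin (h (Finite s))) /\
  (forall r s, 0 < r -> r <= s -> s <= e -> fin (h (Finite s)) / s <= fin (h (Finite r)) / r).
Proof.
  intros [Hg [e1 [He1 H1]]]. assert (Hg' := Hg). destruct Hg' as [_ [[e2 [He2 Hm]] [Hlim [H0 _]]]].
  destruct (Hlim 1) as [e3 [He3 H3]]; [lra|].
  set (e := Rmin (Rmin e1 e2) e3 / 2).
  assert (He : 0 < e /\ e < e1 /\ e < e2 /\ e < e3).
  { assert (0 < Rmin (Rmin e1 e2) e3) by (repeat apply Rmin_glb_lt; auto). unfold e.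
    generalize (Rmin_l (Rmin e1 e2) e3) (Rmin_r (Rmin e1 e2) e3) (Rmin_l e1 e2) (Rmin_r e1 e2). lra. }
  assert (F : forall r, 0 <= r <= e -> h (Finite r) = Finite (fin (h (Finite r))) /\ 0 <= fin (h (Finite r))).
  { intros r Hr. assert (Hn : Rbar_le (Finite 0) (h (Finite r))) by (apply gauge_nonneg; auto; lra).
    assert (E : h (Finite r) = Finite (fin (h (Finite r)))).
    { destruct (Rle_lt_or_eq_dec 0 r) as [h0|<-]; [lra| |].
      - apply finite_between with 1; auto. apply H3. lra.
      - rewrite H0. reflexivity. }
    split; auto. rewrite E in Hn. exact Hn. }
  exists e. split; [tauto|]. split; [exact F|]. split.
  - intros r s h0 h1 h2. assert (Hle : Rbar_le (h (Finite r)) (h (Finite s))) by (apply Hm; lra).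
    destruct (F r) as [Er _]; [lra|]. destruct (F s) as [Es _]; [lra|]. rewrite Er, Es in Hle. exact Hle.
  - intros r s h0 h1 h2. assert (Hle := normalize_ratio h r s h0 h1).
    rewrite <- (H1 r), <- (H1 s) in Hle by lra.
    destruct (F r) as [Er _]; [lra|]. destruct (F s) as [Es _]; [lra|]. rewrite Er, Es in Hle. simpl in Hle.
    unfold Rdiv. lra.
Qed.

Definition superlin (h : Rbar -> Rbar) : Prop := forall M, exists rho, 0 < rho /\
  forall r, 0 < r < rho -> Rbar_le (Finite (M * r)) (h (Finite r)).

(** The condition in [G_s] with its negation pushed inwards, stated for any function so that it can
    be passed on to larger ones. *)
Definition freq (w : R) (h : Rbar -> Rbar) : Prop := forall s, w < s -> exists eta, 0 < eta /\
  forall rho, 0 < rho -> exists r, 0 < r < rho /\ ~ Rbar_le (h (Finite r)) (Finite (eta * Rpower r s)).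

Lemma G_infty_superlin g : G_infty g -> superlin (normalize g).
Proof.
  intros [Hg He] M.
  assert (Hs : ~ Rbar_le (ell g) (Finite M)) by (rewrite He; simpl; auto).
  unfold ell in Hs. apply Rbar_sup_gt in Hs. destruct Hs as [y [[e [H0 ->]] Hy]].
  exists e. split; auto. intros r Hr. rewrite normalizeE by lra.
  replace (Finite (M * r)) with (Rbar_scal r (Finite M)) by (simpl; f_equal; lra).
  apply scal_le; [lra|]. apply Rbar_le_trans with (Rbar_inf (fun w => exists r, 0 < r < e /\ w = Rbar_scal (/ r) (g (Finite r)))).
  - destruct (Rbar_le_total (Finite M) (Rbar_inf (fun w => exists r, 0 < r < e /\ w = Rbar_scal (/ r) (g (Finite r))))); auto.
    contradiction.
  - apply Rbar_inf_glb. intros z [rho [h ->]]. apply Rbar_inf_lb. exists rho. split; [lra|reflexivity].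
Qed.

Lemma superlin_pos h : superlin h -> exists rho, 0 < rho /\ forall r, 0 < r < rho -> 0 < fin (h (Finite r)) \/ h (Finite r) = p_infty.
Proof.
  intros H. destruct (H 1) as [rho [Hr Hh]]. exists rho. split; auto. intros r h0. specialize (Hh r h0).
  destruct (h (Finite r)); simpl in *; auto; [left; lra|tauto].
Qed.

Lemma G_s_freq s0 g : G_s s0 g -> freq s0 (normalize g).
Proof.
  intros [_ H] s Hs. specialize (H s Hs). apply NNPP. intros Hn. apply H. intros eta Heta.
  apply NNPP. intros Hn2. apply Hn. exists eta. split; auto. intros rho Hrho. apply NNPP. intros Hn3.
  apply Hn2. exists rho. split; auto. intros r Hr. apply NNPP. intros Hn4. apply Hn3. now exists r.
Qed.

(** * Diameters with respect to a norm on the line *)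

Section Norm.
Variable N : R -> R.
Hypothesis HN : is_norm N.

Lemma norm_scale x : N x = Rabs x * N 1.
Proof. destruct HN as [_ [H _]]. rewrite <- H. f_equal. lra. Qed.

Lemma norm1_pos : 0 < N 1.
Proof.
  destruct HN as [H0 [H1 H2]]. assert (N 0 = 0) by now apply H0.
  assert (N 1 <> 0) by (intros e; apply (proj1 (H0 1)) in e; lra).
  specialize (H2 1 (-1)). replace (1 + -1) with 0 in H2 by lra.
  replace (-1) with (-1 * 1) in H2 by lra. rewrite H1 in H2.
  replace (Rabs (-1)) with 1 in H2 by (rewrite Rabs_left; lra). lra.
Qed.

Lemma diam_nonneg C : Rbar_le (Finite 0) (diam N C).
Proof. apply Rbar_sup_ub. now left. Qed.

Lemma diam_le C x y r : Rbar_le (diam N C) (Finite r) -> C x -> C y -> N 1 * Rabs (x - y) <= r.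
Proof.
  intros H Hx Hy. assert (Rbar_le (Finite (N (x - y))) (diam N C)) by (apply Rbar_sup_ub; right; now exists x, y).
  assert (H' := Rbar_le_trans _ _ _ H0 H). simpl in H'. rewrite norm_scale in H'. lra.
Qed.

Lemma diam_interval a b (P : R -> Prop) : a < b -> (forall x, a <= x < b -> P x) -> (forall x, P x -> a <= x <= b) ->
  diam N P = Finite (N 1 * (b - a)).
Proof.
  intros Hab H1 H2. assert (Hc := norm1_pos). apply Rbar_sup_eq. split.
  - intros y [->|[x [x' [Hx [Hx' ->]]]]]; simpl.
    + apply Rmult_le_pos; lra.
    + rewrite norm_scale, Rmult_comm. apply Rmult_le_compat_l; [lra|]. apply H2 in Hx, Hx'. apply Rabs_le. lra.
  - intros u Hu. destruct u as [r| |]; simpl; auto.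
    + apply Rnot_lt_le. intros Hlt.
      assert (H0 : 0 <= r) by (apply (Hu (Finite 0)); now left).
      set (t := (r / N 1 + (b - a)) / 2).
      assert (Hr : r / N 1 < b - a).
      { apply Rmult_lt_reg_r with (N 1); auto. unfold Rdiv. rewrite Rmult_assoc, Rinv_l; lra. }
      assert (Hr0 : 0 <= r / N 1) by (apply Rmult_le_pos; [lra|left; now apply Rinv_0_lt_compat]).
      assert (Hle : Rbar_le (Finite (N (a + t - a))) (Finite r)).
      { apply Hu. right. exists (a + t), a. split; [apply H1; unfold t; lra|]. split; [apply H1; lra|reflexivity]. }
      simpl in Hle. rewrite norm_scale in Hle. replace (a + t - a) with t in Hle by lra.
      rewrite Rabs_right in Hle by (unfold t; lra).
      assert (t <= r / N 1).
      { apply Rmult_le_reg_r with (N 1); auto. unfold Rdiv. rewrite Rmult_assoc, Rinv_l; lra. }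
      unfold t in H. lra.
    + apply (Hu (Finite 0)). now left.
Qed.

Lemma diam_dyadic j k : diam N (dyadic j k) = Finite (N 1 * len j).
Proof.
  assert (H := len_pos j). rewrite (diam_interval (IZR k * len j) ((IZR k + 1) * len j)).
  - do 2 f_equal. lra.
  - lra.
  - intros x Hx. exact Hx.
  - intros x Hx. unfold dyadic in Hx. fold (len j) in Hx. lra.
Qed.

End Norm.

Lemma normalized_eps h : d_normalized h -> exists e, 0 < e /\ Rbar_le (Finite e) (eps_h h).
Proof.
  intros H. destruct (normalized_near0 h H) as [e [He [H1 [H2 H3]]]]. exists e. split; auto.
  apply Rbar_sup_ub. exists e. split; auto. split; auto. split.
  - intros r s h0 h1 h2. destruct (H1 r) as [-> _]; [lra|]. destruct (H1 s) as [-> _]; [lra|]. simpl. apply H2; lra.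
  - intros r s h0 h1 h2. specialize (H3 r s h0 h1 h2). destruct (H1 r) as [-> _]; [lra|]. destruct (H1 s) as [-> _]; [lra|].
    simpl. unfold Rdiv in H3. lra.
Qed.

Lemma below_eps_mono h r s : 0 <= r -> r <= s -> Rbar_lt (Finite s) (eps_h h) -> Rbar_le (h (Finite r)) (h (Finite s)).
Proof.
  intros Hr Hs [H1 H2]. assert (Hn : ~ Rbar_le (eps_h h) (Finite s)).
  { intros h0. apply H2. now apply Rbar_le_antisym. }
  apply Rbar_sup_gt in Hn. destruct Hn as [y [[e [h0 [-> [h1 _]]]] hy]]. simpl in hy. apply h1; auto. lra.
Qed.

(** * Net content of the approximation set *)

Section Full.
Variables (N : R -> R) (h : Rbar -> Rbar).
Hypotheses (HN : is_norm N).
Hypotheses (h_norm : d_normalized h) (h_super : superlin h).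

Definition Hseq (j : Z) : R := fin (h (Finite (N 1 * len j))).

(** All that the descent uses of [h] is read off along the diameters [N 1 * len j]. For [freq],
    moving from [r] to the dyadic diameter just below it loses at most a factor 2, since [h(r)/r] is
    nonincreasing. *)
Lemma gauge_seq : exists j0,
  (forall j, (j0 <= j)%Z -> h (Finite (N 1 * len j)) = Finite (Hseq j)) /\
  (forall j, (j0 <= j)%Z -> Rbar_lt (Finite (N 1 * len j)) (eps_h h)) /\
  (forall j, (j0 <= j)%Z -> 0 < Hseq j) /\
  (forall i j, (j0 <= i)%Z -> (i <= j)%Z -> Hseq j <= Hseq i) /\
  (forall i j, (j0 <= i)%Z -> (i <= j)%Z -> Hseq i / len i <= Hseq j / len j) /\
  (forall M, exists J, forall j, (J <= j)%Z -> M <= Hseq j / len j) /\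
  (forall s0, 0 < s0 -> freq s0 h -> forall s, s0 < s -> exists eta, 0 < eta /\
     forall J, exists g, (J <= g)%Z /\ eta * Rpower (len g) s <= Hseq g).
Proof.
  assert (Hc := norm1_pos N HN). set (c := N 1) in *.
  destruct (normalized_near0 h h_norm) as [e1 [He1 [F1 [F2 F3]]]].
  destruct (superlin_pos h h_super) as [e2 [He2 F4]].
  destruct (normalized_eps h h_norm) as [e3 [He3 F5]].
  set (e := Rmin (Rmin e1 e2) e3).
  assert (He : 0 < e /\ e <= e1 /\ e <= e2 /\ e <= e3).
  { assert (0 < e) by (repeat apply Rmin_glb_lt; auto). unfold e in *.
    generalize (Rmin_l (Rmin e1 e2) e3) (Rmin_r (Rmin e1 e2) e3) (Rmin_l e1 e2) (Rmin_r e1 e2). lra. }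
  assert (Hsmall : forall d, 0 < d -> exists J, forall j, (J <= j)%Z -> 0 < c * len j < d).
  { intros d Hd. destruct (len_small (d / c)) as [J HJ]; [now apply Rdiv_lt_0_compat|]. exists J. intros j Hj.
    specialize (HJ j Hj). assert (Hl := len_pos j). split; [nra|].
    apply Rmult_lt_reg_r with (/ c); [now apply Rinv_0_lt_compat|].
    replace (c * len j * / c) with (len j) by (field; lra). exact HJ. }
  destruct (Hsmall e) as [j0 Hj0]; [tauto|].
  assert (Eq : forall j, (j0 <= j)%Z -> h (Finite (c * len j)) = Finite (Hseq j)).
  { intros j Hj. apply F1. specialize (Hj0 j Hj). lra. }
  assert (Hrat : forall i j, (j0 <= i)%Z -> (i <= j)%Z -> Hseq i / len i <= Hseq j / len j).
  { intros i j Hi Hij. unfold Hseq. fold c.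
    assert (Hl := len_le i j Hij). assert (Hlp := len_pos j). assert (Hlp' := len_pos i).
    assert (Hr : fin (h (Finite (c * len i))) / (c * len i) <= fin (h (Finite (c * len j))) / (c * len j)).
    { apply F3; [nra|nra|]. specialize (Hj0 i Hi). lra. }
    apply Rmult_le_reg_l with (/ c); [now apply Rinv_0_lt_compat|].
    replace (/ c * (fin (h (Finite (c * len i))) / len i)) with (fin (h (Finite (c * len i))) / (c * len i)) by (field; lra).
    replace (/ c * (fin (h (Finite (c * len j))) / len j)) with (fin (h (Finite (c * len j))) / (c * len j)) by (field; lra).
    exact Hr. }
  exists j0. split; [exact Eq|]. split; [|split; [|split; [|split; [exact Hrat|split]]]].
  - intros j Hj. specialize (Hj0 j Hj). split.
    + eapply Rbar_le_trans; [|exact F5]. simpl. lra.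
    + intros E. rewrite <- E in F5. simpl in F5. lra.
  - intros j Hj. specialize (Hj0 j Hj). destruct (F4 (c * len j)) as [h1|h1]; [lra|exact h1|].
    rewrite (Eq j Hj) in h1. discriminate.
  - intros i j Hi Hij. unfold Hseq. fold c. assert (Hl := len_le i j Hij). assert (Hlp := len_pos j).
    specialize (Hj0 i Hi). apply F2; nra.
  - intros M. destruct (h_super (M / c)) as [rho [Hr HM]]. destruct (Hsmall rho Hr) as [J HJ].
    exists (Z.max J j0). intros j Hj. specialize (HJ j ltac:(lia)). specialize (HM _ HJ).
    rewrite Eq in HM by lia. simpl in HM. assert (Hl := len_pos j).
    apply Rmult_le_reg_r with (len j); auto. replace (Hseq j / len j * len j) with (Hseq j) by (field; lra).
    replace (M / c * (c * len j)) with (M * len j) in HM by (field; lra). exact HM.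
  - intros s0 Hs0 Hf s Hs. destruct (Hf s Hs) as [eta [Heta Hq]].
    assert (Hcs := Rpower_pos c s). exists (eta / 2 * Rpower c s). split; [nra|].
    intros J. assert (HlJ := len_pos (Z.max J j0)).
    destruct (Hq (Rmin e (c * len (Z.max J j0)))) as [r [Hr1 Hr2]]; [apply Rmin_glb_lt; nra|].
    assert (Hr3 := Rmin_l e (c * len (Z.max J j0))). assert (Hr4 := Rmin_r e (c * len (Z.max J j0))).
    assert (Hrc : 0 < r / c) by (apply Rdiv_lt_0_compat; lra).
    destruct (len_bracket (r / c) Hrc) as [g [G1 G2]].
    assert (Hrc2 : r / c < len (Z.max J j0)).
    { apply Rmult_lt_reg_r with c; auto. replace (r / c * c) with r by (field; lra). lra. }
    assert (Hrc3 : c * (r / c) = r) by (field; lra).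
    assert (Hg : (Z.max J j0 <= g)%Z).
    { destruct (Z_le_dec (Z.max J j0) g); auto. exfalso.
      assert (len (Z.max J j0) <= len g) by (apply len_le; lia). lra. }
    exists g. split; [lia|]. assert (Hlg := len_pos g). set (x := len g) in *.
    assert (Hcx : c * x <= r) by nra. assert (Hcx0 : 0 < c * x) by nra.
    assert (R1 := F3 (c * x) r Hcx0 Hcx ltac:(lra)).
    destruct (F1 r) as [E1 E2]; [lra|]. rewrite E1 in Hr2. simpl in Hr2. apply Rnot_le_lt in Hr2.
    fold c in R1. change (fin (h (Finite (c * x)))) with (Hseq g) in R1.
    assert (R2 : fin (h (Finite r)) * (c * x) <= Hseq g * r).
    { apply Rmult_le_reg_r with (/ (r * (c * x))); [apply Rinv_0_lt_compat; nra|].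
      replace (fin (h (Finite r)) * (c * x) * / (r * (c * x))) with (fin (h (Finite r)) / r) by (field; lra).
      replace (Hseq g * r * / (r * (c * x))) with (Hseq g / (c * x)) by (field; lra). exact R1. }
    assert (R3 : fin (h (Finite r)) / 2 <= Hseq g).
    { assert (r < 2 * (c * x)) by nra. apply Rnot_lt_le. intros Hlt. nra. }
    assert (R4 : Rpower c s * Rpower x s <= Rpower r s).
    { rewrite Rpower_mult_distr by auto. apply Rle_Rpower_l; lra. }
    nra.
Qed.

Definition approx_set (w x : R) : Prop := forall n m, near_alg w n m x.

(** Monotonicity gives one inequality. For the other, a cover of the smaller set of finite cost [S]
    is repaired by [new_lam] into a cover of [V] of cost at most [S / th], the pairs of conditions
    defining [approx_set] being listed as one sequence [W]. *)
Lemma approx_set_content w V : 1 < w -> freq (/ w) h -> open_set V ->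
  M_infty N h (fun x => approx_set w x /\ V x) = M_infty N h V.
Proof.
  intros w_gt1 Hf HV. apply Rbar_le_antisym.
  { apply Rbar_inf_glb. intros y [lam [h1 [h2 ->]]]. apply Rbar_inf_lb. exists lam. split; [|auto].
    intros x [_ Hx]. now apply h1. }
  destruct gauge_seq as [j0 [Eq [Heps [Hpos [Hanti [Hrat [Hinf Hfreq]]]]]]]. 
  specialize (Hfreq (/ w) (Rinv_0_lt_compat w ltac:(lra)) Hf).
  apply Rbar_inf_glb. intros y [lam [Hcov [Hlam ->]]].
  set (u := fun n => match lam n with Some (j, k) => h (diam N (dyadic j k)) | None => Finite 0 end).
  assert (Hu : forall n, Rbar_le (Finite 0) (u n)).
  { intros n. unfold u. destruct (lam n) as [[j k]|]; [|simpl; lra]. rewrite diam_dyadic by auto.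
    apply gauge_nonneg; [apply h_norm|]. apply Rmult_le_pos; [left; now apply norm1_pos|left; apply len_pos]. }
  destruct (Rbar_series u) as [S| |] eqn:ES.
  3: { assert (Hn := series_nonneg u). rewrite ES in Hn. easy. }
  2: { apply Rbar_le_p_infty. }
  assert (S0 : 0 <= S) by (assert (Hn := series_nonneg u); rewrite ES in Hn; exact Hn).
  destruct (series_le_inv u S Hu) as [v [Hv HvS]]; [rewrite ES; apply Rbar_le_refl|].
  (* This makes [S / th <= S + e], with [S + 1] in place of [S] to allow [S = 0]. *)
  apply Rbar_le_dense. intros e He. set (th := / (1 + e / (S + 1))).
  assert (Hd : 0 < e / (S + 1)) by (apply Rdiv_lt_0_compat; lra).
  assert (Hth : 0 < th <= 1).
  { unfold th. split; [apply Rinv_0_lt_compat; lra|]. apply Rle_trans with (/ 1); [apply Rinv_le_contravar; lra|rewrite Rinv_1; lra]. }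
  assert (HSth : S / th <= S + e).
  { unfold th, Rdiv. rewrite Rinv_inv. assert (S * / (S + 1) <= 1); [|unfold Rdiv; nra].
    apply Rmult_le_reg_r with (S + 1); [lra|]. rewrite Rmult_assoc, Rinv_l; lra. }
  apply Rbar_le_trans with (Finite (S / th)); [|exact HSth].
  set (W := fun i x => near_alg w (fst (Cantor.of_nat i)) (snd (Cantor.of_nat i)) x).
  assert (HW : forall x, (forall i, W i x) -> approx_set w x).
  { intros x Hx n m. specialize (Hx (Cantor.to_nat (n, m))). unfold W in Hx. rewrite Cantor.cancel_of_to in Hx. exact Hx. }
  set (lam' := new_lam Hseq j0 lam th).
  apply Rbar_le_trans with (Rbar_series (fun n => match lam' n with Some (j, k) => h (diam N (dyadic j k)) | None => Finite 0 end)).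
  - apply Rbar_inf_lb. exists lam'. split; [|split; [|reflexivity]].
    + intros x Vx. destruct (new_cover Hseq j0 Hpos lam W th) with (V := V) (x := x) as [n [[j k] [E1 E2]]]; auto.
      * intros i l Hl Hlight. apply (light_step Hseq j0 w w_gt1 Hpos Hanti Hrat Hinf Hfreq lam th Hth); auto.
      * lra.
      * intros y Hy Vy. destruct (Hcov y) as [n [j [k [E1 E2]]]]; [split; auto|]. now exists n, (j, k).
      * now exists n, j, k.
    + intros n j k E. rewrite diam_dyadic by auto. unfold lam', new_lam in E.
      destruct (top_of Hseq j0 lam th n) as [l|] eqn:E'.
      * destruct Nat.eq_dec; [|discriminate]. inversion E; subst.
        apply top_of_Some in E'. destruct E' as [m [_ [[[h1 _] _] _]]]. apply Heps. exact h1.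
      * specialize (Hlam n j k E). now rewrite diam_dyadic in Hlam.
  - apply series_le with (new_cost Hseq j0 lam th v).
    + intros n. unfold lam', new_lam, new_cost. destruct (top_of Hseq j0 lam th n) as [[j k]|] eqn:E'.
      * destruct Nat.eq_dec; [|reflexivity]. rewrite diam_dyadic by auto.
        apply top_of_Some in E'. destruct E' as [m [_ [[[h1 _] _] _]]]. apply Eq. exact h1.
      * destruct (Hv n) as [h1 _]. exact h1.
    + apply new_cost_sum; auto.
      * apply Hv.
      * intros n [j k] E Hj. destruct (Hv n) as [h1 _]. unfold u in h1. rewrite E in h1.
        rewrite diam_dyadic, Eq in h1 by auto. inversion h1. reflexivity.
Qed.

(* Any cover has cost at least a constant times the length, or else uses a cube of generation below [j0]. *)
Lemma interval_content_pos u v : u < v -> ~ Rbar_le (M_infty N h (fun x => u < x < v)) (Finite 0).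
Proof.
  intros Huv Hle.
  destruct gauge_seq as [j0 [Eq [Heps [Hpos [Hanti [Hrat _]]]]]].
  assert (Hp0 := Hpos j0 (Z.le_refl _)). assert (Hl0 := len_pos j0).
  set (kap := Hseq j0 / len j0). assert (Hkap : 0 < kap) by (apply Rdiv_lt_0_compat; auto).
  set (e := Rmin (Hseq j0 / 2) (kap * (v - u) / 8)).
  assert (He : 0 < e) by (apply Rmin_glb_lt; nra).
  destruct (Rbar_inf_lt _ 0 e He Hle) as [y [[lam [Hcov [Hlam ->]]] Hy]].
  set (x := fun n => match lam n with Some (j, k) => h (diam N (dyadic j k)) | None => Finite 0 end) in Hy.
  assert (Hx : forall n, Rbar_le (Finite 0) (x n)).
  { intros n. unfold x. destruct (lam n) as [[j k]|]; [|simpl; lra]. rewrite diam_dyadic by auto.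
    apply gauge_nonneg; [apply h_norm|]. apply Rmult_le_pos; [left; now apply norm1_pos|left; apply len_pos]. }
  destruct (series_le_inv x (0 + e) Hx Hy) as [z [Hz HzS]].
  assert (Hz1 : forall n, z n <= e).
  { intros n. specialize (HzS (S n)). simpl in HzS.
    assert (0 <= rsum z n) by (apply rsum_nonneg; intros; apply Hz). lra. }
  assert (Hlen : forall n j k, lam n = Some (j, k) -> kap * len j <= z n).
  { intros n j k E. destruct (Hz n) as [E1 _]. unfold x in E1. rewrite E, diam_dyadic in E1 by auto.
    assert (Hl := Hlam n j k E). rewrite diam_dyadic in Hl by auto.
    assert (Hj : (j0 <= j)%Z).
    { destruct (Z_le_dec j0 j); auto. exfalso.
      assert (Hm : Rbar_le (h (Finite (N 1 * len j0))) (h (Finite (N 1 * len j)))).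
      { apply below_eps_mono; auto.
        - apply Rmult_le_pos; [left; now apply norm1_pos|lra].
        - apply Rmult_le_compat_l; [left; now apply norm1_pos|]. apply len_le. lia. }
      rewrite E1, Eq in Hm by lia. simpl in Hm. specialize (Hz1 n).
      assert (e <= Hseq j0 / 2) by apply Rmin_l. lra. }
    rewrite Eq in E1 by auto. inversion E1 as [E2].
    assert (R1 := Hrat j0 j (Z.le_refl _) Hj). fold kap in R1. assert (Hlj := len_pos j).
    apply Rmult_le_reg_r with (/ len j); [now apply Rinv_0_lt_compat|].
    replace (kap * len j * / len j) with kap by (field; lra). exact R1. }
  set (a := fun n => match lam n with Some (j, k) => IZR k * len j - len j | None => 0 end).
  set (b := fun n => match lam n with Some (j, k) => (IZR k + 1) * len j | None => 0 end).
  destruct (cover_length a b (u + (v - u) / 4) (v - (v - u) / 4)) as [n Hn].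
  - intros n. unfold a, b. destruct (lam n) as [[j k]|]; [|lra]. assert (Hlj := len_pos j). lra.
  - lra.
  - intros t Ht. destruct (Hcov t) as [n [j [k [E1 E2]]]]; [lra|]. exists n. unfold a, b. rewrite E1.
    unfold dyadic in E2. fold (len j) in E2. assert (Hlj := len_pos j). lra.
  - assert (rsum (fun i => b i - a i) n <= rsum (fun i => 2 / kap * z i) n).
    { apply rsum_le. intros i _. unfold a, b. destruct (lam i) as [[j k]|] eqn:E.
      - specialize (Hlen i j k E). apply Rmult_le_reg_l with kap; auto.
        replace (kap * (2 / kap * z i)) with (2 * z i) by (field; lra). nra.
      - destruct (Hz i) as [_ h1]. rewrite Rminus_0_r. apply Rmult_le_pos; auto. left. apply Rdiv_lt_0_compat; lra. }
    rewrite rsum_scal in H. specialize (HzS n).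
    assert (e <= kap * (v - u) / 8) by apply Rmin_r.
    assert (2 / kap * rsum z n <= 2 / kap * (kap * (v - u) / 8)).
    { apply Rmult_le_compat_l; [left; apply Rdiv_lt_0_compat; lra|lra]. }
    replace (2 / kap * (kap * (v - u) / 8)) with ((v - u) / 4) in H1 by (field; lra). lra.
Qed.

End Full.

(** * Sets of small power sums *)

Lemma rsum_single (f : nat -> R) (i0 : nat) K : rsum (fun i => if Nat.eq_dec i i0 then f i else 0) K =
  if lt_dec i0 K then f i0 else 0.
Proof.
  induction K as [|K IH]; cbn [rsum].
  - destruct lt_dec; [lia|reflexivity].
  - rewrite IH. destruct (Nat.eq_dec K i0) as [->|e].
    + destruct lt_dec; [lia|]. destruct lt_dec; [lra|lia].
    + destruct (lt_dec i0 K), (lt_dec i0 (S K)); try lia; lra.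
Qed.

Lemma rsum_pair (u : nat -> nat -> R) (c : nat -> R) C : (forall n i, 0 <= u n i) ->
  (forall n M, rsum (u n) M <= c n) -> (forall M, rsum c M <= C) ->
  forall M, rsum (fun m => u (fst (Cantor.of_nat m)) (snd (Cantor.of_nat m))) M <= C.
Proof.
  intros Hu Hc HC M.
  set (d := fun m n i => if Nat.eq_dec m (Cantor.to_nat (n, i)) then u n i else 0).
  apply Rle_trans with (rsum c M); [|apply HC].
  apply Rle_trans with (rsum (fun n => rsum (u n) M) M); [|apply rsum_le; auto].
  apply Rle_trans with (rsum (fun m => rsum (fun n => rsum (fun i => d m n i) M) M) M).
  - apply rsum_le. intros m Hm. destruct (Cantor.of_nat m) as [n i] eqn:E. cbn [fst snd].
    assert (Em : m = Cantor.to_nat (n, i)) by (rewrite <- E; now rewrite Cantor.cancel_to_of).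
    assert (Hni := Cantor.to_nat_non_decreasing n i). rewrite <- Em in Hni.
    assert (D0 : forall n i, 0 <= d m n i) by (intros; unfold d; destruct Nat.eq_dec; auto; lra).
    apply Rle_trans with (rsum (fun i' => d m n i') M).
    + assert (H := rsum_single (fun i' => u n i') i M). destruct lt_dec; [|lia]. rewrite <- H.
      apply rsum_le. intros i' _. destruct (Nat.eq_dec i' i) as [->|]; [|apply D0].
      unfold d. rewrite <- Em. destruct Nat.eq_dec; [lra|easy].
    + assert (H := rsum_single (fun n' => rsum (fun i' => d m n' i') M) n M). destruct lt_dec; [|lia].
      rewrite <- H. apply rsum_le. intros n' _. destruct Nat.eq_dec; [lra|]. now apply rsum_nonneg.
  - rewrite rsum_swap. apply rsum_le. intros n _. rewrite rsum_swap. apply rsum_le. intros i _.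
    assert (H := rsum_single (fun _ => u n i) (Cantor.to_nat (n, i)) M). cbv beta in H. unfold d. rewrite H.
    specialize (Hu n i). destruct lt_dec; lra.
Qed.

Definition ocost {T : Type} (cost : T -> R) (o : option T) : R := match o with Some t => cost t | None => 0 end.

Lemma rsum_nth_error {T : Type} (cost : T -> R) (l : list T) M : (forall t, In t l -> 0 <= cost t) ->
  rsum (fun i => ocost cost (nth_error l i)) M <= lsum cost l.
Proof.
  intros H. assert (H0 : forall k, 0 <= ocost cost (nth_error l k)).
  { intros k. destruct (nth_error l k) eqn:E; simpl; [|lra]. apply H. eapply nth_error_In; eauto. }
  apply Rle_trans with (rsum (fun i => ocost cost (nth_error l i)) (M + length l)).
  { apply rsum_mono; auto. lia. }
  clear H H0. revert l. assert (Hshift : forall (f : nat -> R) n, rsum f (S n) = f 0%nat + rsum (fun i => f (S i)) n).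
  { intros f n. induction n as [|n IH]; [simpl; lra|]. cbn [rsum] in *. lra. }
  induction l as [|a l IH].
  - simpl. rewrite (rsum_ext _ (fun _ => 0)), rsum_zero; [lra|]. intros i _. now destruct i.
  - simpl length. rewrite Nat.add_succ_r, Hshift. simpl. lra.
Qed.

Lemma flatten_lists {T : Type} (cost : T -> R) (L : nat -> list T) (c : nat -> R) C :
  (forall n t, In t (L n) -> 0 <= cost t) -> (forall n, lsum cost (L n) <= c n) -> (forall M, rsum c M <= C) ->
  exists p : nat -> option T, (forall m t, p m = Some t -> exists n, In t (L n)) /\
    (forall n t, In t (L n) -> exists m, p m = Some t) /\ forall M, rsum (fun m => ocost cost (p m)) M <= C.
Proof.
  intros H0 H1 H2. exists (fun m => nth_error (L (fst (Cantor.of_nat m))) (snd (Cantor.of_nat m))). split; [|split].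
  - intros m t E. exists (fst (Cantor.of_nat m)). eapply nth_error_In; eauto.
  - intros n t Ht. apply In_nth_error in Ht. destruct Ht as [i Hi]. exists (Cantor.to_nat (n, i)).
    now rewrite Cantor.cancel_of_to.
  - apply (rsum_pair (fun n i => ocost cost (nth_error (L n) i)) c); auto.
    + intros n i. destruct (nth_error (L n) i) eqn:E; simpl; [|lra]. apply (H0 n). eapply nth_error_In; eauto.
    + intros n M. eapply Rle_trans; [apply rsum_nth_error; intros t; apply (H0 n)|apply H1].
Qed.

Definition bcost (s : R) (b : R * R) : R := Rpower (snd b) s.

(** Vanishing of the [s]-dimensional Hausdorff measure, for [s > 0]. Radii are left free because a
    small sum of powers makes each of them small; [None] encodes an absent ball. *)
Definition snull (s : R) (E : R -> Prop) : Prop := forall e, 0 < e -> exists b : nat -> option (R * R),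
  (forall n t, b n = Some t -> 0 < snd t) /\
  (forall x, E x -> exists n t, b n = Some t /\ Rabs (x - fst t) < snd t) /\
  forall M, rsum (fun n => ocost (bcost s) (b n)) M <= e.

Lemma snull_subset s E F : (forall x, E x -> F x) -> snull s F -> snull s E.
Proof.
  intros H HF e He. destruct (HF e He) as [b [h1 [h2 h3]]]. exists b. split; auto.
Qed.

Lemma snull_union s (E : nat -> R -> Prop) : (forall n, snull s (E n)) -> snull s (fun x => exists n, E n x).
Proof.
  intros H e He.
  assert (Hn : forall n, 0 < e * / 2 ^ S n) by (intros; apply Rmult_lt_0_compat; auto; apply Rinv_0_lt_compat, pow_lt; lra).
  set (P := fun n (b : nat -> option (R * R)) =>
    (forall i t, b i = Some t -> 0 < snd t) /\
    (forall x, E n x -> exists i t, b i = Some t /\ Rabs (x - fst t) < snd t) /\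
    forall M, rsum (fun i => ocost (bcost s) (b i)) M <= e * / 2 ^ S n).
  set (B := fun n => epsilon (inhabits (fun _ => None)) (P n)).
  assert (HB : forall n, P n (B n)) by (intros n; apply epsilon_spec, (H n _ (Hn n))).
  exists (fun m => B (fst (Cantor.of_nat m)) (snd (Cantor.of_nat m))). split; [|split].
  - intros m t Ht. eapply HB; eauto.
  - intros x [n Hx]. destruct (HB n) as [_ [h _]]. destruct (h x Hx) as [i [t [h1 h2]]].
    exists (Cantor.to_nat (n, i)), t. now rewrite Cantor.cancel_of_to.
  - apply (rsum_pair (fun n i => ocost (bcost s) (B n i)) (fun n => e * / 2 ^ S n)).
    + intros n i. destruct (B n i); simpl; [|lra]. left. apply Rpower_pos.
    + intros n. apply HB.
    + intros M. rewrite rsum_scal. assert (Hg := rsum_geom_le M). nra.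
Qed.

(** Common engine of [content_null] and [hausdorff_null]: the pieces replacing a ball are dyadic
    intervals in the one, intervals of a well chosen diameter in the other. *)
Lemma snull_pieces {T : Type} (mem : T -> R -> Prop) (ok : T -> Prop) (cost : T -> R) s C E : 0 < s ->
  (forall t, ok t -> 0 <= cost t) -> snull s E ->
  (exists r0, 0 < r0 /\ forall a r, 0 < r <= r0 -> exists l : list T,
     (forall t, In t l -> ok t) /\ lsum cost l <= C * Rpower r s /\
     forall x, Rabs (x - a) < r -> exists t, In t l /\ mem t x) ->
  forall e, 0 < e -> exists p : nat -> option T, (forall m t, p m = Some t -> ok t) /\
    (forall x, E x -> exists m t, p m = Some t /\ mem t x) /\ forall M, rsum (fun m => ocost cost (p m)) M <= e.
Proof.
  intros Hs Hcost HE [r0 [Hr0 Hp]] e He.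
  set (C' := Rmax C 1). assert (HC1 : 1 <= C') by apply Rmax_r. assert (HC2 : C <= C') by apply Rmax_l.
  (* Bounding the whole sum by [r0^s] forces every ball to have radius at most [r0]. *)
  set (d := Rmin (e / C') (Rpower r0 s)).
  assert (Hd : 0 < d) by (apply Rmin_glb_lt; [apply Rdiv_lt_0_compat; lra|apply Rpower_pos]).
  destruct (HE d Hd) as [b [Hb1 [Hb2 Hb3]]].
  assert (B0 : forall n, 0 <= ocost (bcost s) (b n)).
  { intros n. destruct (b n); simpl; [left; apply Rpower_pos|lra]. }
  assert (Hbr : forall n t, b n = Some t -> 0 < snd t <= r0).
  { intros n t E1. split; [now apply (Hb1 n)|]. apply Rnot_lt_le. intros Hlt.
    specialize (Hb3 (S n)). simpl in Hb3. rewrite E1 in Hb3. simpl in Hb3. unfold bcost in Hb3 at 2.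
    assert (0 <= rsum (fun n => ocost (bcost s) (b n)) n) by now apply rsum_nonneg.
    assert (Rpower r0 s < Rpower (snd t) s) by (apply Rlt_Rpower_l; lra).
    assert (d <= Rpower r0 s) by apply Rmin_r. lra. }
  set (P := fun n l => (forall t, In t l -> ok t) /\ lsum cost l <= C' * ocost (bcost s) (b n) /\
     forall x t, b n = Some t -> Rabs (x - fst t) < snd t -> exists t, In t l /\ mem t x).
  assert (HP : forall n, exists l, P n l).
  { intros n. destruct (b n) as [[a r]|] eqn:E1.
    - destruct (Hp a r) as [l [l1 [l2 l3]]]; [apply (Hbr n (a, r)); auto|]. exists l. split; auto. split.
      + rewrite E1. simpl. unfold bcost. simpl. assert (Hq := Rpower_pos r s). nra.
      + intros x t E2. rewrite E1 in E2. inversion E2; subst. simpl. auto.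
    - exists nil. split; [intros t []|]. split; [rewrite E1; simpl; lra|]. intros x t E2. rewrite E1 in E2. discriminate. }
  set (L := fun n => epsilon (inhabits nil) (P n)).
  assert (HL : forall n, P n (L n)) by (intros n; apply epsilon_spec, HP).
  destruct (flatten_lists cost L (fun n => C' * ocost (bcost s) (b n)) e) as [p [p1 [p2 p3]]].
  - intros n t Ht. apply Hcost. now apply (HL n).
  - intros n. apply HL.
  - intros M. rewrite rsum_scal. specialize (Hb3 M). assert (d <= e / C') by apply Rmin_l.
    apply Rmult_le_reg_l with (/ C'); [apply Rinv_0_lt_compat; lra|].
    replace (/ C' * (C' * rsum (fun i => ocost (bcost s) (b i)) M)) with (rsum (fun i => ocost (bcost s) (b i)) M) by (field; lra).
    unfold Rdiv in H. lra.
  - exists p. split; [|split; auto].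
    + intros m t E1. destruct (p1 m t E1) as [n Hn]. now apply (HL n).
    + intros x Hx. destruct (Hb2 x Hx) as [n [t [h1 h2]]]. destruct (HL n) as [_ [_ h3]].
      destruct (h3 x t h1 h2) as [t' [h4 h5]]. destruct (p2 n t' h4) as [m Hm]. now exists m, t'.
Qed.

(** * The sets [Kstar] and [Omega_star] *)

Lemma Kstar_anti n u v x : u <= v -> Kstar n v x -> Kstar n u x.
Proof.
  intros Huv H [l Hl]. apply H. exists l. intros a [h1 [h [h2 h3]]]. apply Hl. split; auto. exists h. split; auto.
  eapply Rlt_le_trans; [exact h3|]. apply Rle_Rpower; [|lra]. apply IZR_le. now apply height_ge1 in h2.
Qed.

Lemma Kstar_avoid n v x l : Kstar n v x -> exists a h, alg_deg_le n a /\ height a h /\ ~ In a l /\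
  Rabs (x - a) < Rpower (IZR h) (- v - 1).
Proof.
  intros H. apply NNPP. intros Hn. apply H. exists l. intros a [h1 [h [h2 h3]]]. apply NNPP. intros h4. apply Hn.
  now exists a, h.
Qed.

(** The members of a finite list other than [x] stay at a positive distance from [x], so a number
    [a <> x] closer than that is not in the list. *)
Lemma approx_set_Kstar w x n : approx_set w x -> Kstar (S n) (INR (S n) * w) x.
Proof.
  intros H [l Hl].
  destruct (common_bound l (fun a m => x <> a -> / INR (S m) <= Rabs (x - a))) as [m Hm].
  - intros a i j Hij Hi Hne. eapply Rle_trans; [|now apply Hi]. apply Rinv_le_contravar; [apply lt_0_INR; lia|].
    apply le_INR. lia.
  - intros a _. destruct (Req_dec x a) as [->|Hne]; [exists 0%nat; easy|].
    assert (Hp : 0 < Rabs (x - a)) by (apply Rabs_pos_lt; lra).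
    destruct (archimed_cor1 _ Hp) as [m [h1 h2]]. exists m. intros _. apply Rlt_le. eapply Rle_lt_trans; [|exact h1].
    apply Rinv_le_contravar; [now apply lt_0_INR|]. apply le_INR. lia.
  - destruct (H n m) as [a [h [h1 [h2 [h3 [h4 h5]]]]]].
    assert (In a l) by (apply Hl; split; auto; exists h; auto).
    assert (x <> a) by (intros ->; replace (a - a) with 0 in h3 by lra; rewrite Rabs_R0 in h3; lra).
    specialize (Hm a H0 H1). lra.
Qed.

Lemma near_alg_open w n m : open_set (near_alg w n m).
Proof.
  intros x [a [h [h1 [h2 [h3 [h4 h5]]]]]].
  set (e := Rmin (Rabs (x - a)) (Rmin (/ INR (S m) - Rabs (x - a)) (Rpower (IZR h) (- (INR (S n) * w) - 1) - Rabs (x - a)))).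
  assert (e1 := Rmin_l (Rabs (x - a)) (Rmin (/ INR (S m) - Rabs (x - a)) (Rpower (IZR h) (- (INR (S n) * w) - 1) - Rabs (x - a)))).
  assert (e2 := Rmin_r (Rabs (x - a)) (Rmin (/ INR (S m) - Rabs (x - a)) (Rpower (IZR h) (- (INR (S n) * w) - 1) - Rabs (x - a)))).
  fold e in e1, e2.
  assert (e3 := Rmin_l (/ INR (S m) - Rabs (x - a)) (Rpower (IZR h) (- (INR (S n) * w) - 1) - Rabs (x - a))).
  assert (e4 := Rmin_r (/ INR (S m) - Rabs (x - a)) (Rpower (IZR h) (- (INR (S n) * w) - 1) - Rabs (x - a))).
  exists e. split; [unfold e; repeat apply Rmin_glb_lt; lra|].
  intros y Hy. exists a, h. split; auto. split; auto.
  assert (t1 := Rabs_triang (y - x) (x - a)). replace (y - x + (x - a)) with (y - a) in t1 by lra.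
  assert (t2 := Rabs_triang (x - y) (y - a)). replace (x - y + (y - a)) with (x - a) in t2 by lra.
  rewrite (Rabs_minus_sym x y) in t2. lra.
Qed.

Lemma approx_set_G_delta w : G_delta (approx_set w).
Proof.
  exists (fun i => near_alg w (fst (Cantor.of_nat i)) (snd (Cantor.of_nat i))). split.
  - intros i. apply near_alg_open.
  - intros x. split; [intros H i; apply H|]. intros H n m. specialize (H (Cantor.to_nat (n, m))).
    now rewrite Cantor.cancel_of_to in H.
Qed.

Lemma omega_star_n_ge n v x : -1 < v -> Kstar n v x -> Rbar_le (Finite v) (omega_star_n n x).
Proof. intros Hv H. apply Rbar_sup_ub. now exists v. Qed.

Lemma Rbar_le_approx w v : (forall i, Rbar_le (Finite (w - / INR (S i))) v) -> Rbar_le (Finite w) v.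
Proof.
  intros H. destruct v as [r| |]; [|exact I|exact (H 0%nat)]. apply Rnot_lt_le. intros Hlt.
  destruct (archimed_cor1 (w - r)) as [m [h1 h2]]; [lra|].
  assert (Hi := H (pred m)). replace (S (pred m)) with m in Hi by lia. unfold Rbar_le in Hi. lra.
Qed.

(** The upper limit and the suprema are tested at the levels [w - 1/(i+1)], which suffices because
    [Kstar] shrinks as its exponent grows. Both the Borel property and the covers are derived from
    this form. *)
Lemma Omega_star_iff w x : 1 < w ->
  (Omega_star w x <-> forall i K, exists k, (K <= k)%nat /\ Kstar (S k) (INR (S k) * (w - / INR (S i))) x).
Proof.
  intros Hw. unfold Omega_star, omega_star, Rbar_limsup. split.
  - intros H i K. set (v := w - / INR (S i)).
    assert (Hv : v < w) by (unfold v; assert (0 < / INR (S i)) by (apply Rinv_0_lt_compat, lt_0_INR; lia); lra).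
    set (U := fun k => Rbar_scal (/ INR (S k)) (omega_star_n (S k) x)) in *.
    assert (H1 : ~ Rbar_le (Rbar_sup (fun y => exists n, (K <= n)%nat /\ y = U n)) (Finite v)).
    { intros h. assert (Hc : Rbar_le (Finite w) (Finite v)); [|simpl in Hc; lra].
      eapply Rbar_le_trans; [exact H|]. eapply Rbar_le_trans; [|exact h]. apply Rbar_inf_lb. now exists K. }
    apply Rbar_sup_gt in H1. destruct H1 as [y [[k [Hk ->]] Hy]]. exists k. split; auto.
    assert (Hp : 0 < INR (S k)) by (apply lt_0_INR; lia).
    assert (H2 : ~ Rbar_le (omega_star_n (S k) x) (Finite (INR (S k) * v))).
    { intros h. apply Hy. unfold U. replace (Finite v) with (Rbar_scal (/ INR (S k)) (Finite (INR (S k) * v))).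
      - apply scal_le; auto. now apply Rinv_0_lt_compat.
      - unfold Rbar_scal. f_equal. field. lra. }
    apply Rbar_sup_gt in H2. destruct H2 as [z [[v' [h1 [h2 ->]]] h3]]. change (~ v' <= INR (S k) * v) in h3.
    apply Kstar_anti with v'; auto. lra.
  - intros H. apply Rbar_inf_glb. intros y [K ->].
    set (U := fun k => Rbar_scal (/ INR (S k)) (omega_star_n (S k) x)) in *.
    set (Sp := Rbar_sup (fun w0 => exists n, (K <= n)%nat /\ w0 = U n)).
    assert (Hi : forall i, Rbar_le (Finite (w - / INR (S i))) Sp).
    { intros i. destruct (H i K) as [k [Hk HK]].
      assert (Hp : 0 < INR (S k)) by (apply lt_0_INR; lia).
      assert (Hi1 : / INR (S i) <= 1).
      { rewrite <- Rinv_1. apply Rinv_le_contravar; [lra|]. rewrite S_INR. assert (h := pos_INR i). lra. }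
      apply Rbar_le_trans with (U k); [|apply Rbar_sup_ub; now exists k].
      unfold U. replace (Finite (w - / INR (S i))) with (Rbar_scal (/ INR (S k)) (Finite (INR (S k) * (w - / INR (S i))))).
      - apply scal_le; [now apply Rinv_0_lt_compat|]. apply omega_star_n_ge; auto.
        assert (0 <= INR (S k) * (w - / INR (S i))); [apply Rmult_le_pos; lra|lra].
      - unfold Rbar_scal. f_equal. field. split; [|lra]. assert (0 < INR (S i)) by (apply lt_0_INR; lia). lra. }
    now apply Rbar_le_approx.
Qed.

Lemma approx_set_Omega w x : 1 < w -> approx_set w x -> Omega_star w x.
Proof.
  intros Hw H. apply Omega_star_iff; auto. intros i K. exists K. split; auto.
  apply Kstar_anti with (INR (S K) * w); [|now apply approx_set_Kstar].
  apply Rmult_le_compat_l; [apply pos_INR|]. assert (0 < / INR (S i)) by (apply Rinv_0_lt_compat, lt_0_INR; lia). lra.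
Qed.

Lemma borel_ext (E F : R -> Prop) : (forall x, E x <-> F x) -> borel E -> borel F.
Proof.
  intros H HE. replace F with E; auto. apply functional_extensionality. intros x. now apply propositional_extensionality.
Qed.

Lemma borel_inter (E : nat -> R -> Prop) : (forall n, borel (E n)) -> borel (fun x => forall n, E n x).
Proof.
  intros H. apply borel_ext with (fun x => ~ exists n, ~ E n x).
  - intros x. split; intros h.
    + intros n. apply NNPP. intros h'. apply h. now exists n.
    + intros [n h']. now apply h'.
  - apply borel_compl, borel_union. intros n. now apply borel_compl.
Qed.

Definition alg_of_height (n H : nat) : list R :=
  proj1_sig (constructive_indefinite_description _ (alg_list_R n H)).

Lemma alg_of_height_spec n H : (length (alg_of_height n H) <= (S (2 * H)) ^ (S n) * S n)%nat /\
  forall a h, alg_deg_le n a -> height a h -> (h <= Z.of_nat H)%Z -> In a (alg_of_height n H).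
Proof. unfold alg_of_height. apply proj2_sig. Qed.

(** Infinitude need only be tested against the lists of all numbers of height at most [M], for each
    [M]; every test is an open condition. *)
Lemma Kstar_borel n v : borel (Kstar n v).
Proof.
  set (U := fun M x => exists a h, alg_deg_le n a /\ height a h /\ ~ In a (alg_of_height n M) /\
    Rabs (x - a) < Rpower (IZR h) (- v - 1)).
  apply borel_ext with (fun x => forall M, U M x).
  - intros x. split.
    + intros H [l Hl].
      destruct (common_bound l (fun a M => (exists h, height a h) -> exists h, height a h /\ (h <= Z.of_nat M)%Z)) as [M HM].
      * intros a i j Hij Hi Hh. destruct (Hi Hh) as [h [h1 h2]]. exists h. split; auto. lia.
      * intros a _. destruct (classic (exists h, height a h)) as [[h Hh]|Hn]; [|exists 0%nat; easy].
        exists (Z.to_nat h). intros _. exists h. split; auto. lia.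
      * destruct (H M) as [a [h [h1 [h2 [h3 h4]]]]]. apply h3.
        destruct (HM a) as [h' [h5 h6]]; [apply Hl; split; auto; now exists h|now exists h|].
        now apply (proj2 (alg_of_height_spec n M)) with h'.
    + intros H M. now apply Kstar_avoid.
  - apply borel_inter. intros M. apply borel_open. intros x [a [h [h1 [h2 [h3 h4]]]]].
    exists (Rpower (IZR h) (- v - 1) - Rabs (x - a)). split; [lra|]. intros y Hy. exists a, h. repeat split; auto.
    assert (t1 := Rabs_triang (y - x) (x - a)). replace (y - x + (x - a)) with (y - a) in t1 by lra. lra.
Qed.

Lemma Omega_star_borel w : 1 < w -> borel (Omega_star w).
Proof.
  intros Hw. apply borel_ext with (fun x => forall i K, exists k, Kstar (S (K + k)) (INR (S (K + k)) * (w - / INR (S i))) x).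
  - intros x. rewrite Omega_star_iff by auto. split; intros H i K; destruct (H i K) as [k Hk].
    + exists (K + k)%nat. split; auto. lia.
    + exists (k - K)%nat. destruct Hk as [h1 h2]. replace (K + (k - K))%nat with k by lia. exact h2.
  - apply borel_inter. intros i. apply borel_inter. intros K. apply borel_union. intros k. apply Kstar_borel.
Qed.

(* Crude count: at most [(3 h)^(n+1) (n+1)] numbers of height [h], so that the costs are summable like [1/h^2]. *)
Lemma Kstar_snull n v s : 0 < s -> INR n + 3 <= s * (v + 1) -> snull s (Kstar n v).
Proof.
  intros Hs Hv e He. set (K := 3 ^ S n * INR (S n)).
  assert (HK : 0 < K) by (apply Rmult_lt_0_compat; [apply pow_lt; lra|apply lt_0_INR; lia]).
  destruct (archimed_cor1 (e / K)) as [h0 [A1 A2]]; [now apply Rdiv_lt_0_compat|].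
  assert (Hh0 : 1 <= INR h0) by (apply (le_INR 1); lia).
  set (r := fun m => Rpower (INR (S h0 + m)) (- v - 1)).
  destruct (flatten_lists (bcost s) (fun m => map (fun a => (a, r m)) (alg_of_height n (S h0 + m)))
    (fun m => K * (/ INR (h0 + m) - / INR (S (h0 + m)))) e) as [p [p1 [p2 p3]]].
  - intros m t _. left. apply Rpower_pos.
  - intros m. destruct (alg_of_height_spec n (S h0 + m)) as [Hlen _].
    set (l := alg_of_height n (S h0 + m)) in *. set (X := INR (S (h0 + m))).
    assert (HX : 1 < X) by (unfold X; rewrite S_INR, plus_INR; assert (t := pos_INR m); lra).
    assert (Hc : lsum (bcost s) (map (fun a => (a, r m)) l) = INR (length l) * Rpower (r m) s).
    { clear. induction l as [|a l IH]; [simpl; lra|]. cbn [map length lsum fold_right]. unfold lsum in IH. rewrite IH, S_INR.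
      unfold bcost. simpl. lra. }
    rewrite Hc. change (S h0 + m)%nat with (S (h0 + m)) in *. unfold r. change (S h0 + m)%nat with (S (h0 + m)). fold X. rewrite Rpower_mult.
    assert (L1 : INR (length l) <= K * X ^ S n).
    { apply le_INR in Hlen. rewrite mult_INR, pow_INR in Hlen. eapply Rle_trans; [exact Hlen|].
      unfold K. replace (3 ^ S n * INR (S n) * X ^ S n) with ((3 * X) ^ S n * INR (S n)) by (rewrite Rpow_mult_distr; ring).
      apply Rmult_le_compat_r; [apply pos_INR|]. apply pow_incr. split; [apply pos_INR|].
      rewrite S_INR, mult_INR. fold X. simpl INR at 1. lra. }
    assert (L2 : Rpower X ((- v - 1) * s) <= / X ^ S (S (S n))).
    { rewrite <- Rpower_pow, <- Rpower_Ropp by lra. apply Rle_Rpower; [lra|]. rewrite !S_INR. lra. }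
    assert (P1 : 0 < X ^ S n) by (apply pow_lt; lra).
    assert (P3 : 0 < Rpower X ((- v - 1) * s)) by apply Rpower_pos.
    apply Rle_trans with (K * X ^ S n * / X ^ S (S (S n))).
    + apply Rmult_le_compat; auto; [apply pos_INR|lra].
    + replace (K * X ^ S n * / X ^ S (S (S n))) with (K * / (X * X)) by (change (X ^ S (S (S n))) with (X * (X * X ^ S n)); field; lra).
      apply Rmult_le_compat_l; [lra|]. assert (EX : INR (h0 + m) = X - 1) by (unfold X; rewrite S_INR; lra). rewrite EX.
      fold X. replace (/ (X - 1) - / X) with (/ ((X - 1) * X)) by (field; lra). apply Rinv_le_contravar; nra.
  - intros M. rewrite rsum_scal.
    assert (Ht : rsum (fun m => / INR (h0 + m) - / INR (S (h0 + m))) M = / INR h0 - / INR (h0 + M)).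
    { induction M as [|M IH]; cbn [rsum]; [rewrite Nat.add_0_r; lra|]. rewrite IH, Nat.add_succ_r. lra. }
    rewrite Ht. assert (0 < / INR (h0 + M)) by (apply Rinv_0_lt_compat, lt_0_INR; lia).
    apply Rle_trans with (K * (e / K)); [apply Rmult_le_compat_l; lra|]. right. field. lra.
  - exists p. split; [|split; auto].
    + intros k t E. destruct (p1 k t E) as [m Hm]. apply in_map_iff in Hm. destruct Hm as [a [<- _]]. apply Rpower_pos.
    + intros x Hx. destruct (Kstar_avoid n v x (alg_of_height n h0) Hx) as [a [h [h1 [h2 [h3 h4]]]]].
      assert (Hh : (Z.of_nat h0 < h)%Z).
      { destruct (Z_lt_dec (Z.of_nat h0) h); auto. exfalso. apply h3.
        apply (proj2 (alg_of_height_spec n h0)) with h; auto. lia. }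
      set (m := (Z.to_nat h - S h0)%nat).
      assert (Em : (S h0 + m)%nat = Z.to_nat h) by (unfold m; lia).
      destruct (p2 m (a, r m)) as [k Hk].
      { apply in_map_iff. exists a. split; auto. apply (proj2 (alg_of_height_spec n (S h0 + m))) with h; auto. lia. }
      exists k, (a, r m). split; auto. simpl. unfold r. rewrite Em, INR_IZR_INZ, Z2Nat.id by lia. exact h4.
Qed.

(** Only large degrees matter. For [v] slightly below [w] with [s v > 1], the crude requirement
    [n + 3 <= s (n v + 1)] holds for all large [n], since [n (s v - 1)] eventually exceeds 3. *)
Lemma Omega_star_snull w s : 1 < w -> / w < s -> snull s (Omega_star w).
Proof.
  intros Hw Hs. assert (0 < / w) by (apply Rinv_0_lt_compat; lra).
  assert (Hsw : 1 < s * w).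
  { apply Rmult_lt_reg_r with (/ w); auto. rewrite Rmult_assoc, Rinv_r; lra. }
  destruct (archimed_cor1 ((s * w - 1) / (2 * s))) as [m [A1 A2]]; [apply Rdiv_lt_0_compat; lra|].
  set (v := w - / INR (S (pred m))).
  assert (Hv : (s * w - 1) / 2 <= s * v - 1).
  { unfold v. replace (S (pred m)) with m by lia.
    assert (s * / INR m <= s * ((s * w - 1) / (2 * s))) by (apply Rmult_le_compat_l; lra).
    replace (s * ((s * w - 1) / (2 * s))) with ((s * w - 1) / 2) in H0 by (field; lra). lra. }
  destruct (archimed_cor1 ((s * w - 1) / 6)) as [K [B1 B2]]; [lra|].
  assert (HK : 0 < INR K) by now apply lt_0_INR.
  assert (HK3 : 3 <= INR K * (s * v - 1)).
  { assert (1 <= INR K * ((s * w - 1) / 6)).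
    { apply Rle_trans with (INR K * / INR K); [rewrite Rinv_r; lra|]. apply Rmult_le_compat_l; lra. }
    nra. }
  apply snull_subset with (fun x => exists k, Kstar (S (K + k)) (INR (S (K + k)) * v) x).
  - intros x Hx. rewrite Omega_star_iff in Hx by auto. destruct (Hx (pred m) K) as [k [h1 h2]].
    exists (k - K)%nat. replace (K + (k - K))%nat with k by lia. exact h2.
  - apply snull_union. intros k. apply Kstar_snull; [lra|].
    assert (INR K <= INR (S (K + k))) by (apply le_INR; lia). nra.
Qed.

Lemma snull_lebesgue E : snull 1 E -> lebesgue E = Finite 0.
Proof.
  intros HE. apply Rbar_le_antisym.
  - apply Rbar_le_dense. intros e He. destruct (HE (e / 2)) as [b [h1 [h2 h3]]]; [lra|].
    set (r := fun n => ocost snd (b n)). set (c := fun n => ocost fst (b n)).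
    assert (Hr : forall n, 0 <= r n).
    { intros n. unfold r. destruct (b n) eqn:E1; simpl; [left; eapply h1; eauto|lra]. }
    apply Rbar_le_trans with (Rbar_series (fun n => Finite (c n + r n - (c n - r n)))).
    + apply Rbar_inf_lb. exists (fun n => c n - r n), (fun n => c n + r n). split; [|split; [|reflexivity]].
      * intros n. specialize (Hr n). lra.
      * intros x Hx. destruct (h2 x Hx) as [n [t [h4 h5]]]. exists n. unfold c, r. rewrite h4. simpl.
        apply Rabs_def2 in h5. lra.
    + apply series_le with (fun n => 2 * r n); [intros; f_equal; lra|]. intros M. rewrite rsum_scal.
      specialize (h3 M). rewrite (rsum_ext _ r) in h3; [lra|]. intros n _. unfold r. destruct (b n) eqn:E1; auto.
      simpl. unfold bcost. rewrite Rpower_1; auto. eapply h1; eauto.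
  - apply Rbar_inf_glb. intros y [a [b [_ [_ ->]]]]. apply series_nonneg.
Qed.

(** * Hausdorff measure and net content *)

Definition big_O (s : R) (h : Rbar -> Rbar) : Prop :=
  exists rho, 0 < rho /\ forall r, 0 < r < rho -> Rbar_le (h (Finite r)) (Finite (Rpower r s)).

Section Covers.
Variables (N : R -> R).
Hypothesis HN : is_norm N.

Lemma M_infty_mono h (E F : R -> Prop) : (forall x, E x -> F x) -> Rbar_le (M_infty N h E) (M_infty N h F).
Proof.
  intros H. apply Rbar_inf_glb. intros y [lam [h1 [h2 ->]]]. apply Rbar_inf_lb. exists lam. split; auto.
Qed.

Definition dcost (h : Rbar -> Rbar) (t : Z * Z) : R := fin (h (Finite (N 1 * len (fst t)))).

Definition admissible (h : Rbar -> Rbar) (t : Z * Z) : Prop :=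
  Rbar_lt (Finite (N 1 * len (fst t))) (eps_h h) /\ h (Finite (N 1 * len (fst t))) = Finite (dcost h t) /\ 0 <= dcost h t.

Lemma M_infty_le h E c (p : nat -> option (Z * Z)) : (forall m t, p m = Some t -> admissible h t) ->
  (forall x, E x -> exists m t, p m = Some t /\ dset t x) -> (forall M, rsum (fun m => ocost (dcost h) (p m)) M <= c) ->
  Rbar_le (M_infty N h E) (Finite c).
Proof.
  intros H1 H2 H3.
  apply Rbar_le_trans with (Rbar_series (fun n => match p n with Some (j, k) => h (diam N (dyadic j k)) | None => Finite 0 end)).
  - apply Rbar_inf_lb. exists p. split; [|split; [|reflexivity]].
    + intros x Hx. destruct (H2 x Hx) as [n [[j k] [E1 E2]]]. now exists n, j, k.
    + intros n j k E1. rewrite diam_dyadic by auto. now apply (H1 n (j, k)).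
  - apply series_le with (fun m => ocost (dcost h) (p m)); auto. intros n. destruct (p n) as [[j k]|] eqn:E1; [|reflexivity].
    rewrite diam_dyadic by auto. now apply (H1 n (j, k)).
Qed.

Lemma small_admissible h : d_normalized h -> exists e, 0 < e /\ forall t, N 1 * len (fst t) <= e -> admissible h t.
Proof.
  intros Hh. destruct (normalized_near0 h Hh) as [e1 [He1 [F1 _]]]. destruct (normalized_eps h Hh) as [e2 [He2 F2]].
  exists (Rmin e1 (e2 / 2)). split; [apply Rmin_glb_lt; lra|]. intros t Ht.
  assert (m1 := Rmin_l e1 (e2 / 2)). assert (m2 := Rmin_r e1 (e2 / 2)).
  assert (0 < N 1 * len (fst t)) by (apply Rmult_lt_0_compat; [now apply norm1_pos|apply len_pos]).
  split; [|apply F1; lra]. split.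
  - eapply Rbar_le_trans; [|exact F2]. simpl. lra.
  - intros E. rewrite <- E in F2. simpl in F2. lra.
Qed.

Definition run (j k : Z) (n : nat) : list (Z * Z) := map (fun i => (j, k + Z.of_nat i)%Z) (seq 0 n).

Lemma run_mem j k n x : IZR k * len j <= x < (IZR k + INR n) * len j -> exists t, In t (run j k n) /\ dset t x.
Proof.
  intros Hx. assert (Hl := len_pos j). destruct (dyadic_ex j x) as [m Hm]. exists (j, m). split; [|exact Hm].
  unfold dyadic in Hm. fold (len j) in Hm. apply in_map_iff. exists (Z.to_nat (m - k)).
  assert (A1 : (k < m + 1)%Z) by (apply lt_IZR; rewrite plus_IZR; nra).
  assert (A2 : (m < k + Z.of_nat n)%Z) by (apply lt_IZR; rewrite plus_IZR, <- INR_IZR_INZ; nra).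
  split; [f_equal; lia|]. apply in_seq. lia.
Qed.

Lemma run_cost h j k n : lsum (dcost h) (run j k n) = INR n * fin (h (Finite (N 1 * len j))).
Proof.
  rewrite (lsum_ext _ (fun _ => fin (h (Finite (N 1 * len j))))).
  - rewrite lsum_const. unfold run. now rewrite length_map, length_seq.
  - intros t Ht. apply in_map_iff in Ht. destruct Ht as [i [<- _]]. reflexivity.
Qed.

Lemma run_fst j k n t : In t (run j k n) -> fst t = j.
Proof. intros Ht. apply in_map_iff in Ht. destruct Ht as [i [<- _]]. reflexivity. Qed.

Lemma content_null h s E : 0 < s -> d_normalized h -> big_O s h -> snull s E ->
  Rbar_le (M_infty N h E) (Finite 0).
Proof.
  intros Hs Hh [rho [Hrho HO]] HE. assert (Hc := norm1_pos N HN). set (c := N 1) in *.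
  destruct (small_admissible h Hh) as [e0 [He0 Hadm]].
  apply Rbar_le_dense. intros e He. rewrite Rplus_0_l.
  destruct (snull_pieces dset (admissible h) (dcost h) s (3 * Rpower (2 * c) s) E Hs) with (e := e) as [p [p1 [p2 p3]]]; auto.
  - intros t Ht. apply Ht.
  - set (d := Rmin e0 (rho / 2)). assert (Hd : 0 < d) by (apply Rmin_glb_lt; lra).
    assert (m1 := Rmin_l e0 (rho / 2)). assert (m2 := Rmin_r e0 (rho / 2)). fold d in m1, m2.
    exists (d / (2 * c)). split; [apply Rdiv_lt_0_compat; lra|]. intros a r Hr.
    assert (Hr2 : 2 * c * r <= d).
    { replace d with (2 * c * (d / (2 * c))) by (field; lra). apply Rmult_le_compat_l; lra. }
    (* From [len j <= 2 r < 2 len j], three consecutive dyadic intervals cover the ball. *)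
    destruct (len_bracket (2 * r)) as [j [B1 B2]]; [lra|]. destruct (dyadic_ex j (a - r)) as [k Hk].
    assert (Hl := len_pos j). assert (Hcl : 0 < c * len j <= 2 * c * r) by nra.
    unfold dyadic in Hk. fold (len j) in Hk.
    assert (Hat : forall t, In t (run j k 3) -> admissible h t).
    { intros t Ht. apply run_fst in Ht. apply Hadm. rewrite Ht. fold c. lra. }
    exists (run j k 3). split; [exact Hat|]. split.
    + rewrite run_cost. fold c. replace (INR 3) with 3 by (simpl; lra).
      rewrite Rmult_assoc, Rpower_mult_distr by lra. apply Rmult_le_compat_l; [lra|].
      assert (H1 : Rbar_le (h (Finite (c * len j))) (Finite (Rpower (c * len j) s))) by (apply HO; lra).
      destruct (Hadm (j, k)) as [_ [H2 _]]; [simpl; fold c; lra|]. simpl in H2. fold c in H2. rewrite H2 in H1. simpl in H1.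
      unfold dcost in H1. simpl in H1. fold c in H1. eapply Rle_trans; [exact H1|]. apply Rle_Rpower_l; lra.
    + intros x Hx. apply Rabs_def2 in Hx. apply run_mem. replace (INR 3) with 3 by (simpl; lra). lra.
  - now apply M_infty_le with p.
Qed.

Lemma diam_empty : diam N (fun _ => False) = Finite 0.
Proof.
  apply Rbar_sup_eq. split.
  - intros y [->|[x [_ [[] _]]]]. simpl. lra.
  - intros u Hu. apply Hu. now left.
Qed.

Lemma hausdorff_ge0 g E : Rbar_le (Finite 0) (hausdorff N g E).
Proof.
  apply Rbar_le_trans with (hausdorff_delta N g 1 E).
  - apply Rbar_inf_glb. intros y [C [_ [_ ->]]]. apply series_nonneg.
  - apply Rbar_sup_ub. exists 1. split; [lra|reflexivity].
Qed.

(* A ball is cut into intervals of the diameter [rho] that nearly realises the infimum in [normalize g]. *)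
Lemma hausdorff_null g s E : 0 < s -> is_gauge g -> big_O s (normalize g) -> snull s E -> hausdorff N g E = Finite 0.
Proof.
  intros Hs Hg [rho0 [Hrho HO]] HE. assert (Hc := norm1_pos N HN). set (c := N 1) in *.
  apply Rbar_le_antisym; [|apply hausdorff_ge0].
  apply Rbar_sup_lub. intros y [del [Hdel ->]]. apply Rbar_le_dense. intros e He. rewrite Rplus_0_l.
  set (cost := fun t : R * R => fin (g (Finite (c * snd t)))).
  set (ok := fun t : R * R => 0 < snd t /\ c * snd t <= del /\ g (Finite (c * snd t)) = Finite (cost t) /\ 0 <= cost t).
  destruct (snull_pieces (fun t x => fst t <= x <= fst t + snd t) ok cost s (4 * Rpower (2 * c) s) E Hs)
    with (e := e) as [p [p1 [p2 p3]]]; auto.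
  - intros t Ht. apply Ht.
  - set (d := Rmin del (rho0 / 2)). assert (Hd : 0 < d) by (apply Rmin_glb_lt; lra).
    assert (m1 := Rmin_l del (rho0 / 2)). assert (m2 := Rmin_r del (rho0 / 2)). fold d in m1, m2.
    exists (d / (2 * c)). split; [apply Rdiv_lt_0_compat; lra|]. intros a r Hr.
    assert (Hr2 : 0 < 2 * c * r <= d).
    { split; [nra|]. replace d with (2 * c * (d / (2 * c))) by (field; lra). apply Rmult_le_compat_l; lra. }
    set (D := 2 * c * r) in *. set (P := Rpower D s). assert (HP : 0 < P) by apply Rpower_pos.
    assert (HPD : 0 < P / D) by (apply Rdiv_lt_0_compat; lra).
    assert (Hm : Rbar_le (mean_inf g D) (Finite (P / D))).
    { rewrite <- (scal_inv_l D (mean_inf g D)), <- normalizeE by lra.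
      replace (Finite (P / D)) with (Rbar_scal (/ D) (Finite P)) by (simpl; f_equal; unfold Rdiv; lra).
      apply scal_le; [apply Rinv_0_lt_compat; lra|]. apply HO. lra. }
    destruct (Rbar_inf_lt _ _ (P / D) HPD Hm) as [y [[rho [R1 ->]] R2]].
    assert (R3 : Rbar_le (g (Finite rho)) (Finite (2 * rho * (P / D)))).
    { rewrite <- (scal_inv_r rho (g (Finite rho))) by lra.
      replace (Finite (2 * rho * (P / D))) with (Rbar_scal rho (Finite (P / D + P / D))) by (unfold Rbar_scal; f_equal; lra).
      apply scal_le; [lra|exact R2]. }
    assert (R4 : Rbar_le (Finite 0) (g (Finite rho))) by (apply gauge_nonneg; auto; lra).
    assert (R5 := finite_between _ _ R4 R3).
    assert (R6 : 0 <= fin (g (Finite rho)) <= 2 * rho * (P / D)) by (rewrite R5 in R3, R4; split; assumption).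
    set (l := rho / c). assert (Hl : 0 < l) by (apply Rdiv_lt_0_compat; lra).
    assert (Hcl : c * l = rho) by (unfold l; field; lra).
    assert (Hl2 : l <= 2 * r) by (apply Rmult_le_reg_l with c; auto; unfold D in R1; lra).
    destruct (archimed (2 * r / l)) as [U1 U2].
    assert (Hq : 1 <= 2 * r / l).
    { apply Rmult_le_reg_r with l; auto. replace (2 * r / l * l) with (2 * r) by (field; lra). lra. }
    set (m := Z.to_nat (up (2 * r / l))).
    assert (Hup : (0 < up (2 * r / l))%Z) by (apply lt_IZR; lra).
    assert (Hm1 : INR m = IZR (up (2 * r / l))) by (unfold m; rewrite INR_IZR_INZ, Z2Nat.id by lia; reflexivity).
    assert (Hm2 : 2 * r < INR m * l).
    { rewrite Hm1. apply Rmult_lt_reg_r with (/ l); [now apply Rinv_0_lt_compat|].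
      replace (IZR (up (2 * r / l)) * l * / l) with (IZR (up (2 * r / l))) by (field; lra). unfold Rdiv in U1. lra. }
    assert (Hm3 : INR m <= 2 * (D / rho)).
    { rewrite Hm1. replace (D / rho) with (2 * r / l) by (unfold l, D; field; lra). lra. }
    exists (map (fun i => (a - r + INR i * l, l)) (seq 0 m)). split; [|split].
    + intros t Ht. apply in_map_iff in Ht. destruct Ht as [i [<- _]]. unfold ok, cost. simpl. rewrite Hcl.
      split; auto. split; [lra|]. split; [exact R5|apply R6].
    + rewrite (lsum_ext _ (fun _ => fin (g (Finite rho)))).
      * rewrite lsum_const, length_map, length_seq, Rmult_assoc, Rpower_mult_distr by lra. fold D P.
        apply Rle_trans with (2 * (D / rho) * (2 * rho * (P / D))).
        -- apply Rmult_le_compat; [apply pos_INR|apply R6|exact Hm3|apply R6].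
        -- right. field. lra.
      * intros t Ht. apply in_map_iff in Ht. destruct Ht as [i [<- _]]. unfold cost. simpl. now rewrite Hcl.
    + intros x Hx. apply Rabs_def2 in Hx.
      assert (Hfind : forall k, x < a - r + INR k * l -> exists i, (i < k)%nat /\ a - r + INR i * l <= x <= a - r + INR i * l + l).
      { induction k as [|k IH]; [simpl; lra|]. intros hk. destruct (Rlt_le_dec x (a - r + INR k * l)) as [h|h].
        - destruct (IH h) as [i [h1 h2]]. exists i. split; auto.
        - exists k. rewrite S_INR in hk. split; [lia|lra]. }
      destruct (Hfind m) as [i [h1 h2]]; [lra|]. exists (a - r + INR i * l, l). split; [|exact h2].
      apply in_map_iff. exists i. split; auto. apply in_seq. lia.
  - set (C := fun n x => match p n with Some t => fst t <= x <= fst t + snd t | None => False end).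
    assert (HC : forall n, g (diam N (C n)) = Finite (ocost cost (p n)) /\ Rbar_le (diam N (C n)) (Finite del)).
    { intros n. unfold C. destruct (p n) as [t|] eqn:E1; simpl.
      - destruct (p1 n t E1) as [h1 [h2 [h3 h4]]]. rewrite (diam_interval N HN (fst t) (fst t + snd t)); [|lra|intros; lra|auto].
        replace (fst t + snd t - fst t) with (snd t) by lra. fold c. split; [exact h3|exact h2].
      - rewrite diam_empty. split; [apply Hg|simpl; lra]. }
    apply Rbar_le_trans with (Rbar_series (fun n => g (diam N (C n)))).
    + apply Rbar_inf_lb. exists C. split; [|split; [|reflexivity]].
      * intros x Hx. destruct (p2 x Hx) as [n [t [h1 h2]]]. exists n. unfold C. now rewrite h1.
      * intros n. apply HC.
    + apply series_le with (fun n => ocost cost (p n)); auto. intros n. apply HC.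
Qed.

(** A set of diameter [d > 0] is covered by five dyadic intervals of diameter at most [d], at cost
    at most [5 g(d)] because [normalize g <= g]. A nonempty set of diameter 0 costs nothing on the
    Hausdorff side and receives tiny intervals paid from a summable error. *)
Lemma hausdorff_content g E : is_gauge g -> hausdorff N g E = Finite 0 -> Rbar_le (M_infty N (normalize g) E) (Finite 0).
Proof.
  intros Hg HE. assert (Hc := norm1_pos N HN). set (c := N 1) in *. set (h := normalize g).
  assert (Hh : d_normalized h) by now apply normalize_normalized.
  destruct (small_admissible h Hh) as [e0 [He0 Hadm]].
  destruct (normalized_near0 h Hh) as [e1 [He1 [F1 [F2 _]]]].
  set (del := Rmin e0 e1). assert (Hdel : 0 < del) by now apply Rmin_glb_lt.
  assert (m1 : del <= e0) by apply Rmin_l. assert (m2 : del <= e1) by apply Rmin_r.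
  apply Rbar_le_dense. intros e He. rewrite Rplus_0_l.
  assert (Hd : Rbar_le (hausdorff_delta N g del E) (Finite 0)).
  { rewrite <- HE. apply Rbar_sup_ub. now exists del. }
  (* Five times [e / 6] for the intervals and one more [e / 6] for the errors add up to [e]. *)
  destruct (Rbar_inf_lt _ 0 (e / 6) ltac:(lra) Hd) as [y [[C [C1 [C2 ->]]] C3]]. rewrite Rplus_0_l in C3.
  assert (Dn : forall n, exists d, diam N (C n) = Finite d /\ 0 <= d <= del).
  { intros n. assert (h1 := diam_nonneg N (C n)). specialize (C2 n). assert (E1 := finite_between _ _ h1 C2).
    exists (fin (diam N (C n))). split; [exact E1|]. rewrite E1 in h1, C2. split; assumption. }
  assert (Gn : forall n, Rbar_le (Finite 0) (g (diam N (C n)))).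
  { intros n. destruct (Dn n) as [d [-> h1]]. apply gauge_nonneg; auto. lra. }
  destruct (series_le_inv _ _ Gn C3) as [v [v1 v2]].
  set (P := fun n l => (forall t, In t l -> admissible h t) /\ lsum (dcost h) l <= 5 * v n + e / 6 * / 2 ^ S n /\
     forall x, C n x -> exists t, In t l /\ dset t x).
  assert (HP : forall n, exists l, P n l).
  { intros n. destruct (Dn n) as [d [Ed Hdd]]. destruct (v1 n) as [V1 V2]. rewrite Ed in V1.
    assert (Heta : 0 < e / 6 * / 2 ^ S n) by (apply Rmult_lt_0_compat; [lra|]; apply Rinv_0_lt_compat, pow_lt; lra).
    destruct (classic (exists x0, C n x0)) as [[x0 Hx0]|Hno].
    2: { exists nil. split; [intros t []|]. split; [cbn [lsum fold_right]; lra|]. intros x Hx. exfalso. apply Hno. now exists x. }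
    assert (HCx : forall x, C n x -> c * Rabs (x - x0) <= d).
    { intros x Hx. apply (diam_le N HN (C n)); auto. rewrite Ed. apply Rbar_le_refl. }
    assert (Hj : exists j, c * len j <= del /\ fin (h (Finite (c * len j))) <= v n + e / 6 * / 2 ^ S n / 5 /\ d < 2 * (c * len j)).
    { destruct (Rle_lt_or_eq_dec 0 d (proj1 Hdd)) as [hd|<-].
      - destruct (len_bracket (d / c)) as [j [B1 B2]]; [now apply Rdiv_lt_0_compat|]. exists j.
        assert (Hdc : c * (d / c) = d) by (field; lra). assert (Hl := len_pos j).
        assert (Hcl : c * len j <= d) by nra. split; [lra|]. split; [|nra].
        assert (fin (h (Finite (c * len j))) <= fin (h (Finite d))) by (apply F2; nra).
        assert (Hhd : Rbar_le (h (Finite d)) (g (Finite d))) by now apply normalize_le.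
        destruct (F1 d) as [Eh _]; [lra|]. rewrite Eh, V1 in Hhd. unfold Rbar_le in Hhd. lra.
      - destruct Hh as [[_ [_ [Hlim _]]] _].
        destruct (Hlim (e / 6 * / 2 ^ S n / 5)) as [rho [Hrho Hl]]; [lra|].
        destruct (len_small (Rmin rho del / c)) as [j Hj]; [apply Rdiv_lt_0_compat; auto; now apply Rmin_glb_lt|].
        specialize (Hj j (Z.le_refl _)). assert (Hlp := len_pos j). exists j.
        assert (Hcl : c * len j < Rmin rho del).
        { replace (Rmin rho del) with (c * (Rmin rho del / c)) by (field; lra). now apply Rmult_lt_compat_l. }
        assert (n1 := Rmin_l rho del). assert (n2 := Rmin_r rho del).
        assert (Hcl0 : 0 < c * len j) by nra. split; [lra|]. split; [|lra].
        assert (Hle : Rbar_le (h (Finite (c * len j))) (Finite (e / 6 * / 2 ^ S n / 5))) by (apply Hl; lra).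
        destruct (F1 (c * len j)) as [Eh _]; [lra|]. rewrite Eh in Hle. unfold Rbar_le in Hle. lra. }
    destruct Hj as [j [J1 [J2 J3]]]. destruct (dyadic_ex j (x0 - d / c)) as [k Hk].
    exists (run j k 5). split; [|split].
    - intros t Ht. apply run_fst in Ht. apply Hadm. rewrite Ht. fold c. lra.
    - rewrite run_cost. fold c. replace (INR 5) with 5 by (simpl; lra). lra.
    - intros x Hx. apply run_mem. replace (INR 5) with 5 by (simpl; lra). unfold dyadic in Hk. fold (len j) in Hk.
      specialize (HCx x Hx). assert (Hdc : c * (d / c) = d) by (field; lra).
      assert (Rabs (x - x0) <= d / c) by nra. assert (d / c < 2 * len j) by nra.
      assert (t1 := Rle_abs (x - x0)). assert (t2 := Rle_abs (- (x - x0))). rewrite Rabs_Ropp in t2. lra. }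
  set (L := fun n => epsilon (inhabits nil) (P n)).
  assert (HL : forall n, P n (L n)) by (intros n; apply epsilon_spec, HP).
  destruct (flatten_lists (dcost h) L (fun n => 5 * v n + e / 6 * / 2 ^ S n) e) as [p [p1 [p2 p3]]].
  - intros n t Ht. apply (HL n) in Ht. apply Ht.
  - intros n. apply HL.
  - intros M. rewrite rsum_plus, !rsum_scal. assert (Hg2 := rsum_geom_le M). specialize (v2 M). nra.
  - apply M_infty_le with p; auto.
    + intros m t E1. destruct (p1 m t E1) as [n Hn]. now apply (HL n).
    + intros x Hx. destruct (C1 x Hx) as [n Hn]. destruct (HL n) as [_ [_ h3]]. destruct (h3 x Hn) as [t [h4 h5]].
      destruct (p2 n t h4) as [m Hm]. now exists m, t.
Qed.

End Covers.

(** * Powers of a normalized gauge function *)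

Definition rpow (t : R) (y : Rbar) : Rbar :=
  match y with
  | Finite r => if Rlt_dec 0 r then Finite (Rpower r t) else Finite 0
  | p_infty => p_infty
  | m_infty => Finite 0
  end.

Lemma rpow_pos t r : 0 < r -> rpow t (Finite r) = Finite (Rpower r t).
Proof. intros Hr. unfold rpow. destruct Rlt_dec; [reflexivity|lra]. Qed.

Lemma rpow_nonneg t y : Rbar_le (Finite 0) (rpow t y).
Proof.
  destruct y as [r| |]; simpl; auto; [|lra]. destruct Rlt_dec; simpl; [left; apply Rpower_pos|lra].
Qed.

Lemma rpow_mono t x y : 0 <= t -> Rbar_le x y -> Rbar_le (rpow t x) (rpow t y).
Proof.
  intros Ht Hxy. destruct x as [r| |].
  - destruct y as [s| |]; [|apply Rbar_le_p_infty|destruct Hxy].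
    simpl in Hxy. destruct (Rlt_dec 0 r) as [Hr|Hr].
    + rewrite !rpow_pos by lra. simpl. apply Rle_Rpower_l; lra.
    + unfold rpow at 1. destruct Rlt_dec; [contradiction|]. apply rpow_nonneg.
  - destruct y; [destruct Hxy|exact I|destruct Hxy].
  - apply rpow_nonneg.
Qed.

Section PowerGauge.
Variables (g : Rbar -> Rbar) (t : R).
Hypotheses (Hg : G_infty g) (Ht : 0 < t < 1).

Definition gpow (x : Rbar) : Rbar := rpow t (normalize g x).

Lemma normalize_pos_near0 : exists e, 0 < e /\
  (forall r, 0 < r < e -> normalize g (Finite r) = Finite (fin (normalize g (Finite r))) /\ 0 < fin (normalize g (Finite r))) /\
  (forall r s, 0 < r -> r <= s -> s < e -> fin (normalize g (Finite r)) <= fin (normalize g (Finite s))) /\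
  (forall r s, 0 < r -> r <= s -> s < e -> fin (normalize g (Finite s)) / s <= fin (normalize g (Finite r)) / r).
Proof.
  destruct (normalized_near0 (normalize g)) as [e1 [He1 [F1 [F2 F3]]]]; [now apply normalize_normalized, Hg|].
  destruct (superlin_pos (normalize g)) as [e2 [He2 F4]]; [now apply G_infty_superlin|].
  assert (m1 := Rmin_l e1 e2). assert (m2 := Rmin_r e1 e2).
  exists (Rmin e1 e2). split; [now apply Rmin_glb_lt|]. split; [|split].
  - intros r Hr. destruct (F1 r) as [E1 E2]; [lra|]. split; auto. destruct (F4 r) as [h|h]; [lra|exact h|].
    rewrite h in E1. discriminate.
  - intros; apply F2; lra.
  - intros; apply F3; lra.
Qed.

Lemma gpow_gauge : is_gauge gpow.
Proof.
  destruct (normalize_gauge g) as [_ [[e [He Hm]] [Hlim [H0 Hinf]]]]; [apply Hg|].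
  split; [|split; [|split; [|split]]].
  - intros [r| |]; auto. intros _. apply rpow_nonneg.
  - exists e. split; auto. intros r s h0 h1 h2. apply rpow_mono; [lra|]. now apply Hm.
  - intros eta Heta. destruct (Rpower_small t eta) as [d [Hd1 Hd2]]; [lra|auto|].
    destruct (Hlim d Hd1) as [rho [Hrho H1]]. exists rho. split; auto. intros r Hr.
    apply Rbar_le_trans with (rpow t (Finite d)); [apply rpow_mono; [lra|auto]|].
    rewrite rpow_pos by auto. apply Hd2. lra.
  - unfold gpow. rewrite H0. unfold rpow. destruct Rlt_dec; [lra|reflexivity].
  - unfold gpow. rewrite Hinf. reflexivity.
Qed.

(** For [r <= s], [g_1(s) <= g_1(r) s/r], where [g_1] is the normalization of [g]; raising to the
    power [t] and using [(s/r)^t <= s/r] gives the same inequality for [gpow]. *)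
Lemma gpow_normalized : d_normalized gpow.
Proof.
  destruct normalize_pos_near0 as [e [He [F1 [F2 F3]]]]. apply ratio_normalized with e; [apply gpow_gauge|auto|].
  intros r s Hr Hrs Hs. unfold gpow.
  destruct (F1 r) as [E1 P1]; [lra|]. destruct (F1 s) as [E2 P2]; [lra|]. specialize (F3 r s Hr Hrs Hs).
  rewrite E1, E2, !rpow_pos by auto. unfold Rbar_scal, Rbar_le.
  set (x := fin (normalize g (Finite r))) in *. set (y := fin (normalize g (Finite s))) in *.
  assert (Hq : 1 <= s / r).
  { apply Rmult_le_reg_r with r; auto. replace (s / r * r) with s by (field; lra). lra. }
  assert (Hy : y <= x * (s / r)).
  { apply Rmult_le_reg_r with (/ s); [apply Rinv_0_lt_compat; lra|].
    replace (x * (s / r) * / s) with (x / r) by (field; lra). exact F3. }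
  assert (Hp : Rpower y t <= Rpower x t * (s / r)).
  { apply Rle_trans with (Rpower x t * Rpower (s / r) t).
    - rewrite Rpower_mult_distr by lra. apply Rle_Rpower_l; lra.
    - apply Rmult_le_compat_l; [left; apply Rpower_pos|].
      apply Rle_trans with (Rpower (s / r) 1); [apply Rle_Rpower; lra|rewrite Rpower_1; lra]. }
  apply Rmult_le_reg_l with s; [lra|]. replace (s * (/ s * Rpower y t)) with (Rpower y t) by (field; lra).
  replace (s * (/ r * Rpower x t)) with (Rpower x t * (s / r)) by (field; lra). exact Hp.
Qed.

(** The quotient is [normalize g] to the power [t - 1 < 0], so it grows to infinity as the
    normalization decreases to 0. *)
Lemma gpow_prec : prec gpow (normalize g).
Proof.
  destruct normalize_pos_near0 as [e [He [F1 [F2 F3]]]]. right. exists e. split; auto.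
  assert (Hr : forall r, 0 < r < e -> gpow (Finite r) = Finite (Rpower (fin (normalize g (Finite r))) t) /\
    fin (gpow (Finite r)) / fin (normalize g (Finite r)) = Rpower (fin (normalize g (Finite r))) (- (1 - t))).
  { intros r h. destruct (F1 r h) as [E1 P1].
    assert (E2 : gpow (Finite r) = Finite (Rpower (fin (normalize g (Finite r))) t)).
    { unfold gpow. rewrite E1 at 1. now apply rpow_pos. }
    split; auto. rewrite E2. cbn [fin]. set (x := fin (normalize g (Finite r))) in *.
    replace (- (1 - t)) with (t + - (1)) by lra. rewrite Rpower_plus, Rpower_Ropp, Rpower_1 by auto. reflexivity. }
  split; [|split].
  - intros r h. destruct (F1 r h) as [E1 P1], (Hr r h) as [E2 _]. split; [eexists; exact E2|]. split; [eexists; exact E1|auto].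
  - intros r s h0 h1 h2. destruct (Hr r) as [_ ->]; [lra|]. destruct (Hr s) as [_ ->]; [lra|].
    apply Rpower_anti; [lra|]. split; [apply F1; lra|]. apply F2; lra.
  - intros M. destruct (Rpower_small (1 - t) (/ (Rabs M + 1))) as [d [Hd1 Hd2]]; [lra| |].
    { apply Rinv_0_lt_compat. generalize (Rabs_pos M). lra. }
    destruct (normalize_gauge g) as [_ [_ [Hlim _]]]; [apply Hg|]. destruct (Hlim d Hd1) as [rho [Hrho H1]].
    assert (m1 := Rmin_l rho e). assert (m2 := Rmin_r rho e).
    exists (Rmin rho e). split; [now apply Rmin_glb_lt|]. intros r h.
    destruct (Hr r) as [_ ->]; [lra|]. specialize (H1 r ltac:(lra)). destruct (F1 r) as [E1 P1]; [lra|].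
    rewrite E1 in H1. simpl in H1. rewrite Rpower_Ropp.
    specialize (Hd2 _ (conj P1 H1)). assert (Hp := Rpower_pos (fin (normalize g (Finite r))) (1 - t)).
    apply Rlt_le_trans with (/ / (Rabs M + 1)); [|now apply Rinv_le_contravar].
    rewrite Rinv_inv. generalize (Rle_abs M). lra.
Qed.

(** Near 0 the normalization is at most 1, and a power below 1 does not decrease it. *)
Lemma gpow_superlin : superlin gpow.
Proof.
  intros M. destruct (G_infty_superlin g Hg M) as [e1 [He1 H1]].
  destruct normalize_pos_near0 as [e2 [He2 [F1 _]]].
  destruct (normalize_gauge g) as [_ [_ [Hlim _]]]; [apply Hg|]. destruct (Hlim 1) as [e3 [He3 H3]]; [lra|].
  exists (Rmin (Rmin e1 e2) e3). split; [repeat apply Rmin_glb_lt; auto|]. intros r Hr.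
  assert (m1 := Rmin_l (Rmin e1 e2) e3). assert (m2 := Rmin_r (Rmin e1 e2) e3).
  assert (m3 := Rmin_l e1 e2). assert (m4 := Rmin_r e1 e2).
  apply Rbar_le_trans with (normalize g (Finite r)); [apply H1; lra|].
  destruct (F1 r) as [E1 P1]; [lra|]. specialize (H3 r ltac:(lra)). unfold gpow. rewrite E1 in H3 |- *. rewrite rpow_pos by auto.
  set (x := fin (normalize g (Finite r))) in *. simpl in H3 |- *.
  replace x with (Rpower x t * Rpower x (1 - t)) at 1.
  - assert (A := Rpower_pos x t). assert (Rpower x (1 - t) <= 1); [|nra].
    replace 1 with (Rpower 1 (1 - t)) at 2 by (unfold Rpower; rewrite ln_1, Rmult_0_r; apply exp_0).
    apply Rle_Rpower_l; lra.
  - rewrite <- Rpower_plus. replace (t + (1 - t)) with 1 by lra. now apply Rpower_1.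
Qed.

Lemma gpow_big_O s : big_O s (normalize g) -> big_O (t * s) gpow.
Proof.
  intros [rho [Hrho H]]. exists rho. split; auto. intros r Hr. unfold gpow.
  apply Rbar_le_trans with (rpow t (Finite (Rpower r s))); [apply rpow_mono; [lra|auto]|].
  rewrite rpow_pos by apply Rpower_pos. rewrite Rpower_mult, (Rmult_comm s t). apply Rbar_le_refl.
Qed.

End PowerGauge.

(** * Describability of the sets [Omega_star] *)

Lemma prec_ge h g : G_infty g -> prec h (normalize g) -> exists e, 0 < e /\
  forall r, 0 < r < e -> Rbar_le (normalize g (Finite r)) (h (Finite r)).
Proof.
  intros Hg [[e [He H]]|[e [He [H1 [_ H3]]]]].
  (* The convention for vanishing gauges cannot occur, since the normalization of [g] is
     superlinear, hence positive near 0. *)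
  - exfalso. destruct (superlin_pos _ (G_infty_superlin g Hg)) as [rho [Hrho Hp]].
    assert (m1 := Rmin_l rho e). assert (m2 := Rmin_r rho e). assert (m3 : 0 < Rmin rho e) by now apply Rmin_glb_lt.
    specialize (Hp (Rmin rho e / 2) ltac:(lra)). rewrite H in Hp by lra. simpl in Hp. destruct Hp; [lra|discriminate].
  - destruct (H3 1) as [rho [Hrho Hr]]. exists (Rmin rho e). split; [now apply Rmin_glb_lt|]. intros r h0.
    assert (m1 := Rmin_l rho e). assert (m2 := Rmin_r rho e).
    destruct (H1 r) as [[x Ex] [[y Ey] Hy]]; [lra|]. specialize (Hr r ltac:(lra)). rewrite Ex, Ey in *. simpl in *.
    apply Rmult_lt_compat_r with (r := y) in Hr; auto. replace (x / y * y) with x in Hr by (field; lra). lra.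
Qed.

Lemma superlin_ge h g e : 0 < e -> (forall r, 0 < r < e -> Rbar_le (g (Finite r)) (h (Finite r))) -> superlin g -> superlin h.
Proof.
  intros He H Hs M. destruct (Hs M) as [rho [Hrho Hr]]. exists (Rmin rho e). split; [now apply Rmin_glb_lt|].
  intros r h0. assert (m1 := Rmin_l rho e). assert (m2 := Rmin_r rho e).
  eapply Rbar_le_trans; [apply Hr; lra|apply H; lra].
Qed.

Lemma freq_ge w h g e : 0 < e -> (forall r, 0 < r < e -> Rbar_le (g (Finite r)) (h (Finite r))) -> freq w g -> freq w h.
Proof.
  intros He H Hs s hs. destruct (Hs s hs) as [eta [Heta Hq]]. exists eta. split; auto. intros rho Hrho.
  assert (m1 := Rmin_l rho e). assert (m2 := Rmin_r rho e).
  destruct (Hq (Rmin rho e)) as [r [h0 h1]]; [now apply Rmin_glb_lt|]. exists r. split; [lra|]. intros h2. apply h1.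
  eapply Rbar_le_trans; [apply H; lra|exact h2].
Qed.

Lemma not_G_s_big_O s0 g : G_infty g -> ~ G_s s0 g -> exists s, s0 < s /\ big_O s (normalize g).
Proof.
  intros Hg H. apply NNPP. intros Hn. apply H. split; auto. intros s Hs Ho. apply Hn. exists s. split; auto.
  destruct (Ho 1) as [rho [Hrho Hr]]; [lra|]. exists rho. split; auto. intros r h. specialize (Hr r h).
  now rewrite Rmult_1_l in Hr.
Qed.

Lemma unit_interval_open : open_set (fun x => 0 < x < 1).
Proof.
  intros x Hx. exists (Rmin x (1 - x)). split; [apply Rmin_glb_lt; lra|]. intros y Hy.
  assert (m1 := Rmin_l x (1 - x)). assert (m2 := Rmin_r x (1 - x)). apply Rabs_def2 in Hy. lra.
Qed.

(** The normalization of [g] itself serves as test gauge: [approx_set] has full, hence positive,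
    content in the unit interval, whereas vanishing Hausdorff measure would make this content
    zero. *)
Lemma G_s_hausdorff N w g : is_norm N -> 1 < w -> G_s (/ w) g -> hausdorff N g (Omega_star w) <> Finite 0.
Proof.
  intros HN Hw Hg HE. assert (Hgi : G_infty g) by apply Hg.
  assert (Hd : d_normalized (normalize g)) by (apply normalize_normalized, Hgi).
  assert (Hs := G_infty_superlin g Hgi).
  apply (interval_content_pos N (normalize g) HN Hd Hs 0 1); [lra|].
  rewrite <- (approx_set_content N (normalize g) HN Hd Hs w); auto; [|now apply G_s_freq|apply unit_interval_open].
  eapply Rbar_le_trans; [|apply (hausdorff_content N HN g (Omega_star w)); [apply Hgi|exact HE]].
  apply M_infty_mono. intros x [Hx _]. now apply approx_set_Omega.
Qed.

Theorem theorem12p6 :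
  forall (N : R -> R), is_norm N ->
  forall w : R, 1 < w ->
    s_describable N (/ w) (Omega_star w) (fun _ => True).
Proof.
  intros N HN w Hw. assert (Hw0 : 0 < / w < 1).
  { split; [apply Rinv_0_lt_compat; lra|]. rewrite <- Rinv_1. apply Rinv_lt_contravar; lra. }
  assert (EU : (fun x => Omega_star w x /\ True) = Omega_star w).
  { apply functional_extensionality. intros x. apply propositional_extensionality. tauto. }
  split; [|split].
  - split; [now apply Omega_star_borel|]. rewrite EU. apply snull_lebesgue, Omega_star_snull; lra.
  - intros g. unfold majorizing. rewrite EU. split.
    + intros [Hg HE]. split; auto. intros Hs. now apply (G_s_hausdorff N w g).
    + intros [Hg Hn]. split; auto. destruct (not_G_s_big_O _ _ Hg Hn) as [s [Hs HO]].
      apply hausdorff_null with s; auto; [lra|apply Hg|now apply Omega_star_snull].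
  - intros g. split.
    + intros [[_ [F [[_ HF] HFO]]] Hg]. apply NNPP. intros Hn. destruct (not_G_s_big_O _ _ Hg Hn) as [s [Hs HO]].
      (* The midpoint between [1/(w s)] and 1, so that [t s = (s + 1/w) / 2] is still above
         [1/w]. *)
      set (t := (1 + / (w * s)) / 2).
      assert (Hws : 1 < w * s).
      { apply Rmult_lt_reg_l with (/ w); [lra|]. rewrite <- Rmult_assoc, Rinv_l; lra. }
      assert (Hi : 0 < / (w * s) < 1).
      { split; [apply Rinv_0_lt_compat; lra|]. rewrite <- Rinv_1. apply Rinv_lt_contravar; lra. }
      assert (Ht : 0 < t < 1) by (unfold t; lra).
      assert (Hts : / w < t * s).
      { replace (t * s) with ((s + / w) / 2) by (unfold t; field; split; nra). lra. }
      apply (interval_content_pos N (gpow g t) HN (gpow_normalized g t Hg Ht) (gpow_superlin g t Hg Ht) 0 1); [lra|].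
      rewrite <- (HF (gpow g t) (gpow_normalized g t Hg Ht) (gpow_prec g t Hg Ht) _ unit_interval_open) by auto.
      apply content_null with (t * s); auto; [nra|now apply gpow_normalized|now apply gpow_big_O|].
      apply snull_subset with (Omega_star w); [|now apply Omega_star_snull]. intros x [Hx _]. now apply HFO.
    + intros HG. assert (Hg : G_infty g) by apply HG. split; auto. split.
      * split; [apply Hg|]. rewrite (proj2 Hg). split; [exact I|discriminate].
      * exists (approx_set w). split; [|intros x; now apply approx_set_Omega].
        split; [apply approx_set_G_delta|]. intros h Hh Hp V HV _.
        destruct (prec_ge h g Hg Hp) as [e [He Hge]].
        apply approx_set_content; auto.
        -- apply superlin_ge with (normalize g) e; auto. now apply G_infty_superlin.
        -- apply freq_ge with (normalize g) e; auto. now apply G_s_freq.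
Qed.
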